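(* Let $Y$ be a Lévy process in $\mathbb{R}^d$. The following are equivalent: (C1) The density $p(t,x)$ of $Y_t$ exists and there are $T_1\in(0,\infty]$, $c_1>0$ such that $\sup_{x\in\mathbb{R}^d}p(t,x)\le c_1[h^{-1}(1/t)]^{-d}$ for all $0<t<T_1$. (C2) There are $T_2\in(0,\infty]$, $c_2>0$ such that $\int_{\mathbb{R}^d}e^{-t\,\mathrm{Re}[\Psi(z)]}dz\le c_2[h^{-1}(1/t)]^{-d}$ for all $0<t<T_2$. (C3) There are $T_3\in(0,\infty]$, $c_3\in(0,1]$, $\alpha_3\in(0,2]$ such that $c_3\Psi^*(|x|)\le \mathrm{Re}[\Psi(x)]$ for all $|x|>1/T_3$, and $\Psi^*(\lambda r)\ge c_3\lambda^{\alpha_3}\Psi^*(r)$ for all $\lambda\ge1$, $r>1/T_3$. (C4) There are $T_4\in(0,\infty]$, $c_4\in[1,\infty)$ such that for all $|x|>1/T_4$, $\Psi^*(|x|)\le c_4\big(\langle x,Ax\rangle+\int_{|\langle x,z\rangle|<1}|\langle x,z\rangle|^2N(dz)\big)$. Moreover, if one of (C1)–(C4) holds with $T_i=\infty$, then each of (C1)–(C4) holds with $T_i=\infty$.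
   Context: $Y$ has generating triplet $(A,N,b)$: $A$ symmetric non-negative definite matrix, $b\in\mathbb{R}^d$, $N$ Lévy measure; $\Psi$ is the characteristic exponent, $\mathbb{E}e^{i\langle x,Y_t\rangle}=e^{-t\Psi(x)}$, $\Psi(x)=\langle x,Ax\rangle-i\langle x,b\rangle-\int(e^{i\langle x,z\rangle}-1-i\langle x,z\rangle\mathbf{1}_{|z|<1})N(dz)$. For $r>0$: $h(r)=r^{-2}\|A\|+\int(1\wedge|x|^2/r^2)N(dx)$ and $\Psi^*(r)=\sup_{|z|\le r}\mathrm{Re}\,\Psi(z)$. Standing assumption $h(0^+)=\infty$ (i.e. $Y$ is not a compound Poisson process with drift); $h$ is continuous strictly decreasing from $\infty$ to $0$, $h^{-1}$ its inverse. Convention $1/\infty=0$. *)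

(* Defs.v *)
(* MathComp-Analysis over an abstract R : realType.
   R^d is modelled as d.-tuple R with its product sigma-algebra
   (= Borel sigma-algebra of R^d). *)
From HB Require Import structures.
From mathcomp Require Import all_boot all_order all_algebra.
From mathcomp Require Import all_classical all_reals all_analysis.
Set Implicit Arguments. Unset Strict Implicit. Unset Printing Implicit Defensive.
Import Order.TTheory GRing.Theory Num.Theory.
Import numFieldNormedType.Exports.
Local Open Scope classical_set_scope.
Local Open Scope ring_scope.

Section levy_defs.
Variables (R : realType) (d : nat).
Notation vec := (d.-tuple R).

Definition ip (x y : vec) : R := \sum_(i < d) tnth x i * tnth y i.
Definition enorm (x : vec) : R := Num.sqrt (ip x x).
Definition vsub (x y : vec) : vec := [tuple tnth x i - tnth y i | i < d].
Definition vzero : vec := [tuple (0 : R) | i < d].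
Definition vscale (a : R) (x : vec) : vec := [tuple a * tnth x i | i < d].
Definition mxapp (A : 'M[R]_d) (x : vec) : vec :=
  [tuple \sum_(j < d) A i j * tnth x j | i < d].
Definition qf (A : 'M[R]_d) (x : vec) : R := ip x (mxapp A x).
Definition opnorm (A : 'M[R]_d) : R :=
  sup [set enorm (mxapp A x) | x in [set x : vec | enorm x <= 1]].

(* d-dimensional Lebesgue measure, characterized by its values on boxes
   (a, b] (this determines it uniquely on the product = Borel sigma-algebra) *)
Definition is_lebesgue_tuple (lam : set vec -> \bar R) : Prop :=
  forall a b : vec,
    lam [set x : vec | forall i, tnth a i < tnth x i <= tnth b i] =
    (\prod_(i < d) Num.max (tnth b i - tnth a i) 0)%:E.

Definition sym_nonneg_def (A : 'M[R]_d) : Prop :=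
  A^T = A /\ forall x : vec, 0 <= qf A x.
Definition levy_measure (N : {measure set vec -> \bar R}) : Prop :=
  N [set vzero] = 0%E /\
  (\int[N]_z (Num.min 1 (enorm z ^+ 2))%:E < +oo)%E.

(* Real and imaginary parts of the characteristic exponent
   Psi(x) = <x,Ax> - i<x,b> - \int (e^{i<x,z>} - 1 - i<x,z>1_{|z|<1}) N(dz) *)
Definition RePsi (A : 'M[R]_d) (N : {measure set vec -> \bar R}) (x : vec) : R :=
  qf A x + Rintegral N setT (fun z => 1 - cos (ip x z)).
Definition ImPsi (N : {measure set vec -> \bar R}) (b : vec) (x : vec) : R :=
  - ip x b
  - Rintegral N setT (fun z => sin (ip x z) - ip x z * (if enorm z < 1 then 1 else 0)).

Definition PsiStar (A : 'M[R]_d) (N : {measure set vec -> \bar R}) (r : R) : R :=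
  sup [set RePsi A N z | z in [set z : vec | enorm z <= r]].

Definition hfun (A : 'M[R]_d) (N : {measure set vec -> \bar R}) (r : R) : \bar R :=
  ((r ^- 2 * opnorm A)%:E
   + \int[N]_z (Num.min 1 (enorm z ^+ 2 / r ^+ 2))%:E)%E.
(* h^{-1}(s): since h is continuous strictly decreasing from oo to 0,
   h^{-1}(s) = inf {r > 0 | h r <= s} for s > 0 *)
Definition hinv (A : 'M[R]_d) (N : {measure set vec -> \bar R}) (s : R) : R :=
  inf [set r : R | 0 < r /\ (hfun A N r <= s%:E)%E].

Definition recip (T : \bar R) : R := if T is r%:E then r^-1 else 0.
End levy_defs.

Section levy_process.
Context {R : realType} {d : nat} {dO : measure_display} {Omega : measurableType dO}.
Variables (P : probability Omega R) (Y : R -> Omega -> d.-tuple R).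

Definition levy_process : Prop :=
  (forall t, measurable_fun setT (Y t)) /\
  P [set w | Y 0 w = vzero R d] = 1%E /\
  (forall (n : nat) (s : 'I_n.+1 -> R),
     0 <= s ord0 -> (forall i : 'I_n, s (widen_ord (leqnSn n) i) <= s (lift ord0 i)) ->
     forall B : 'I_n -> set (d.-tuple R), (forall i, measurable (B i)) ->
     P (\bigcap_(i in [set: 'I_n])
          [set w | B i (vsub (Y (s (lift ord0 i)) w) (Y (s (widen_ord (leqnSn n) i)) w))])
     = (\prod_(i < n)
          P [set w | B i (vsub (Y (s (lift ord0 i)) w) (Y (s (widen_ord (leqnSn n) i)) w))])%E) /\
  (forall s t, 0 <= s -> 0 <= t -> forall B : set (d.-tuple R), measurable B ->
     P [set w | B (vsub (Y (s + t) w) (Y s w))] = P [set w | B (Y t w)]) /\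
  (forall t, 0 <= t -> forall eps eta : R, 0 < eps -> 0 < eta ->
     exists delta : R, 0 < delta /\ forall s, 0 <= s -> `|s - t| < delta ->
       (P [set w | (eps < enorm (vsub (Y s w) (Y t w)))%R] < eta%:E)%E).

(* Y has generating triplet (A, N, b):  E e^{i<x,Y_t>} = e^{-t Psi(x)},
   written via real and imaginary parts *)
Definition has_triplet (A : 'M[R]_d) (N : {measure set (d.-tuple R) -> \bar R})
    (b : d.-tuple R) : Prop :=
  forall t, 0 <= t -> forall x : d.-tuple R,
    (\int[P]_w (cos (ip x (Y t w)))%:E =
       (expR (- t * RePsi A N x) * cos (t * ImPsi N b x))%:E)%E /\
    (\int[P]_w (sin (ip x (Y t w)))%:E =
       (- (expR (- t * RePsi A N x) * sin (t * ImPsi N b x)))%:E)%E.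

Definition is_density (lam : {measure set (d.-tuple R) -> \bar R}) (t : R)
    (p : d.-tuple R -> R) : Prop :=
  measurable_fun setT p /\ (forall x, 0 <= p x) /\
  forall B : set (d.-tuple R), measurable B ->
    P [set w | B (Y t w)] = (\int[lam]_(x in B) (p x)%:E)%E.

Definition C1 (lam : {measure set (d.-tuple R) -> \bar R}) (A : 'M[R]_d)
    (N : {measure set (d.-tuple R) -> \bar R}) (T : \bar R) : Prop :=
  (forall t, 0 < t -> exists p, is_density lam t p) /\
  exists c1 : R, 0 < c1 /\ forall t : R, 0 < t -> (t%:E < T)%E ->
    exists p, is_density lam t p /\
      forall x, p x <= c1 * (hinv A N t^-1) ^- d.
End levy_process.

Section conditions.
Variables (R : realType) (d : nat).
Definition C2 (lam : {measure set (d.-tuple R) -> \bar R}) (A : 'M[R]_d)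
    (N : {measure set (d.-tuple R) -> \bar R}) (T : \bar R) : Prop :=
  exists c2 : R, 0 < c2 /\ forall t : R, 0 < t -> (t%:E < T)%E ->
    (\int[lam]_z (expR (- t * RePsi A N z))%:E
       <= (c2 * (hinv A N t^-1) ^- d)%:E)%E.

Definition C3 (A : 'M[R]_d) (N : {measure set (d.-tuple R) -> \bar R}) (T : \bar R) : Prop :=
  exists c3 alpha3 : R, 0 < c3 <= 1 /\ 0 < alpha3 <= 2 /\
    (forall x : d.-tuple R, recip T < enorm x ->
       c3 * PsiStar A N (enorm x) <= RePsi A N x) /\
    (forall lambda r : R, 1 <= lambda -> recip T < r ->
       c3 * lambda `^ alpha3 * PsiStar A N r <= PsiStar A N (lambda * r)).

Definition C4 (A : 'M[R]_d) (N : {measure set (d.-tuple R) -> \bar R}) (T : \bar R) : Prop :=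
  exists c4 : R, 1 <= c4 /\
    forall x : d.-tuple R, recip T < enorm x ->
      ((PsiStar A N (enorm x))%:E <=
        c4%:E * ((qf A x)%:E
          + \int[N]_(z in [set z | (`|ip x z| < 1)%R]) (ip x z ^+ 2)%:E))%E.
End conditions.

(* Main.v *)
Require Import Defs.
From HB Require Import structures.
From mathcomp Require Import all_boot all_order all_algebra.
From mathcomp Require Import all_classical all_reals all_analysis.
From mathcomp Require Import measurable_realfun random_variable.
From mathcomp Require Import ring lra zify.
Import Order.TTheory GRing.Theory Num.Theory.
Import numFieldNormedType.Exports.
Local Open Scope classical_set_scope.
Local Open Scope ring_scope.
(* Write [k x] for the right-hand side of (C4) and [G x] for the same expression with
   [1 /\ <x,z>^2] in place of [<x,z>^2 1_{|<x,z>| < 1}]. Averaging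
   [1 - cos (s <x,z>)] over [0 <= s <= 1] and summing over the coordinate directions
   shows that [G], [Psi*] and [h] are comparable: [Psi*(r) ~ h(1/r)]. As
   [G (l x) <= l^2 k x + G x], (C3) with a large [l] gives (C4); conversely
   [G (2 x) - G x >= 3/4 k (2 x)], which under (C4) is a fixed fraction of [G (2 x)],
   and iterating gives a power.

   (C3) => (C2): split R^d into dyadic shells around the ball of radius
   [1/h^{-1}(1/t)], on which the exponent grows like a power.

   (C2) => (C1), and (C1) => a bound on [\int_Q exp(-2t Re Psi)] over all cubes [Q]:
   no Fourier inversion is needed. For the indicator [w] of a cube and [y = x - a],
   [|w^(y)|^2] integrated against the law of [Y_t] equals the double integral of
   [w(z) w(z') Re(e^{-i<a,z'-z>} phi(z'-z))], where [phi] is the characteristic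
   function. If [phi] is integrable this bounds the mass of small cubes, hence
   (through dyadic cells) the Radon-Nikodym density. If the law has a bounded density,
   integrating over [a] against the law itself bounds the integral of [|phi|^2].

   The local bound => (C3), with [t = 2/h(1/r)]: if [Re Psi(x)] were much smaller than
   [Psi*(|x|)], then [exp(-2t Re Psi)] would be bounded below on many disjoint cubes
   around [x, 2x, 4x, ...]; if [Psi*(L r) < 2 Psi*(r)] for a large [L], it would be
   bounded below on a cube of volume comparable to [(L r)^d]. *)

Set Implicit Arguments.
Unset Strict Implicit.
Unset Printing Implicit Defensive.

(** * Euclidean vectors *)

Section vectors.
Variables (R : realType) (d : nat).
Implicit Types (x y z : d.-tuple R) (a : R) (A : 'M[R]_d).

(** (C1) and (C2) enter the converse direction through one common consequence,
    [local_fourier_bound]. The function [exp(-2 t RePsi)] is the squared modulus of the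
    characteristic function of [Y t], so the phase, and with it the drift, is gone; both conditions
    bound its integral over every cube by a constant that does not depend on the cube. Cubes appear
    because under (C1) square integrability over the whole space is not known beforehand.

    [h] is handled through monotonicity alone; factors 2 take the place of strict monotonicity. With
    [t = 2 / h(1/r)] one has [1/t < h(1/r)], hence [hinv(1/t) >= 1/r], so the local bound becomes
    [c r^d], while [2 t PsiStar(r)] is at most 8. Every argument by contradiction then takes place
    at the single scale [r] and compares a volume with [c r^d].

    An implication may change the threshold [T], but each one sends the threshold [+oo] to [+oo];
    this is recorded along the way and gives the last claim of the theorem. *)

Definition vadd x y : d.-tuple R := [tuple tnth x i + tnth y i | i < d].
Definition evec (i : 'I_d) : d.-tuple R := [tuple (i == j)%:R | j < d].

Lemma ipC x y : ip x y = ip y x.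
Proof. by apply: eq_bigr => i _; rewrite mulrC. Qed.

Lemma ip_addl x y z : ip (vadd x y) z = ip x z + ip y z.
Proof. by rewrite -big_split; apply: eq_bigr => i _ /=; rewrite tnth_mktuple mulrDl. Qed.

Lemma ip_subl x y z : ip (vsub x y) z = ip x z - ip y z.
Proof. by rewrite -sumrB; apply: eq_bigr => i _ /=; rewrite tnth_mktuple mulrBl. Qed.

Lemma ip_subr x y z : ip z (vsub x y) = ip z x - ip z y.
Proof. by rewrite ipC ip_subl ipC [ip y z]ipC. Qed.

Lemma ip_scalel a x z : ip (vscale a x) z = a * ip x z.
Proof. by rewrite mulr_sumr; apply: eq_bigr => i _ /=; rewrite tnth_mktuple mulrA. Qed.

Lemma ip_ge0 x : 0 <= ip x x.
Proof. by apply: sumr_ge0 => i _; rewrite -expr2 sqr_ge0. Qed.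

Lemma enorm_sqr x : enorm x ^+ 2 = ip x x.
Proof. by rewrite sqr_sqrtr// ip_ge0. Qed.

Lemma enorm_ge0 x : 0 <= enorm x.
Proof. exact: sqrtr_ge0. Qed.

Lemma ip_evec i z : ip (evec i) z = tnth z i.
Proof.
rewrite /ip (bigD1 i)//= tnth_mktuple eqxx mul1r big1 ?addr0// => j ji.
by rewrite tnth_mktuple eq_sym (negbTE ji) mul0r.
Qed.

Lemma enorm_evec i : enorm (evec i) = 1.
Proof. by rewrite /enorm ip_evec tnth_mktuple eqxx sqrtr1. Qed.

Lemma enorm_scale a x : enorm (vscale a x) = `|a| * enorm x.
Proof.
apply/eqP; rewrite -(@eqrXn2 _ 2)// ?enorm_ge0 ?mulr_ge0 ?enorm_ge0//.
by rewrite exprMn !enorm_sqr ip_scalel ipC ip_scalel real_normK ?num_real// expr2 mulrA.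
Qed.

Lemma ip0l z : ip (vzero R d) z = 0.
Proof. by apply: big1 => i _; rewrite tnth_mktuple mul0r. Qed.

Lemma enorm0 : enorm (vzero R d) = 0.
Proof. by rewrite /enorm ip0l sqrtr0. Qed.

Lemma enorm0_eq x : enorm x = 0 -> x = vzero R d.
Proof.
move=> /(congr1 (fun a => a ^+ 2)); rewrite enorm_sqr expr0n => /eqP.
rewrite psumr_eq0 => [/allP h|i _]; last by rewrite -expr2 sqr_ge0.
apply: eq_from_tnth => i; rewrite tnth_mktuple.
by have := h i (mem_index_enum _); rewrite -expr2 sqrf_eq0 => /eqP.
Qed.

Lemma vscale1 x : vscale 1 x = x.
Proof. by apply: eq_from_tnth => i; rewrite tnth_mktuple mul1r. Qed.

Lemma vscaleA a b x : vscale a (vscale b x) = vscale (a * b) x.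
Proof. by apply: eq_from_tnth => i; rewrite !tnth_mktuple mulrA. Qed.

Lemma vscale0 x : vscale 0 x = vzero R d.
Proof. by apply: eq_from_tnth => i; rewrite !tnth_mktuple mul0r. Qed.

Lemma vscale2 x : vscale 2 x = vadd x x.
Proof. by apply: eq_from_tnth => i; rewrite !tnth_mktuple mulr_natl mulr2n. Qed.

Lemma cauchy_schwarz x z : `|ip x z| <= enorm x * enorm z.
Proof.
rewrite -(@ler_pXn2r _ 2)// ?nnegrE ?mulr_ge0 ?enorm_ge0//.
rewrite exprMn !enorm_sqr real_normK ?num_real//.
have key t : 0 <= ip x x - 2 * t * ip x z + t ^+ 2 * ip z z.
  have := ip_ge0 (vsub x (vscale t z)).
  rewrite ip_subl !ip_subr !ip_scalel ![ip _ (vscale _ _)]ipC !ip_scalel [ip z x]ipC.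
  by move/le_trans; apply; rewrite le_eqVlt; apply/orP; left; apply/eqP; ring.
have [z0|z0] := eqVneq (ip z z) 0.
  rewrite z0 mulr0.
  have [->|xz] := eqVneq (ip x z) 0; first by rewrite expr0n.
  (* If [ip x z] were nonzero, this [t] would give the now affine expression in [key] the value
     -1. *)
  have := key ((ip x x + 1) / (2 * ip x z)); rewrite z0 mulr0 addr0.
  rewrite (_ : _ - _ = -1) ?ler0N1//.
  by field.
have zp : 0 < ip z z by rewrite lt_neqAle eq_sym z0 ip_ge0.
have := key (ip x z / ip z z).
rewrite (_ : _ + _ = (ip x x * ip z z - ip x z ^+ 2) / ip z z); last by field.
by rewrite pmulr_lge0 ?invr_gt0// subr_ge0.
Qed.

Lemma abs_tnth_le_enorm x i : `|tnth x i| <= enorm x.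
Proof. by have := cauchy_schwarz (evec i) x; rewrite ip_evec enorm_evec mul1r. Qed.

Lemma enorm_le_sum x : enorm x <= \sum_(i < d) `|tnth x i|.
Proof.
rewrite -(@ler_pXn2r _ 2)// ?nnegrE ?enorm_ge0 ?sumr_ge0//.
rewrite enorm_sqr /ip [leRHS]expr2 mulr_suml; apply: ler_sum => i _.
rewrite -expr2 -real_normK ?num_real// expr2 ler_wpM2l//.
by rewrite (bigD1 i)//= lerDl sumr_ge0.
Qed.

Lemma enorm_le_max x r : (forall i, `|tnth x i| <= r) -> enorm x <= d%:R * r.
Proof.
move=> h; apply: (le_trans (enorm_le_sum x)).
rewrite mulr_natl -[d in _ *+ d]card_ord -sumr_const.
by apply: ler_sum.
Qed.

Lemma enorm_add x y : enorm (vadd x y) <= enorm x + enorm y.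
Proof.
rewrite -(@ler_pXn2r _ 2)// ?nnegrE ?addr_ge0 ?enorm_ge0//.
rewrite enorm_sqr ip_addl [ip x _]ipC [ip y _]ipC !ip_addl.
have := cauchy_schwarz x y; have := ler_norm (ip x y).
rewrite sqrrD !enorm_sqr [ip y x]ipC mulr2n => h1 h2.
have h3 := le_trans h1 h2.
lra.
Qed.

Lemma qf_bilin A x y : qf A (vadd x y) = qf A x + qf A y + ip x (mxapp A y) + ip y (mxapp A x).
Proof.
have mxD u v w : ip u (mxapp A (vadd v w)) = ip u (mxapp A v) + ip u (mxapp A w).
  rewrite -big_split; apply: eq_bigr => i _ /=; rewrite !tnth_mktuple -mulrDr.
  by rewrite -big_split; congr (_ * _); apply: eq_bigr => j _ /=; rewrite tnth_mktuple mulrDr.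
by rewrite /qf ip_addl !mxD; ring.
Qed.

Lemma mxapp_scale A a x : mxapp A (vscale a x) = vscale a (mxapp A x).
Proof.
apply: eq_from_tnth => i; rewrite !tnth_mktuple mulr_sumr.
by apply: eq_bigr => j _; rewrite tnth_mktuple mulrCA.
Qed.

Lemma qf_scale A a x : qf A (vscale a x) = a ^+ 2 * qf A x.
Proof. by rewrite /qf mxapp_scale ip_scalel ipC ip_scalel ipC expr2 mulrA. Qed.

Lemma qf_evec A i : qf A (evec i) = A i i.
Proof.
rewrite /qf ip_evec tnth_mktuple (bigD1 i)//= tnth_mktuple eqxx mulr1 big1 ?addr0//.
by move=> j ji; rewrite tnth_mktuple eq_sym (negbTE ji) mulr0.
Qed.

Lemma ip_mxapp_evec A i j : ip (evec i) (mxapp A (evec j)) = A i j.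
Proof.
rewrite ip_evec tnth_mktuple (bigD1 j)//= tnth_mktuple eqxx mulr1 big1 ?addr0//.
by move=> k kj; rewrite tnth_mktuple eq_sym (negbTE kj) mulr0.
Qed.

(** The parallelogram identity, with the nonnegative value of the form at [x - y] dropped. *)
Lemma qf_subadd A x y : sym_nonneg_def A -> qf A (vadd x y) <= 2 * qf A x + 2 * qf A y.
Proof.
move=> [_ A0]; have := A0 (vadd x (vscale (-1) y)).
rewrite !qf_bilin qf_scale mxapp_scale ip_scalel [ip x (vscale _ _)]ipC ip_scalel.
rewrite [ip (mxapp _ _) x]ipC; lra.
Qed.

(** Testing the form on e_i + e_j and e_i - e_j gives 2 |A_ij| <= A_ii + A_jj. In this way the
    diagonal controls [opnorm A] without any spectral theory, which is what the sum over coordinate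
    directions in [h_le_PsiStar] requires. *)
Lemma abs_mx_le_trace A i j : sym_nonneg_def A -> `|A i j| <= \sum_(k < d) A k k.
Proof.
move=> [sA A0].
have Aij : A j i = A i j by rewrite -[in LHS]sA mxE.
have Akk k : 0 <= A k k by rewrite -qf_evec.
have le_tr k : A k k <= \sum_(k < d) A k k.
  by rewrite (bigD1 k)//= lerDl sumr_ge0.
have := A0 (vadd (evec i) (vscale (-1) (evec j))).
have := A0 (vadd (evec i) (evec j)).
rewrite !qf_bilin qf_scale mxapp_scale ip_scalel [ip (evec i) (vscale _ _)]ipC ip_scalel.
rewrite [ip (mxapp _ _) (evec i)]ipC !ip_mxapp_evec !qf_evec Aij.
have := le_tr i; have := le_tr j.
by rewrite ler_norml; lra.
Qed.

Lemma enorm_mxapp_le A x : sym_nonneg_def A ->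
  enorm (mxapp A x) <= d%:R ^+ 2 * (\sum_(k < d) A k k) * enorm x.
Proof.
move=> sA; rewrite expr2 -!mulrA; apply: enorm_le_max => i.
rewrite tnth_mktuple; apply: (le_trans (ler_norm_sum _ _ _)).
rewrite mulr_natl -[d in _ *+ d]card_ord -sumr_const.
apply: ler_sum => j _; rewrite normrM ler_pM//; first exact: abs_mx_le_trace.
exact: abs_tnth_le_enorm.
Qed.

Lemma opnorm_le_trace A : sym_nonneg_def A -> opnorm A <= d%:R ^+ 2 * (\sum_(k < d) A k k).
Proof.
move=> sA; apply: ge_sup.
  by exists (enorm (mxapp A (vzero R d))), (vzero R d) => //=; rewrite enorm0.
move=> _ [x /= x1 <-]; apply: (le_trans (enorm_mxapp_le x sA)).
rewrite ler_piMr// mulr_ge0// sumr_ge0// => k _.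
by have [_] := sA; rewrite -(qf_evec A k); apply.
Qed.

Lemma qf_le_opnorm A x : sym_nonneg_def A -> qf A x <= opnorm A * enorm x ^+ 2.
Proof.
move=> sA; have [x0|x0] := eqVneq (enorm x) 0.
  by rewrite x0 expr0n mulr0 (enorm0_eq x0) /qf ip0l.
have xp : 0 < enorm x by rewrite lt_neqAle eq_sym x0 enorm_ge0.
have ub : has_ubound [set enorm (mxapp A x) | x in [set x | enorm x <= 1]].
  exists (d%:R ^+ 2 * (\sum_(k < d) A k k)) => _ [y /= y1 <-].
  apply: (le_trans (enorm_mxapp_le y sA)).
  rewrite ler_piMr// mulr_ge0// sumr_ge0// => k _.
  by have [_] := sA; rewrite -(qf_evec A k); apply.
have : enorm (mxapp A (vscale (enorm x)^-1 x)) <= opnorm A.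
  apply: (ub_le_sup ub); exists (vscale (enorm x)^-1 x) => //=.
  by rewrite enorm_scale ger0_norm ?invr_ge0 ?enorm_ge0// mulVf.
rewrite mxapp_scale enorm_scale ger0_norm ?invr_ge0 ?enorm_ge0// mulrC ler_pdivrMr//.
move=> h; apply: (le_trans (ler_norm _)); apply: (le_trans (cauchy_schwarz _ _)).
by rewrite expr2 mulrA [leRHS]mulrC ler_wpM2l// enorm_ge0.
Qed.

Lemma opnorm_ge0 A : sym_nonneg_def A -> 0 <= opnorm A.
Proof.
move=> sA; apply: ub_le_sup.
  exists (d%:R ^+ 2 * (\sum_(k < d) A k k)) => _ [y /= y1 <-].
  apply: (le_trans (enorm_mxapp_le y sA)).
  rewrite ler_piMr// mulr_ge0// sumr_ge0// => k _.
  by have [_] := sA; rewrite -(qf_evec A k); apply.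
exists (vzero R d) => /=; first by rewrite enorm0.
by rewrite -(vscale0 (vzero R d)) mxapp_scale enorm_scale normr0 mul0r.
Qed.

End vectors.

Section vector_measurability.
Variables (R : realType) (d : nat) (dT : measure_display) (T : measurableType dT).
Implicit Types f g : T -> d.-tuple R.

Lemma measurable_tnth_comp f i : measurable_fun setT f ->
  measurable_fun setT (fun w => tnth (f w) i).
Proof.
move=> mf; apply: (@measurableT_comp _ _ _ _ _ _ (fun x => tnth x i)) => //.
exact: measurable_tnth.
Qed.

Lemma measurable_ip f g : measurable_fun setT f -> measurable_fun setT g ->
  measurable_fun setT (fun w => ip (f w) (g w)).
Proof.
move=> mf mg; apply: measurable_sum => i.
by apply: measurable_funM; exact: measurable_tnth_comp.
Qed.

Lemma measurable_enorm f : measurable_fun setT f ->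
  measurable_fun setT (fun w => enorm (f w)).
Proof.
move=> mf.
rewrite (_ : (fun w => _) = (@powR R)^~ (2^-1) \o (fun w => ip (f w) (f w))).
  by apply: measurableT_comp; [exact: measurable_powR | exact: measurable_ip].
apply/funext => w /=; rewrite powR12_sqrt//; exact: ip_ge0.
Qed.

Lemma measurable_vsub f g : measurable_fun setT f -> measurable_fun setT g ->
  measurable_fun setT (fun w => vsub (f w) (g w)).
Proof.
move=> mf mg; apply/measurable_fun_tnthP => i.
rewrite (_ : _ \o _ = fun w => tnth (f w) i - tnth (g w) i).
  by apply: measurable_funB; exact: measurable_tnth_comp.
by apply/funext => w /=; rewrite tnth_mktuple.
Qed.

Lemma measurable_vadd f g : measurable_fun setT f -> measurable_fun setT g ->
  measurable_fun setT (fun w => vadd (f w) (g w)).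
Proof.
move=> mf mg; apply/measurable_fun_tnthP => i.
rewrite (_ : _ \o _ = fun w => tnth (f w) i + tnth (g w) i).
  by apply: measurable_funD; exact: measurable_tnth_comp.
by apply/funext => w /=; rewrite tnth_mktuple.
Qed.

End vector_measurability.

(** * Elementary bounds for sine, cosine and truncation at 1 *)

Section trigonometric_bounds.
Variable R : realType.
Implicit Types u v : R.

Lemma one_sub_cos u : 1 - cos u = 2 * sin (u / 2) ^+ 2.
Proof.
rewrite {1}(_ : u = (u / 2) *+ 2); last by rewrite -mulr_natr; field.
by rewrite cos_mulr2n cos2sin2 -[_ *+ 2]mulr_natl; ring.
Qed.

(** Serves in both directions: |cos c| <= 1 gives |sin u| <= |u|, and |c| <= |u| <= 1 gives a lower
    bound through cos c >= cos 1. *)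
Lemma sin_mvt u : exists2 c, `|c| <= `|u| & sin u = u * cos c.
Proof.
wlog u0 : u / 0 <= u.
  move=> h; have [|u0] := leP 0 u; first exact: h.
  have [|c cu e] := h (- u); first by rewrite oppr_ge0 ltW.
  exists c; first by rewrite normrN in cu.
  by apply: oppr_inj; rewrite -sinN e mulNr.
have [c /[!in_itv]/= /andP[c0 cu]] : exists2 c, c \in `[0, u] & sin u - sin 0 = cos c * (u - 0).
  apply: MVT_segment => //.
  by apply: continuous_subspaceT => x; exact: continuous_sin.
by rewrite sin0 !subr0 => ->; exists c; rewrite ?ger0_norm// mulrC.
Qed.

Lemma abs_sin_le u : `|sin u| <= `|u|.
Proof.
have [c _ ->] := sin_mvt u.
by rewrite normrM ler_piMr// cos_max.
Qed.

Lemma one_sub_cos_ge0 u : 0 <= 1 - cos u.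
Proof. by rewrite subr_ge0 cos_le1. Qed.

Lemma one_sub_cos_le u : 1 - cos u <= 2 * Num.min 1 (u ^+ 2).
Proof.
rewrite minr_pMr// le_min; apply/andP; split.
  by have := cos_geN1 u; lra.
rewrite one_sub_cos ler_pM2l// -[leLHS]real_normK ?num_real//.
have : `|sin (u / 2)| ^+ 2 <= `|u / 2| ^+ 2.
  by rewrite ler_pXn2r ?nnegrE ?normr_ge0// abs_sin_le.
move=> /le_trans; apply.
rewrite real_normK ?num_real// expr_div_n ler_pdivrMr//.
by have := sqr_ge0 u; lra.
Qed.

(* Locked so that [cos 1] is not unfolded in arithmetic goals. *)
Definition coslb : R := locked (cos 1 ^+ 2 / 2).

Lemma cos1_lt1 : cos 1 < 1 :> R.
Proof.
rewrite -[ltRHS](@cos0 R) ltr_cos ?ltr01// in_itv/= ?lexx ?pi_ge0//.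
by rewrite ler01/= (le_trans _ (@pi_ge2 R))// ler1n.
Qed.

Lemma coslb_gt0 : 0 < coslb.
Proof. by rewrite /coslb -lock divr_gt0// exprn_gt0// cos1_gt0. Qed.

Lemma coslb_le1 : coslb <= 1.
Proof.
have h1 := @cos1_lt1; have h0 := @cos1_gt0 R.
have : cos 1 ^+ 2 <= 1 :> R by rewrite expr_le1// ltW.
by rewrite /coslb -lock; lra.
Qed.

Lemma cos_ge_cos1 u : `|u| <= 1 -> cos 1 <= cos u.
Proof.
move=> u1; rewrite -(cos_norm u) leNgt ltr_cos ?in_itv/=.
- by rewrite -leNgt.
- by rewrite ler01/= (le_trans _ (@pi_ge2 R))// ler1n.
- by rewrite normr_ge0/= (le_trans u1)// (le_trans _ (@pi_ge2 R))// ler1n.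
Qed.

(** By the half-angle formula and [sin_mvt], 1 - cos u = (u^2 / 2) cos(c)^2 with |c| <= |u / 2| <=
    1; this is the origin of the value of [coslb] and of the range |u| <= 2. *)
Lemma one_sub_cos_ge u : `|u| <= 2 -> coslb * u ^+ 2 <= 1 - cos u.
Proof.
move=> u2; rewrite one_sub_cos.
have [c cu ->] := sin_mvt (u / 2).
have hu : `|u / 2| <= 1 by rewrite normrM [`|2^-1|]ger0_norm ?invr_ge0// ler_pdivrMr// mul1r.
have c1 := cos_ge_cos1 (le_trans cu hu).
have : cos 1 ^+ 2 <= cos c ^+ 2 by rewrite ler_pXn2r// nnegrE ?(ltW (cos1_gt0 _))// (le_trans _ c1)// ltW// cos1_gt0.
rewrite /coslb -lock exprMn => h.
have : u ^+ 2 * cos 1 ^+ 2 <= u ^+ 2 * cos c ^+ 2 by rewrite ler_wpM2l// sqr_ge0.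
rewrite expr_div_n; lra.
Qed.

(** At half angles this reads sin(p + q)^2 <= 2 sin(p)^2 + 2 sin(q)^2. It makes [RePsi] subadditive
    up to a factor 2. *)
Lemma one_sub_cosD u v : 1 - cos (u + v) <= 2 * (1 - cos u) + 2 * (1 - cos v).
Proof.
rewrite one_sub_cos (one_sub_cos u) (one_sub_cos v) (mulrDl u v) sinD.
set a := sin (u / 2); set b := sin (v / 2); set p := cos (u / 2); set q := cos (v / 2).
have h : (a * q + p * b) ^+ 2 <= 2 * (a * q) ^+ 2 + 2 * (p * b) ^+ 2.
  by have := sqr_ge0 (a * q - p * b); nra.
have ha : (a * q) ^+ 2 <= a ^+ 2.
  by rewrite exprMn ler_piMr ?sqr_ge0// -(cos2Dsin2 (v / 2)) lerDl sqr_ge0.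
have hb : (p * b) ^+ 2 <= b ^+ 2.
  by rewrite exprMn ler_piMl ?sqr_ge0// -(cos2Dsin2 (u / 2)) lerDl sqr_ge0.
lra.
Qed.

(* [1 - sin u / u] is the mean of [1 - cos (s u)] over [s] in [0, 1]. *)
Lemma mean_one_sub_cos_ge u : u != 0 ->
  coslb / 24 * Num.min 1 (u ^+ 2) <= 1 - sin u / u.
Proof.
wlog u0 : u / 0 < u.
  move=> h uN0; have [|u0] := leP 0 u.
    by rewrite le_eqVlt eq_sym (negbTE uN0)/= => /h; exact.
  have := h (- u); rewrite oppr_gt0 u0 oppr_eq0 sqrrN sinN invrN mulrNN.
  by apply.
move=> uN0; have k0 := coslb_gt0; have k1 := coslb_le1.
(* Beyond 2 the crude bound sin u / u <= 1/2 is enough; up to 2 the quadratic bound [one_sub_cos_ge]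
   is available and gets integrated. *)
have [u2|u2] := leP u 2; last first.
  have : sin u / u <= 1 / 2.
    rewrite ler_pdivrMr// (le_trans (sin_le1 u))//; lra.
  have : coslb / 24 * Num.min 1 (u ^+ 2) <= 1 / 24.
    rewrite (le_trans (ler_wpM2l _ (_ : _ <= 1)))//; first lra.
    + by rewrite ge_min lexx.
    + lra.
  lra.
(* Integrates [one_sub_cos_ge] from 0 to [u]: the difference u - (coslb / 3) u^3 - sin u has
   derivative 1 - coslb u^2 - cos u, which is nonnegative there. *)
have [c /[!in_itv]/= /andP[c0 cu]] : exists2 c, c \in `[0, u] &
    (u - coslb / 3 * u ^+ 3 - sin u) - (0 - coslb / 3 * 0 ^+ 3 - sin 0) =
    (1 - coslb * c ^+ 2 - cos c) * (u - 0).
  apply: (@MVT_segment _ (fun x => x - coslb / 3 * x ^+ 3 - sin x)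
     (fun x => 1 - coslb * x ^+ 2 - cos x)); first exact: ltW.
    by move=> x _; apply: trigger_derive; rewrite /GRing.scale/=; field.
  apply: continuous_subspaceT => x.
  apply: cvgB; last exact: continuous_sin.
  apply: cvgB; first exact: cvg_id.
  apply: cvgM; first exact: cvg_cst.
  by apply: exprn_continuous.
rewrite sin0 expr0n mulr0 !subr0 => e.
have h : 0 <= 1 - coslb * c ^+ 2 - cos c.
  have := @one_sub_cos_ge c; rewrite ger0_norm// => /(_ (le_trans cu u2)); lra.
have : 0 <= u - coslb / 3 * u ^+ 3 - sin u by rewrite e mulr_ge0// ltW.
have e2 : 1 - sin u / u - coslb / 3 * u ^+ 2 = (u - coslb / 3 * u ^+ 3 - sin u) / u by field.
rewrite -(@pmulr_lge0 _ u^-1) ?invr_gt0// -e2 => h2.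
have : coslb / 24 * Num.min 1 (u ^+ 2) <= coslb / 24 * u ^+ 2.
  by rewrite ler_wpM2l ?ge_min ?lexx ?orbT//; lra.
have : 0 <= coslb * u ^+ 2 by rewrite mulr_ge0// ?sqr_ge0// ltW.
lra.

Qed.

End trigonometric_bounds.

Section min_bounds.
Variable R : realType.
Implicit Types a b c : R.

Lemma min1_scale c a : 0 <= c -> 0 <= a -> Num.min 1 (c * a) <= (1 + c) * Num.min 1 a.
Proof.
move=> c0 a0; have [a1|a1] := leP a 1.
  by rewrite ge_min mulrDl mul1r lerDr a0 orbT.
by rewrite mulr1 ge_min lerDl c0.
Qed.

Lemma min1_sum_le n (a : 'I_n -> R) : (forall i, 0 <= a i) ->
  Num.min 1 (\sum_(i < n) a i) <= \sum_(i < n) Num.min 1 (a i).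
Proof.
(* The induction also carries the nonnegativity of the partial sums, since truncation at 1 is
   subadditive only on nonnegative arguments. *)
move=> a0; suff : Num.min 1 (\sum_(i < n) a i) <= \sum_(i < n) Num.min 1 (a i)
    /\ 0 <= \sum_(i < n) a i by case.
apply: (big_ind2 (fun s t => Num.min 1 s <= t /\ 0 <= s)) => [|s t s' t' [h1 h2] [h3 h4]|i _].
- by rewrite ge_min lexx orbT.
- split; last exact: addr_ge0.
  apply: le_trans (lerD h1 h3).
  have [?|?] := leP s 1; have [?|?] := leP s' 1; have [?|?] := leP (s + s') 1 => //; lra.
- by [].
Qed.

Lemma Rintegral_sum dT (T : measurableType dT) (m : {measure set T -> \bar R})
    n (f : 'I_n -> T -> R) :
  (forall i, m.-integrable setT (EFin \o f i)) ->
  \int[m]_x (\sum_(i < n) f i x) = \sum_(i < n) \int[m]_x f i x.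
Proof.
move=> mf; rewrite /Rintegral.
under eq_integral do rewrite -sumEFin.
rewrite integral_sum//=.
rewrite (eq_bigr (fun i => (fine (\int[m]_x (f i x)%:E))%:E)); first by rewrite sumEFin.
by move=> i _; rewrite fineK//; exact: integrable_fin_num (mf i).
Qed.

End min_bounds.

(** * The real part of the exponent and its truncated companions *)

Section levy_exponent.
Variables (R : realType) (d : nat) (A : 'M[R]_d).
Variable N : {sigma_finite_measure set (d.-tuple R) -> \bar R}.
Hypotheses (HA : sym_nonneg_def A) (HN : levy_measure N).
Implicit Types (x y z : d.-tuple R) (r s : R).
Local Notation RePsi := (RePsi A N).
Local Notation PsiStar := (PsiStar A N).

Lemma measurable_ipl x : measurable_fun setT (ip x).
Proof. by apply: measurable_ip => //; exact: measurable_cst. Qed.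

Lemma levy_integrable (f : d.-tuple R -> R) c : measurable_fun setT f ->
  (forall z, 0 <= f z <= c * Num.min 1 (enorm z ^+ 2)) ->
  N.-integrable setT (EFin \o f).
Proof.
move=> mf fc.
have mm : measurable_fun setT (fun z : d.-tuple R => Num.min 1 (enorm z ^+ 2)).
  apply: measurable_minr => //; apply: measurable_funX.
  exact: measurable_enorm.
have m0 z : 0 <= Num.min 1 (enorm z ^+ 2) by rewrite le_min ler01 sqr_ge0.
apply: (@le_integrable _ _ _ _ _ measurableT _
  (fun z => c%:E * (Num.min 1 (enorm z ^+ 2))%:E)%E).
- exact/measurable_EFinP.
- move=> z _ /=; rewrite lee_fin.
  by case/andP: (fc z) => f0 h; rewrite ger0_norm// (le_trans h)// ler_norm.
- apply: integrableZl => //; apply/integrableP; split; first exact/measurable_EFinP.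
  under eq_integral do rewrite gee0_abs ?lee_fin//.
  exact: HN.2.
Qed.

Definition trunc_sqr x z := Num.min 1 (ip x z ^+ 2).
Definition small_sqr x z : R := if `|ip x z| < 1 then ip x z ^+ 2 else 0.

Lemma ip_sqr_le x z : ip x z ^+ 2 <= enorm x ^+ 2 * enorm z ^+ 2.
Proof.
rewrite -exprMn -[leLHS]real_normK ?num_real// ler_pXn2r ?nnegrE ?mulr_ge0 ?enorm_ge0//.
exact: cauchy_schwarz.
Qed.

Lemma trunc_sqr_bound x z :
  0 <= trunc_sqr x z <= (1 + enorm x ^+ 2) * Num.min 1 (enorm z ^+ 2).
Proof.
rewrite le_min ler01 sqr_ge0/=.
apply: le_trans (min1_scale (sqr_ge0 (enorm x)) (sqr_ge0 (enorm z))).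
by rewrite le_min !ge_min lexx/= ip_sqr_le orbT.
Qed.

Lemma integrable_trunc_sqr x : N.-integrable setT (EFin \o trunc_sqr x).
Proof.
apply: levy_integrable (trunc_sqr_bound x).
by apply: measurable_minr => //; apply: measurable_funX; exact: measurable_ipl.
Qed.

Lemma small_sqr_ge0 x z : 0 <= small_sqr x z.
Proof. by rewrite /small_sqr; case: ifP => // _; exact: sqr_ge0. Qed.

Lemma small_le_trunc x z : small_sqr x z <= trunc_sqr x z.
Proof.
rewrite /small_sqr /trunc_sqr; case: ifP => [h|_]; last by rewrite le_min ler01 sqr_ge0.
by rewrite le_min lexx andbT -real_normK ?num_real// expr_le1// ltW.
Qed.

Lemma measurable_small_sqr x : measurable_fun setT (small_sqr x).
Proof.
apply: measurable_fun_ifT => //.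
- apply: measurable_fun_ltr => //.
  by apply: measurableT_comp => //; exact: measurable_ipl.
- by apply: measurable_funX; exact: measurable_ipl.
Qed.

Lemma integrable_small_sqr x : N.-integrable setT (EFin \o small_sqr x).
Proof.
apply: (@levy_integrable _ (1 + enorm x ^+ 2)); first exact: measurable_small_sqr.
move=> z; rewrite small_sqr_ge0/= (le_trans (small_le_trunc x z))//.
by case/andP: (trunc_sqr_bound x z).
Qed.

Lemma measurable_cos_ip x : measurable_fun setT (fun z => 1 - cos (ip x z)).
Proof.
apply: measurable_funB => //; apply: measurableT_comp; last exact: measurable_ipl.
by apply: continuous_measurable_fun; exact: continuous_cos.
Qed.

Lemma integrable_cos x : N.-integrable setT (EFin \o (fun z => 1 - cos (ip x z))).
Proof.
apply: (@levy_integrable _ (2 * (1 + enorm x ^+ 2))); first exact: measurable_cos_ip.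
move=> z; rewrite one_sub_cos_ge0/= (le_trans (one_sub_cos_le _))// -mulrA ler_pM2l//.
by case/andP: (trunc_sqr_bound x z).
Qed.

Definition Gfun x := qf A x + \int[N]_z trunc_sqr x z.
(* [kfun] is the right-hand side of (C4). *)
Definition kfun x := qf A x + \int[N]_z small_sqr x z.

Lemma qf_ge0 x : 0 <= qf A x. Proof. exact: HA.2. Qed.

Lemma RePsi_ge0 x : 0 <= RePsi x.
Proof.
by rewrite addr_ge0 ?qf_ge0// Rintegral_ge0// => z _; exact: one_sub_cos_ge0.
Qed.

Lemma Gfun_ge0 x : 0 <= Gfun x.
Proof.
by rewrite addr_ge0 ?qf_ge0// Rintegral_ge0// => z _; case/andP: (trunc_sqr_bound x z).
Qed.

Lemma RePsi_le_Gfun x : RePsi x <= 2 * Gfun x.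
Proof.
rewrite /RePsi /Gfun mulrDr lerD//; first by have := qf_ge0 x; lra.
rewrite -RintegralZl//; last exact: integrable_trunc_sqr.
apply: le_Rintegral => //; first exact: integrable_cos.
- by rewrite -[X in _.-integrable _ X]/(fun z => 2%:E * (trunc_sqr x z)%:E)%E;
    apply: integrableZl => //; exact: integrable_trunc_sqr.
- by move=> z _; exact: one_sub_cos_le.
Qed.

Lemma kfun_le_RePsi x : coslb R * kfun x <= RePsi x.
Proof.
have k0 := @coslb_gt0 R; have k1 := @coslb_le1 R.
rewrite /RePsi /kfun mulrDr lerD//; first by rewrite ler_piMl// qf_ge0.
rewrite -RintegralZl//; last exact: integrable_small_sqr.
apply: le_Rintegral => //; last 1 first.
- move=> z _; rewrite /small_sqr; case: ifP => [h|_]; last by rewrite mulr0 one_sub_cos_ge0.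
  apply: one_sub_cos_ge; rewrite (le_trans (ltW h))// ler1n//.
- by rewrite -[X in _.-integrable _ X]/(fun z => (coslb R)%:E * (small_sqr x z)%:E)%E;
    apply: integrableZl => //; exact: integrable_small_sqr.
- exact: integrable_cos.
Qed.

Lemma kfun_le_Gfun x : kfun x <= Gfun x.
Proof.
rewrite lerD2l; apply: le_Rintegral => //; last by move=> z _; exact: small_le_trunc.
- exact: integrable_small_sqr.
- exact: integrable_trunc_sqr.
Qed.

Lemma RePsi_add x y : RePsi (vadd x y) <= 2 * RePsi x + 2 * RePsi y.
Proof.
have h : \int[N]_z (1 - cos (ip (vadd x y) z)) <=
    2 * (\int[N]_z (1 - cos (ip x z))) + 2 * (\int[N]_z (1 - cos (ip y z))).
  rewrite -!RintegralZl//; try exact: integrable_cos.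
  have i2 u : N.-integrable setT (EFin \o (fun z => 2 * (1 - cos (ip u z)))).
    rewrite -[X in _.-integrable _ X]/(fun z => 2%:E * (1 - cos (ip u z))%:E)%E.
    by apply: integrableZl => //; exact: integrable_cos.
  rewrite -RintegralD//; apply: le_Rintegral => //.
  - exact: integrable_cos.
  - exact: (integrableD measurableT (i2 x) (i2 y)).
  - by move=> z _; rewrite ip_addl; exact: one_sub_cosD.
have := qf_subadd x y HA; rewrite /RePsi; lra.
Qed.

Lemma RePsi_double x : RePsi (vscale 2 x) <= 4 * RePsi x.
Proof. by rewrite vscale2 (le_trans (RePsi_add x x))//; have := RePsi_ge0 x; lra. Qed.

Lemma Gfun_scale_le r x : `|r| <= 1 -> Gfun (vscale r x) <= Gfun x.
Proof.
move=> r1; have r2 : r ^+ 2 <= 1 by rewrite -real_normK ?num_real// expr_le1.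
rewrite /Gfun qf_scale lerD//; first by rewrite ler_piMl// qf_ge0.
apply: le_Rintegral => //; try exact: integrable_trunc_sqr.
move=> z _; rewrite /trunc_sqr ip_scalel exprMn le_min ge_min lexx/=.
by rewrite ge_min ler_piMl ?sqr_ge0// orbT.
Qed.

(** Where |2 <x,z>| < 1 neither truncation is active and the increment is exactly 3 <x,z>^2;
    elsewhere it is nonnegative. The quadratic part also grows by exactly 3 [qf A x]. *)
Lemma Gfun_double_sub x : 3 / 4 * kfun (vscale 2 x) <= Gfun (vscale 2 x) - Gfun x.
Proof.
rewrite /Gfun /kfun qf_scale.
have -> : forall a b c, 2 ^+ 2 * a + b - (a + c) = 3 * a + (b - c) :> R by move=> *; ring.
rewrite mulrDr lerD//; first by rewrite mulrA; have := qf_ge0 x; lra.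
rewrite -RintegralB//; try exact: integrable_trunc_sqr.
rewrite -RintegralZl//; last exact: integrable_small_sqr.
apply: le_Rintegral => //; last 1 first.
- move=> z _; rewrite /small_sqr /trunc_sqr ip_scalel; set u := ip x z.
  case: ifP => [h|_].
    have : (2 * u) ^+ 2 <= 1 by rewrite -real_normK ?num_real// expr_le1// ltW.
    rewrite exprMn => h2.
    have h3 : u ^+ 2 <= 1 by have := sqr_ge0 u; lra.
    by rewrite !min_r//; lra.
  rewrite mulr0 subr_ge0 le_min ge_min lexx/= ge_min exprMn.
  by apply/orP; right; have := sqr_ge0 u; lra.
- by rewrite -[X in _.-integrable _ X]/(fun z => (3 / 4)%:E * (small_sqr (vscale 2 x) z)%:E)%E;
    apply: integrableZl => //; exact: integrable_small_sqr.
- exact: (integrableB measurableT (integrable_trunc_sqr _) (integrable_trunc_sqr _)).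
Qed.

End levy_exponent.

(** * Comparison of [Gfun], [PsiStar] and [h] *)

Section concentration.
Variables (R : realType) (d : nat) (A : 'M[R]_d).
Variable N : {sigma_finite_measure set (d.-tuple R) -> \bar R}.
Hypotheses (HA : sym_nonneg_def A) (HN : levy_measure N).
Implicit Types (x y z : d.-tuple R) (r s : R).
Local Notation RePsi := (RePsi A N).
Local Notation PsiStar := (PsiStar A N).
Local Notation G := (Gfun A N).

(** Real-valued form of [hfun]: for a Lévy measure the integral is finite, so nothing is lost, as
    [hfunE] records. *)
Definition hR r : R := r ^- 2 * opnorm A + \int[N]_z Num.min 1 (enorm z ^+ 2 / r ^+ 2).

Lemma h_integrand_bound r z :
  0 <= Num.min 1 (enorm z ^+ 2 / r ^+ 2) <= (1 + r ^- 2) * Num.min 1 (enorm z ^+ 2).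
Proof.
rewrite le_min ler01 divr_ge0 ?sqr_ge0//= mulrC.
by apply: min1_scale; rewrite ?invr_ge0 sqr_ge0.
Qed.

Lemma measurable_h_integrand r :
  measurable_fun setT (fun z : d.-tuple R => Num.min 1 (enorm z ^+ 2 / r ^+ 2)).
Proof.
apply: measurable_minr => //; apply: measurable_funM => //.
by apply: measurable_funX; exact: measurable_enorm.
Qed.

Lemma integrable_h r :
  N.-integrable setT (EFin \o (fun z => Num.min 1 (enorm z ^+ 2 / r ^+ 2))).
Proof.
exact: (levy_integrable HN (measurable_h_integrand r) (h_integrand_bound r)).
Qed.

Lemma hfunE r : hfun A N r = (hR r)%:E.
Proof.
rewrite /hfun EFinD /Rintegral fineK//.
exact: integrable_fin_num (integrable_h r).
Qed.

Lemma hR_nonincr r s : 0 < r -> r <= s -> hR s <= hR r.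
Proof.
move=> r0 rs; have s0 := lt_le_trans r0 rs.
have inv : s ^- 2 <= r ^- 2 by rewrite lef_pV2 ?posrE ?exprn_gt0// ler_pXn2r// nnegrE ltW.
rewrite lerD ?ler_wpM2r ?opnorm_ge0//; apply: le_Rintegral => //; try exact: integrable_h.
by move=> z _; rewrite le_min ge_min lexx/= ge_min ler_wpM2l ?sqr_ge0 ?orbT.
Qed.

Lemma hR_double r : 0 < r -> hR r <= 4 * hR (2 * r).
Proof.
move=> r0; rewrite /hR mulrDr lerD//.
  by rewrite le_eqVlt; apply/orP; left; apply/eqP; field; rewrite gt_eqF.
rewrite -RintegralZl//; last exact: integrable_h.
apply: le_Rintegral => //; first exact: integrable_h.
- rewrite -[X in _.-integrable _ X]/(fun z => 4%:E * (Num.min 1 (enorm z ^+ 2 / (2 * r) ^+ 2))%:E)%E.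
  by apply: integrableZl => //; exact: integrable_h.
- move=> z _; set q := enorm z ^+ 2 / r ^+ 2.
  have -> : enorm z ^+ 2 / (2 * r) ^+ 2 = q / 4 by rewrite /q; field; rewrite gt_eqF.
  have q0 : 0 <= q by rewrite divr_ge0 ?sqr_ge0.
  have [?|?] := leP q 1; have [?|?] := leP (q / 4) 1 => //; lra.
Qed.

Lemma G_le_h r x : 0 < r -> enorm x * r <= 1 -> G x <= hR r.
Proof.
move=> r0 xr.
have xr2 : enorm x ^+ 2 <= r ^- 2.
  rewrite -[leRHS]mul1r ler_pdivlMr ?exprn_gt0// -exprMn expr_le1//.
  by rewrite mulr_ge0 ?enorm_ge0// ltW.
rewrite lerD//.
  by rewrite (le_trans (qf_le_opnorm x HA))// mulrC ler_wpM2r ?opnorm_ge0.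
apply: le_Rintegral => //; [exact: integrable_trunc_sqr|exact: integrable_h|].
move=> z _; rewrite le_min ge_min lexx/= ge_min; apply/orP; right.
by rewrite (le_trans (ip_sqr_le x z))// mulrC ler_wpM2l ?sqr_ge0.
Qed.

Lemma RePsi_le_h r x : 0 < r -> enorm x * r <= 1 -> RePsi x <= 2 * hR r.
Proof.
move=> r0 xr; rewrite (le_trans (RePsi_le_Gfun HA HN x))// ler_pM2l//.
exact: G_le_h.
Qed.

(** Without this bound the [sup] in [PsiStar] might be a default value. The radius (|r| + 1)^-1
    makes [RePsi_le_h] applicable whatever the sign of [r]. *)
Lemma PsiStar_has_sup r : has_ubound [set RePsi z | z in [set z | enorm z <= r]].
Proof.
exists (2 * hR (`|r| + 1)^-1) => _ [x /= xr <-]; apply: RePsi_le_h.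
  by rewrite invr_gt0 ltr_wpDl.
rewrite ler_pdivrMr ?mul1r; last by rewrite ltr_wpDl.
by rewrite (le_trans xr)// (le_trans (ler_norm r))// lerDl.
Qed.

Lemma RePsi_le_PsiStar r x : enorm x <= r -> RePsi x <= PsiStar r.
Proof. by move=> xr; apply: (ub_le_sup (PsiStar_has_sup r)); exists x. Qed.

Lemma PsiStar_le r M : 0 <= r -> (forall x, enorm x <= r -> RePsi x <= M) -> PsiStar r <= M.
Proof.
move=> r0 h; apply: ge_sup; last by move=> _ [x /= /h xr <-].
by exists (RePsi (vzero R d)), (vzero R d) => //=; rewrite enorm0.
Qed.

Lemma PsiStar_ge0 r : 0 <= r -> 0 <= PsiStar r.
Proof.
move=> r0; apply: (le_trans (RePsi_ge0 N HA (vzero R d))).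
by apply: RePsi_le_PsiStar; rewrite enorm0.
Qed.

Lemma PsiStar_mono r s : 0 <= r -> r <= s -> PsiStar r <= PsiStar s.
Proof.
move=> r0 rs; apply: PsiStar_le => // x xr; apply: RePsi_le_PsiStar.
exact: le_trans rs.
Qed.

Lemma PsiStar_double r : 0 <= r -> PsiStar (2 * r) <= 4 * PsiStar r.
Proof.
move=> r0; apply: PsiStar_le; first by rewrite mulr_ge0.
move=> x xr.
have -> : x = vscale 2 (vscale 2^-1 x) by rewrite vscaleA divff// vscale1.
rewrite (le_trans (RePsi_double HA HN _))// ler_pM2l// RePsi_le_PsiStar//.
by rewrite enorm_scale ger0_norm// mulrC ler_pdivrMr// mulrC.
Qed.

Lemma PsiStar_le_h r : 0 < r -> PsiStar r^-1 <= 2 * hR r.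
Proof.
move=> r0; apply: PsiStar_le; first by rewrite invr_ge0 ltW.
by move=> x xr; apply: RePsi_le_h => //; rewrite -ler_pdivlMr// mul1r.
Qed.

Lemma integral_cos_segment (u : R) : u != 0 ->
  (\int[lebesgue_measure]_(s in `[0%R, 1%R]) (1 - cos (s * u))%:E = (1 - sin u / u)%:E)%E.
Proof.
move=> u0; have cf : continuous (fun s : R => 1 - cos (s * u)).
  move=> s; apply: cvgB; first exact: cvg_cst.
  apply: (@continuous_comp _ _ _ (fun s => s * u) cos); last exact: continuous_cos.
  by apply: cvgM; [exact: cvg_id|exact: cvg_cst].
have cF : continuous (fun s : R => s - sin (s * u) / u).
  move=> s; apply: cvgB; first exact: cvg_id.
  apply: cvgM; last exact: cvg_cst.
  apply: (@continuous_comp _ _ _ (fun s => s * u) sin); last exact: continuous_sin.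
  by apply: cvgM; [exact: cvg_id|exact: cvg_cst].
have dF s : is_derive s 1 (fun s : R => s - sin (s * u) / u) (1 - cos (s * u)).
  by apply: trigger_derive; rewrite /GRing.scale/=; field.
rewrite (@continuous_FTC2 _ _ (fun s => s - sin (s * u) / u)) ?ltr01//.
- by rewrite mul1r mul0r sin0 mul0r subr0 -EFinB subr0.
- exact: continuous_subspaceT.
- split.
  + by move=> s _; apply: ex_derive.
  + by apply: cvg_at_right_filter; exact: cF.
  + by apply: cvg_at_left_filter; exact: cF.
- by move=> s _; rewrite derive1E; apply: derive_val.
Qed.

(** 1 - cos u vanishes at nonzero multiples of 2 pi, so it cannot dominate the truncated square
    pointwise. Its mean over the segment from 0 to [x] can, and every [RePsi (s x)] on that segment
    is at most [PsiStar (enorm x)]. *)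
Lemma mean_RePsi_ge x : coslb R / 24 * \int[N]_z trunc_sqr x z <= PsiStar (enorm x).
Proof.
pose f (p : R * d.-tuple R) : \bar R :=
  (\1_(`[0%R, 1%R]%classic) p.1 * (1 - cos (p.1 * ip x p.2)))%:E.
have f0 p : (0 <= f p)%E by rewrite lee_fin mulr_ge0// one_sub_cos_ge0.
have mf : measurable_fun setT f.
  apply/measurable_EFinP; apply: measurable_funM.
    by apply: measurableT_comp => //; exact: measurable_indic.
  apply: measurable_funB => //; apply: measurableT_comp.
    by apply: continuous_measurable_fun; exact: continuous_cos.
  apply: measurable_funM => //; apply: measurableT_comp; last exact: measurable_snd.
  exact: measurable_ipl.
have := sfinite_Fubini (@lebesgue_measure R) N f f0 mf.
set I := (\int[_]_s _)%E; set J := (\int[N]_z _)%E => IJ.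
have IP : (I <= (PsiStar (enorm x))%:E)%E.
  apply: (@le_trans _ _ (\int[lebesgue_measure]_(s in `[0%R, 1%R]) (PsiStar (enorm x))%:E)%E); last first.
    by rewrite integral_cst//= lebesgue_measure_itv/= lte_fin ltr01 -EFinB subr0 mule1.
  rewrite [leRHS]integral_mkcond; apply: ge0_le_integral => //.
  - by move=> s _; apply: integral_ge0.
  - exact: (@measurable_fun_fubini_tonelli_F _ _ _ _ _ N f mf f0).
  - by apply/(measurable_restrictT _ _).1.
  - move=> s _; rewrite patchE; case: ifPn => [/set_mem|/negP] s01; last first.
      by rewrite integral0_eq// => z _; rewrite /f indicE (negbTE (introN idP s01)) mul0r.
    have s01' := s01; move: s01' => /=; rewrite in_itv/= => /andP[s0 s1].
    apply: (@le_trans _ _ (RePsi (vscale s x))%:E); last first.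
      rewrite lee_fin RePsi_le_PsiStar// enorm_scale ger0_norm//.
      by rewrite ler_piMl ?enorm_ge0.
    rewrite /RePsi EFinD /Rintegral fineK; last first.
      exact: (integrable_fin_num measurableT (integrable_cos HN _)).
    rewrite (_ : (\int[N]_z _)%E = (\int[N]_z (1 - cos (ip (vscale s x) z))%:E)%E).
      by rewrite leeDr// lee_fin qf_ge0.
    by apply: eq_integral => z _; rewrite /f/= indicE mem_set// mul1r ip_scalel.
have JG : ((coslb R / 24 * \int[N]_z trunc_sqr x z)%:E <= J)%E.
  have k0 := @coslb_gt0 R.
  rewrite -RintegralZl//; last exact: integrable_trunc_sqr.
  rewrite /Rintegral fineK; last first.
    rewrite integrable_fin_num//.
    rewrite -[X in _.-integrable _ X]/(fun z => (coslb R / 24)%:E * (trunc_sqr x z)%:E)%E.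
    by apply: integrableZl => //; exact: integrable_trunc_sqr.
  apply: ge0_le_integral => //.
  - move=> z _; rewrite lee_fin mulr_ge0//; first by rewrite divr_ge0// ltW.
    by case/andP: (trunc_sqr_bound x z).
  - apply/measurable_EFinP; apply: measurable_funM => //.
    by apply: measurable_minr => //; apply: measurable_funX; exact: measurable_ipl.
  - exact: (@measurable_fun_fubini_tonelli_G _ _ _ _ _ (@lebesgue_measure R) f mf f0).
  - move=> z _; rewrite /trunc_sqr; set u := ip x z.
    have [->|u0] := eqVneq u 0.
      by rewrite expr0n/= min_r// mulr0 integral_ge0// => s _.
    rewrite (_ : (\int[_]_s _)%E = (1 - sin u / u)%:E).
      by rewrite lee_fin mean_one_sub_cos_ge.
    rewrite -integral_cos_segment// [RHS]integral_mkcond; apply: eq_integral => s _.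
    rewrite patchE /f/= indicE; case: ifPn => h; first by rewrite mul1r.
    by rewrite mul0r.
by rewrite -lee_fin (le_trans JG)// -IJ.
Qed.

(** The jump part costs 24 / coslb by [mean_RePsi_ge]; the quadratic part is at most [PsiStar],
    hence also at most 24 / coslb times it as coslb <= 1. Together they give 48. *)
Lemma G_le_PsiStar x : G x <= 48 / coslb R * PsiStar (enorm x).
Proof.
have k0 := @coslb_gt0 R; have k1 := @coslb_le1 R.
have h1 := mean_RePsi_ge x.
have h2 : qf A x <= PsiStar (enorm x).
  apply: (le_trans _ (@RePsi_le_PsiStar _ x (lexx _))).
  by rewrite lerDl Rintegral_ge0// => z _; exact: one_sub_cos_ge0.
have P0 := PsiStar_ge0 (enorm_ge0 x).
rewrite -mulrA mulrCA -ler_pdivrMl ?invr_gt0// invrK.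
have h3 : coslb R * qf A x <= 24 * PsiStar (enorm x).
  apply: (@le_trans _ _ (1 * PsiStar (enorm x))); last by lra.
  by rewrite ler_pM ?qf_ge0// ltW.
by rewrite /Gfun; lra.
Qed.

(** The factor d^2 + 1 comes from the trace bound for [opnorm] together with the jump part, the
    factor d from the number of coordinate directions, 48 / coslb from [G_le_PsiStar]. The final 1
    makes the constant positive in dimension 0 as well. *)
Definition Ch : R := (d%:R ^+ 2 + 1) * d%:R * (48 / coslb R) + 1.

Lemma Ch_gt0 : 0 < Ch.
Proof.
rewrite /Ch ltr_wpDl// !mulr_ge0// ?addr_ge0 ?sqr_ge0// invr_ge0.
exact/ltW/coslb_gt0.
Qed.

(** |z|^2 / r^2 is the sum of the squares of <e_i / r, z>, and truncation at 1 is subadditive; the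
    test vectors e_i / r lie on the sphere of radius 1/r. *)
Lemma h_le_PsiStar r : 0 < r -> hR r <= Ch * PsiStar r^-1.
Proof.
move=> r0; have ri0 : 0 < r^-1 by rewrite invr_gt0.
have P0 := PsiStar_ge0 (ltW ri0).
pose e (i : 'I_d) := vscale r^-1 (evec R i).
have ne i : enorm (e i) = r^-1 by rewrite enorm_scale enorm_evec mulr1 ger0_norm// ltW.
have hJ : \int[N]_z Num.min 1 (enorm z ^+ 2 / r ^+ 2) <= \sum_(i < d) \int[N]_z trunc_sqr (e i) z.
  rewrite -Rintegral_sum; last by move=> i; exact: integrable_trunc_sqr.
  apply: le_Rintegral => //; first exact: integrable_h.
    rewrite (_ : EFin \o _ = fun z => \sum_(i < d) (trunc_sqr (e i) z)%:E)%E.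
      apply: (@integrable_sum _ _ _ N _ measurableT _ _ xpredT (fun i z => (trunc_sqr (e i) z)%:E)) => i _.
      exact: integrable_trunc_sqr.
    by apply/funext => z /=; rewrite sumEFin.
  move=> z _; rewrite enorm_sqr /ip mulr_suml.
  apply: (le_trans (min1_sum_le _)) => [i|]; first by rewrite -expr2 divr_ge0 ?sqr_ge0.
  by apply: ler_sum => i _; rewrite /trunc_sqr ip_scalel ip_evec exprMn exprVn mulrC expr2 expr2.
have hq : r ^- 2 * opnorm A <= d%:R ^+ 2 * \sum_(i < d) qf A (e i).
  rewrite (eq_bigr (fun i => r ^- 2 * A i i)); last by move=> i _; rewrite qf_scale qf_evec exprVn.
  rewrite -mulr_sumr mulrCA ler_wpM2l ?invr_ge0 ?sqr_ge0//.
  exact: opnorm_le_trace.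
have d2 : 0 <= d%:R ^+ 2 :> R by rewrite sqr_ge0.
have q0 : 0 <= \sum_(i < d) qf A (e i) by rewrite sumr_ge0// => i _; exact: qf_ge0.
have J0 : 0 <= \sum_(i < d) \int[N]_z trunc_sqr (e i) z.
  by rewrite sumr_ge0// => i _; rewrite Rintegral_ge0// => z _; case/andP: (trunc_sqr_bound (e i) z).
have : hR r <= (d%:R ^+ 2 + 1) * \sum_(i < d) G (e i).
  rewrite /Gfun big_split/= /hR; nra.
move=> /le_trans; apply.
rewrite /Ch [leRHS]mulrDl mul1r ler_wpDr// -!mulrA ler_wpM2l ?addr_ge0//.
rewrite mulr_natl -[X in _ *+ X](card_ord d) -sumr_const; apply: ler_sum => i _.
by rewrite mulrA -(ne i) G_le_PsiStar.
Qed.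

End concentration.

(** * From growth along a geometric sequence to a power law *)

Section power_growth.
Variable R : realType.

Lemma exp_bracket (L l : R) : 1 < L -> 1 <= l -> exists n, L ^+ n <= l < L ^+ n.+1.
Proof.
move=> L1 l1.
have [m lm] : exists m, l < L ^+ m.
  exists (Num.bound (l / (L - 1))).
  have L0 : 0 < L - 1 by rewrite subr_gt0.
  have lb : l / (L - 1) < (Num.bound (l / (L - 1)))%:R.
    by apply: archi_boundP; rewrite divr_ge0 ?(ltW L0)// (le_trans _ l1).
  have bern n : 1 + n%:R * (L - 1) <= L ^+ n.
    elim: n => [|n ih]; first by rewrite mul0r addr0 expr0.
    rewrite exprS; apply: (@le_trans _ _ (L * (1 + n%:R * (L - 1)))); last first.
      by rewrite ler_pM2l// (lt_trans ltr01).
    have : 0 <= n%:R * (L - 1) by rewrite mulr_ge0 ?(ltW L0).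
    rewrite -natr1; nra.
  apply: lt_le_trans (bern _); rewrite ltr_pdivrMr// in lb.
  by rewrite ltr_wpDl.
elim: m lm => [|m ih] lm; first by rewrite expr0 ltNge l1 in lm.
have [h|h] := ltP l (L ^+ m); first exact: ih.
by exists m; rewrite h lm.
Qed.

(** The exponent is log t / log L, so that L^a = t. Iterating the hypothesis treats the powers of L;
    a general [l] lies between L^n and L^(n+1), which costs one factor [t]. The condition t <= L^2
    keeps the exponent at most 2, as (C3) demands. *)
Lemma geometric_growth (f : R -> R) (r0 L t : R) :
  0 <= r0 -> 1 < L -> 1 < t -> t <= L ^+ 2 ->
  (forall r, r0 < r -> 0 <= f r) ->
  (forall r s, r0 < r -> r <= s -> f r <= f s) ->
  (forall r, r0 < r -> t * f r <= f (L * r)) ->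
  exists2 a, 0 < a <= 2 & forall l r, 1 <= l -> r0 < r -> t^-1 * l `^ a * f r <= f (l * r).
Proof.
move=> r00 L1 t1 tL f0 fmono ft.
have L0 : 0 < L by rewrite (lt_trans ltr01).
have t0 : 0 < t by rewrite (lt_trans ltr01).
have lnL : 0 < ln L by rewrite ln_gt0.
pose a := ln t / ln L.
have a0 : 0 < a by rewrite divr_gt0// ln_gt0.
have La : L `^ a = t by rewrite /powR gt_eqF// /a divfK ?gt_eqF// lnK.
exists a.
  rewrite a0/= ler_pdivrMr//.
  by rewrite mulr_natl -lnXn// ler_ln// posrE exprn_gt0.
move=> l r l1 rr0.
have r_gt0 : 0 < r by rewrite (le_lt_trans r00).
have [n /andP[nl ln]] := exp_bracket L1 l1.
have Ln1 k : 1 <= L ^+ k by rewrite exprn_ege1// ltW.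
have it k : t ^+ k * f r <= f (L ^+ k * r).
  elim: k => [|k ih]; first by rewrite !expr0 !mul1r.
  rewrite !exprS -!mulrA; apply: (le_trans _ (ft _ _)); first by rewrite ler_pM2l.
  by rewrite (lt_le_trans rr0)// ler_peMl// ltW.
have h1 : l `^ a <= t ^+ n.+1.
  apply: (@le_trans _ _ ((L ^+ n.+1) `^ a)).
    by apply: ge0_ler_powR; rewrite ?nnegrE ?(ltW a0) ?(ltW ln) ?exprn_ge0 ?(ltW L0)// (le_trans ler01).
  by rewrite -powR_mulrn ?(ltW L0)// -powRrM mulrC powRrM La powR_mulrn ?(ltW t0).
apply: (@le_trans _ _ (f (L ^+ n * r))); last first.
  apply: fmono; last by rewrite ler_pM2r.
  by rewrite (lt_le_trans rr0)// ler_peMl// ltW.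
apply: le_trans (it n); rewrite ler_wpM2r ?f0//.
by rewrite mulrC ler_pdivrMr// -exprSr.
Qed.

End power_growth.

(** * The generalised inverse of [h] *)

Section inverse_of_h.
Variables (R : realType) (d : nat) (A : 'M[R]_d).
Variable N : {sigma_finite_measure set (d.-tuple R) -> \bar R}.
Hypotheses (HA : sym_nonneg_def A) (HN : levy_measure N).
Hypothesis Hh0 : hfun A N r @[r --> 0^'+] --> +oo%E.
Implicit Types (x y z : d.-tuple R) (r s : R).
Local Notation h := (hR A N).
Local Notation hinv := (hinv A N).

Lemma h_blows_up M : exists2 e, 0 < e & forall r, 0 < r -> r < e -> M < h r.
Proof.
have /cvgeyPgt/(_ M)[e /= e0 H] := Hh0.
exists e => // r r0 re; rewrite -lte_fin -hfunE//; apply: H => //=.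
by rewrite sub0r normrN ger0_norm// ltW.
Qed.

(** In dimension 0 the exponent vanishes identically, so [h] would be at most 0 by comparison with
    [PsiStar], against its blow-up at 0. Several later constants divide by the dimension. *)
Lemma dim_gt0 : (0 < d)%N.
Proof.
case: (posnP d) => // d0.
have [e e0 H] := h_blows_up 0.
have := H (e / 2); rewrite divr_gt0// ltr_pdivrMr// ltr_pMr// ltr1n => /(_ isT isT).
rewrite ltNge => /negP[]; rewrite (le_trans (h_le_PsiStar HA HN _))// ?divr_gt0//.
rewrite mulr_ge0_le0 ?(ltW (Ch_gt0 R d))//.
apply: PsiStar_le => [|x _]; first by rewrite invr_ge0 divr_ge0// ltW.
have x0 : enorm x = 0.
  by apply/eqP; rewrite eq_le enorm_ge0 andbT -(mul0r (0 : R)) -[X in X * _](congr1 (fun n => n%:R) d0)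
    enorm_le_max// => i; have := leq_trans (ltn_ord i) (eq_leq d0).
have := RePsi_le_Gfun HA HN x => /le_trans; apply.
rewrite pmulr_rle0// (enorm0_eq x0) /Gfun /qf ip0l add0r /Rintegral integral0_eq//.
by move=> z _; rewrite /trunc_sqr ip0l expr0n/= min_r.
Qed.

(** Makes the set in [hinv] nonempty, so that its infimum is a genuine one. The integrals along
    integer radii converge to 0 by dominated convergence, with the integrand at radius 1 as the
    dominating function. *)
Lemma h_vanishes s : 0 < s -> exists2 r, 0 < r & h r <= s.
Proof.
move=> s0.
pose f n z := (Num.min 1 (enorm z ^+ 2 / n.+1%:R ^+ 2))%:E : \bar R.
have mf n : measurable_fun setT (f n).
  by apply/measurable_EFinP; exact: measurable_h_integrand.
have cf : {ae N, forall z, setT z -> f n z @[n --> \oo] --> 0%E}.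
  apply: aeW => z _; apply/cvg_EFin => //; first by near=> n.
  rewrite /=.
  apply: (@squeeze_cvgr _ _ _ _ (cst 0) (fun n => enorm z ^+ 2 * harmonic n)).
  - near=> n; rewrite le_min ler01 divr_ge0 ?sqr_ge0//= ge_min ler_wpM2l ?sqr_ge0 ?orbT//.
    rewrite /harmonic lef_pV2 ?posrE ?exprn_gt0 ?ltr0n//.
    by rewrite -natrX ler_nat -[X in (X <= _)%N]expn1 leq_pexp2l.
  - exact: cvg_cst.
  - rewrite -(mulr0 (enorm z ^+ 2)); apply: cvgM; [exact: cvg_cst|exact: cvg_harmonic].
have ig : N.-integrable setT (f 0%N) by exact: (integrable_h HN 1).
have dom : {ae N, forall z n, setT z -> (`|f n z| <= f 0%N z)%E}.
  apply: aeW => z n _; rewrite gee0_abs ?lee_fin ?le_min ?ler01 ?divr_ge0 ?sqr_ge0//=.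
  rewrite ge_min lexx/= ge_min ler_wpM2l ?sqr_ge0 ?orbT// lef_pV2 ?posrE ?exprn_gt0 ?ltr0n//.
  by rewrite ler_pXn2r ?nnegrE// ler1n.
have [_ _ cI] := dominated_convergence measurableT mf (measurable_cst _) cf ig dom.
rewrite integral0 in cI.
have e2 : 0 < s / 2 by rewrite divr_gt0.
have : \forall n \near \oo, \int[N]_z Num.min 1 (enorm z ^+ 2 / n.+1%:R ^+ 2) < s / 2.
  by move/fine_cvg/cvgr_lt: cI; apply.
have : \forall n \near \oo, opnorm A * harmonic n < s / 2.
  have : opnorm A * harmonic n @[n --> \oo] --> (0 : R).
    rewrite -(mulr0 (opnorm A)); apply: cvgM; [exact: cvg_cst|exact: cvg_harmonic].
  by move/cvgr_lt; apply.
move=> h1 h2; near \oo => n.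
exists n.+1%:R; first by rewrite ltr0n.
have a1 : opnorm A * harmonic n < s / 2 by near: n.
have a2 : \int[N]_z Num.min 1 (enorm z ^+ 2 / n.+1%:R ^+ 2) < s / 2 by near: n.
have a3 : n.+1%:R ^- 2 * opnorm A <= opnorm A * harmonic n.
  rewrite mulrC ler_wpM2l ?opnorm_ge0// /harmonic lef_pV2 ?posrE ?exprn_gt0 ?ltr0n//.
  by rewrite -natrX ler_nat -[X in (X <= _)%N]expn1 leq_pexp2l.
by rewrite /hR (splitr s) ltW// ltrD// (le_lt_trans a3).
Unshelve. all: by end_near. Qed.

(** [hinv] is used later only through one-sided relations of this kind and its positivity; the
    strict inequality [s < h r] does the work of strict monotonicity. *)
Lemma hinv_ge r s : 0 < s -> 0 < r -> s < h r -> r <= hinv s.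
Proof.
move=> s0 r0 sr; apply: lb_le_inf.
  have [q q0 qs] := h_vanishes s0; exists q; split => //.
  by rewrite hfunE// lee_fin.
move=> q [q0]; rewrite hfunE// lee_fin => qs; rewrite leNgt; apply/negP => qr.
by have := le_lt_trans (le_trans (hR_nonincr HA HN q0 (ltW qr)) qs) sr; rewrite ltxx.
Qed.

Lemma hinv_le r s : 0 < r -> h r <= s -> hinv s <= r.
Proof.
move=> r0 rs; apply: ge_inf; last by split => //; rewrite hfunE// lee_fin.
by exists 0 => q [q0 _]; exact: ltW.
Qed.

Lemma lt_h_of_lt_hinv r s : 0 < r -> r < hinv s -> s < h r.
Proof. by move=> r0 rs; rewrite ltNge; apply/negP => /(hinv_le r0); rewrite leNgt rs. Qed.

Lemma hinv_gt0 s : 0 < s -> 0 < hinv s.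
Proof.
move=> s0; have [e e0 H] := h_blows_up s.
have e20 : 0 < e / 2 by rewrite divr_gt0.
apply: (lt_le_trans e20); apply: hinv_ge => //; apply: H => //.
by rewrite ltr_pdivrMr// ltr_pMr// ltr1n.
Qed.

End inverse_of_h.

(** * Equivalence of (C3) and (C4) *)

Section weak_scaling.
Variables (R : realType) (d : nat) (A : 'M[R]_d).
Variable N : {sigma_finite_measure set (d.-tuple R) -> \bar R}.
Hypotheses (HA : sym_nonneg_def A) (HN : levy_measure N).
Hypothesis Hh0 : hfun A N r @[r --> 0^'+] --> +oo%E.
Implicit Types (x y z : d.-tuple R) (r s : R).
Local Notation RePsi := (RePsi A N).
Local Notation PsiStar := (PsiStar A N).
Local Notation G := (Gfun A N).
Local Notation k := (kfun A N).
Local Notation kap := (coslb R).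

Lemma C4_kfunE x :
  ((qf A x)%:E + \int[N]_(z in [set z | (`|ip x z| < 1)%R]) (ip x z ^+ 2)%:E)%E = (k x)%:E.
Proof.
rewrite /kfun EFinD; congr (_ + _)%E.
rewrite /Rintegral fineK; last exact: (integrable_fin_num measurableT (integrable_small_sqr HN x)).
rewrite [LHS]integral_mkcond; apply: eq_integral => z _.
rewrite patchE /small_sqr; case: ifPn => [/set_mem/= ->//|]; rewrite notin_setE/= => /negP.
by move=> /negbTE ->.
Qed.

Lemma recip_ge0 (T : \bar R) : (0 < T)%E -> 0 <= recip T.
Proof. by case: T => //= r; rewrite lte_fin invr_ge0 => /ltW. Qed.

(** Jumps with |<x,z>| < 1 contribute at most l^2 times their share in [kfun]; for the others the
    truncation has already reached 1 and the scaling adds nothing. *)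
Lemma G_scale_kfun l x : 1 <= l -> G (vscale l x) <= l ^+ 2 * k x + G x.
Proof.
move=> l1; have l0 : 0 <= l by rewrite (le_trans ler01).
rewrite /Gfun /kfun qf_scale mulrDr -addrA lerD2l.
rewrite addrCA ler_wpDl ?qf_ge0// -RintegralZl//; last exact: integrable_small_sqr.
have i2 : N.-integrable setT (EFin \o (fun z => l ^+ 2 * small_sqr x z)).
  rewrite -[X in _.-integrable _ X]/(fun z => (l ^+ 2)%:E * (small_sqr x z)%:E)%E.
  by apply: integrableZl => //; exact: integrable_small_sqr.
rewrite -RintegralD//; last exact: integrable_trunc_sqr.
apply: le_Rintegral => //; first exact: integrable_trunc_sqr.
  exact: (integrableD measurableT i2 (integrable_trunc_sqr HN x)).
move=> z _; rewrite /small_sqr {1}/trunc_sqr ip_scalel exprMn.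
case: ifPn => [_|]; last first.
  rewrite -leNgt mulr0 add0r /trunc_sqr => u1.
  by rewrite [leRHS]min_l ?ge_min ?lexx// -real_normK ?num_real// exprn_ege1.
by rewrite ge_min lerDl le_min ler01 sqr_ge0 orbT.
Qed.

Lemma C3_C4 T : (0 < T)%E -> C3 A N T -> C4 A N T.
Proof.
move=> T0 [c3 [al [/andP[c0 c1] [/andP[a0 a2] [H1 H2]]]]].
have k0 := @coslb_gt0 R; have k1 := @coslb_le1 R.
(* [b] is chosen so that the scaling in (C3) with l^alpha = b turns the bound 48 / kap for [G]
   against [PsiStar] into G x <= (c3 / 4) PsiStar (l r). *)
pose b := 192 / (kap * c3 ^+ 2).
have b1 : 1 <= b.
  rewrite ler_pdivlMr ?mul1r ?(mulr_gt0 k0) ?exprn_gt0//.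
  have : kap * c3 ^+ 2 <= 1 by rewrite mulr_ile1 ?(ltW k0)// ?expr_le1 ?exprn_ge0 ?(ltW c0).
  lra.
pose l := b `^ al^-1.
have l1 : 1 <= l.
  by rewrite -(powRr0 b) ler_powR// invr_ge0 ltW.
have l0 : 0 < l by rewrite (lt_le_trans ltr01).
have la : l `^ al = b by rewrite -powRrM mulVf ?gt_eqF// powRr1// (le_trans ler01).
exists (4 * l ^+ 2 / c3); split.
  rewrite ler_pdivlMr// mul1r (le_trans c1)//.
  have : 1 <= l ^+ 2 by rewrite exprn_ege1.
  lra.
move=> x xT; rewrite C4_kfunE -EFinM lee_fin.
set r := enorm x in xT *.
have r0 : 0 <= r by exact: enorm_ge0.
have nlx : enorm (vscale l x) = l * r by rewrite enorm_scale ger0_norm// ltW.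
have lr : r <= l * r by rewrite ler_peMl.
have P0 := PsiStar_ge0 HA HN r0.
have h1 := H1 (vscale l x); rewrite nlx in h1; have {}h1 := h1 (lt_le_trans xT lr).
have h2 := RePsi_le_Gfun HA HN (vscale l x).
have h3 := G_scale_kfun x l1.
have h4 := G_le_PsiStar HA HN x; rewrite -/r in h4.
have h5 := H2 l r l1 xT; rewrite la in h5.
have h6 := PsiStar_mono HA HN r0 lr.
have h7 : G x <= c3 / 4 * PsiStar (l * r).
  apply: (le_trans h4); rewrite -(@ler_pM2l _ (4 / c3)) ?divr_gt0//.
  apply: le_trans (le_trans h5 _); last by rewrite !mulrA divfK ?gt_eqF// divff ?mul1r.
  rewrite le_eqVlt; apply/orP; left; apply/eqP; rewrite /b; field.
  by rewrite !gt_eqF.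
have -> : 4 * l ^+ 2 / c3 * k x = 4 / c3 * (l ^+ 2 * k x) by ring.
rewrite -ler_pdivrMl ?divr_gt0// invf_div.
(* The chain is c3 PsiStar(l r) <= RePsi(l x) <= 2 G(l x) <= 2 l^2 k(x) + (c3 / 2) PsiStar(l r); the
   last term is absorbed on the left. *)
have : c3 / 4 * PsiStar (l * r) <= l ^+ 2 * k x by lra.
by apply: le_trans; rewrite ler_wpM2l// divr_ge0// ltW.
Qed.

Lemma C4_C3 T : (0 < T)%E -> C4 A N T -> C3 A N T.
Proof.
move=> T0 [c4 [c41 H]].
have k0 := @coslb_gt0 R; have k1 := @coslb_le1 R.
have c40 : 0 < c4 by rewrite (lt_le_trans ltr01).
have {}H x : recip T < enorm x -> PsiStar (enorm x) <= c4 * k x.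
  by move=> /H; rewrite C4_kfunE -EFinM lee_fin.
have T1 := recip_ge0 T0.
(* Under (C4), G <= (48 / kap) PsiStar <= (48 c4 / kap) k, so q G(2 x) <= 3/4 k(2 x) <= G(2 x) -
   G(x). As q <= 3/4, the resulting growth factor (1 - q)^-1 is at most 2^2, which keeps the
   exponent at most 2. *)
pose q := 3 / 4 * (kap / (48 * c4)).
have c48 : 0 < 48 * c4 by rewrite mulr_gt0.
have q0 : 0 < q by rewrite mulr_gt0 ?(divr_gt0 k0)// divr_gt0.
have q34 : q <= 3 / 4.
  rewrite ler_piMr// ler_pdivrMr//; lra.
have q1 : 0 < 1 - q by lra.
(* Growth along a single ray suffices: under (C4), [G] at any vector of norm [r] above the threshold
   is comparable with [PsiStar r]. *)
pose i0 := Ordinal (dim_gt0 HA HN Hh0).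
pose e r := vscale r (evec R i0).
have ne r : 0 <= r -> enorm (e r) = r by move=> r0; rewrite enorm_scale enorm_evec mulr1 ger0_norm.
have e0 r : recip T < r -> 0 <= r by move=> h; rewrite (le_trans T1)// ltW.
have [|||r Tr|r s Tr rs|r Tr|al a02 Hal] := @geometric_growth R (G \o e) (recip T) 2 (1 - q)^-1 T1.
- by rewrite ltr1n.
- by rewrite invf_gt1//; lra.
- by rewrite -[leRHS]invrK lef_pV2 ?posrE ?invr_gt0 ?exprn_gt0// -exprVn; lra.
- exact: Gfun_ge0.
- have s0 : 0 < s by rewrite (lt_le_trans _ rs)// (le_lt_trans T1).
  rewrite /= (_ : e r = vscale (r / s) (e s)); last by rewrite vscaleA divfK// gt_eqF.
  apply: Gfun_scale_le => //.
  rewrite ger0_norm; last by rewrite divr_ge0 ?(ltW s0) ?(e0 _ Tr).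
  by rewrite ler_pdivrMr// mul1r.
- have r0 := e0 _ Tr; rewrite /= -[e (2 * r)]vscaleA -/(e r).
  have h1 := Gfun_double_sub HA HN (e r).
  have n2 : enorm (vscale 2 (e r)) = 2 * r by rewrite enorm_scale ne// ger0_norm.
  have h2 := H (vscale 2 (e r)); rewrite n2 in h2.
  have {}h2 : PsiStar (2 * r) <= c4 * k (vscale 2 (e r)).
    by apply: h2; rewrite (lt_le_trans Tr)// ler_peMl// ler1n.
  have h3 := G_le_PsiStar HA HN (vscale 2 (e r)); rewrite n2 in h3.
  rewrite mulrC ler_pdivrMr//.
  have : q * G (vscale 2 (e r)) <= 3 / 4 * k (vscale 2 (e r)).
    rewrite /q -mulrA ler_pM2l// mulrAC ler_pdivrMr ?mulr_gt0//.
    rewrite -ler_pdivlMl//; apply: (le_trans h3).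
    have -> : kap^-1 * (k (vscale 2 (e r)) * (48 * c4)) = 48 / kap * (c4 * k (vscale 2 (e r))) by ring.
    by rewrite ler_pM2l// divr_gt0.
  lra.
have hc (x : R) : x <= 1 -> 0 <= x -> kap / 48 * x / c4 <= kap / c4.
  move=> x1 x0; rewrite ler_pM2r ?invr_gt0// -mulrA ler_piMr ?ltW//.
  by lra.
(* One constant for both halves of (C3): kap / 48 and c4 convert between [G] and [PsiStar], and 1 -
   q is the step lost in [geometric_growth]. The first half alone would allow kap / c4, which is
   larger. *)
exists (kap / 48 * (1 - q) / c4), al; split.
  rewrite !mulr_gt0 ?invr_gt0//=.
  apply: (le_trans (hc _ _ _)); [lra|lra|].
  by rewrite ler_pdivrMr// mul1r (le_trans k1).
split => //; split.
  move=> x xT; apply: (@le_trans _ _ (kap / c4 * PsiStar (enorm x))).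
    by rewrite ler_wpM2r ?(PsiStar_ge0 HA HN) ?enorm_ge0//; apply: hc; lra.
  apply: le_trans (kfun_le_RePsi HA HN x).
  by rewrite -mulrA ler_pM2l// ler_pdivrMl//; exact: H.
move=> l r l1 Tr.
have r0 := e0 _ Tr; have l0 : 0 <= l by rewrite (le_trans ler01).
have h1 := G_le_PsiStar HA HN (e (l * r)); rewrite ne ?mulr_ge0// in h1.
have h2 := Hal l r l1 Tr; rewrite /= invrK in h2.
have h3 := H (e r); rewrite ne// in h3; have {}h3 := h3 Tr.
have h4 := kfun_le_Gfun A HN (e r).
have h5 : kap / 48 * G (e (l * r)) <= PsiStar (l * r).
  by rewrite -ler_pdivlMl ?divr_gt0// invf_div.
apply: le_trans h5.
rewrite -!mulrA ler_pM2l// ler_pM2l ?invr_gt0//; apply: le_trans h2.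
rewrite -[leRHS]mulrA ler_pM2l// mulrCA ler_wpM2l ?powR_ge0// ler_pdivrMl//.
apply: (le_trans h3); by rewrite ler_pM2l.
Qed.

End weak_scaling.

(** * Lebesgue measure on R^d *)

Section sigma_finite_pack.
Context dT (T : measurableType dT) (R : realType).
Variables (m : {measure set T -> \bar R}) (sf : sigma_finite setT m).

(** An alias carrying the proof of sigma-finiteness as a parameter, so that the structure can be
    declared on it. [sigma_finite_measureE] then allows a given measure to be replaced by an equal
    sigma-finite one. *)
Definition sf_measure of sigma_finite setT m : set T -> \bar R := m.

HB.instance Definition _ := Measure.copy (sf_measure sf) m.
HB.instance Definition _ := Measure_isSigmaFinite.Build _ _ _ (sf_measure sf) sf.

End sigma_finite_pack.

Lemma sigma_finite_measureE dT (T : measurableType dT) (R : realType)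
    (m : {measure set T -> \bar R}) : sigma_finite setT m ->
  exists M : {sigma_finite_measure set T -> \bar R}, (M : {measure set T -> \bar R}) = m.
Proof.
move=> sf; exists (sf_measure sf).
by case: m sf => f [].
Qed.

Section boxes.
Variables (R : realType) (d : nat).
Implicit Types a b x : d.-tuple R.

Definition box a b : set (d.-tuple R) := [set x | forall i, tnth a i < tnth x i <= tnth b i].
Definition ctuple (r : R) : d.-tuple R := [tuple r | i < d].
Definition cube (r : R) := box (ctuple (- r)) (ctuple r).

Lemma boxE a b : box a b = \bigcap_(i in [set: 'I_d])
  ((fun x => tnth x i) @^-1` `]tnth a i, tnth b i]%classic).
Proof.
by apply/seteqP; split => [x h i _ /=|x h i]; rewrite ?in_itv/=;
  [exact: h|have := h i I; rewrite /= in_itv].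
Qed.

Lemma measurable_coord_preimage i (B : set R) : measurable B ->
  measurable ((fun x : d.-tuple R => tnth x i) @^-1` B).
Proof.
move=> mB; rewrite -[X in measurable X]setTI.
exact: (@measurable_tnth _ R d i measurableT B mB).
Qed.

Lemma measurable_box a b : measurable (box a b).
Proof.
rewrite boxE; apply: fin_bigcap_measurable => // i _.
by apply: measurable_coord_preimage.
Qed.

Lemma measurable_cube r : measurable (cube r).
Proof. exact: measurable_box. Qed.

Definition boxes := [set box p.1 p.2 | p in [set: d.-tuple R * d.-tuple R]].

Lemma boxes_setI : setI_closed boxes.
Proof.
move=> _ _ [[a b] _ <-] [[a' b'] _ <-] /=.
exists ([tuple Num.max (tnth a i) (tnth a' i) | i < d],
        [tuple Num.min (tnth b i) (tnth b' i) | i < d]) => //=.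
apply/seteqP; split => [x h|x [h1 h2] i].
- split=> i; have := h i; rewrite !tnth_mktuple gt_max le_min => /andP[/andP[? ?] /andP[? ?]];
  exact/andP.
- have /andP[p1 p2] := h1 i; have /andP[p3 p4] := h2 i.
  by rewrite !tnth_mktuple gt_max le_min p1 p2 p3 p4.
Qed.

Lemma cube_cover : \bigcup_n cube n%:R = setT.
Proof.
rewrite -subTset => x _.
exists (\max_(i < d) (Num.bound `|tnth x i|))%N => // i; rewrite !tnth_mktuple.
set m := (\max_(i < d) _)%N.
have : `|tnth x i| < m%:R.
  apply: (@lt_le_trans _ _ (Num.bound `|tnth x i|)%:R); first exact: archi_boundP.
  by rewrite ler_nat /m (leq_bigmax i).
by rewrite ltr_norml => /andP[-> /ltW ->].
Qed.

Lemma cube_mono r s : r <= s -> cube r `<=` cube s.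
Proof.
move=> rs x h i; have := h i; rewrite !tnth_mktuple => /andP[h1 h2].
by rewrite (le_lt_trans _ h1) ?lerN2//= (le_trans h2).
Qed.

Lemma measurable_tupleE : @measurable _ (d.-tuple R) = <<s boxes >>.
Proof.
apply/seteqP; split; last first.
  apply: smallest_sub; first exact: sigma_algebra_measurable.
  by move=> _ [[a b] _ <-]; exact: measurable_box.
apply: smallest_sub; first exact: smallest_sigma_algebra.
move=> A; rewrite -bigcup_seq => -[i /= _ [B mB <-]]; rewrite setTI.
have : (<<s @ocitv R >>) B by exact: mB.
apply: (@smallest_sub _ _ _ [set B | <<s boxes >> ((fun x : d.-tuple R => tnth x i) @^-1` B)]).
  split => /=.
  - by rewrite preimage_set0; exact: sigma_algebra0.
  - move=> C mC /=; rewrite setTD preimage_setC -setTD.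
    by apply: sigma_algebraCD.
  - by move=> F mF /=; rewrite preimage_bigcup; exact: sigma_algebra_bigcup.
move=> _ [[u v] _ <-] /=.
(* A slab in coordinate [i] is the union over n of the boxes that have this slab as side [i] and are
   bounded by n in all other coordinates. *)
pose a n : d.-tuple R := [tuple if j == i then u else - n%:R | j < d].
pose b n : d.-tuple R := [tuple if j == i then v else n%:R | j < d].
rewrite (_ : _ @^-1` _ = \bigcup_n box (a n) (b n)).
  apply: sigma_algebra_bigcup => n; apply: sub_sigma_algebra.
  by exists (a n, b n).
apply/seteqP; split => [x /=|x [n _ /= h]]; last first.
  by have := h i; rewrite !tnth_mktuple eqxx in_itv.
rewrite in_itv/= => xi.
have : (\bigcup_n cube n%:R) x by rewrite cube_cover.
move=> [n _ h]; exists n => // j; have := h j; rewrite !tnth_mktuple.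
by case: eqP => [->|].
Qed.

End boxes.

Section lebesgue_tuple.
Variables (R : realType) (d : nat).
Implicit Types (m : {measure set (d.-tuple R) -> \bar R}) (x y z : d.-tuple R).

Lemma lebesgue_cube m r : is_lebesgue_tuple m -> 0 <= r -> m (cube r) = ((2 * r) ^+ d)%:E.
Proof.
move=> Hm r0; rewrite /cube /box Hm; congr (_%:E).
rewrite -[in RHS](card_ord d) -prodr_const; apply: eq_bigr => i _.
by rewrite !tnth_mktuple opprK max_l; lra.
Qed.

Lemma lebesgue_tuple_unique m1 m2 : is_lebesgue_tuple m1 -> is_lebesgue_tuple m2 ->
  forall A, measurable A -> m1 A = m2 A.
Proof.
move=> H1 H2; apply: (measure_unique (@boxes R d) (fun n => cube n%:R)).
- exact: measurable_tupleE.
- exact: boxes_setI.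
- by move=> n; exists (ctuple d (- n%:R), ctuple d n%:R).
- exact: cube_cover.
- by move=> _ [[a b] _ <-]; rewrite /box H1 H2.
- by move=> n; rewrite lebesgue_cube// ltry.
Qed.

Lemma lebesgue_sigma_finite m : is_lebesgue_tuple m -> sigma_finite setT m.
Proof.
move=> H; exists (fun n => cube n%:R); first by rewrite cube_cover.
by move=> n; split; [exact: measurable_cube|rewrite lebesgue_cube// ltry].
Qed.

Lemma measurable_translation y : measurable_fun setT (vadd y).
Proof. by apply: measurable_vadd => //; exact: measurable_cst. Qed.

Lemma lebesgue_translation m y (A : set (d.-tuple R)) : is_lebesgue_tuple m ->
  measurable A -> m (vadd y @^-1` A) = m A.
Proof.
move=> H mA; apply/esym.
have mt := measurable_translation y.
pose m' : {measure set _ -> \bar R} := pushforward m (vadd y).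
rewrite -[RHS]/(m' mt A); apply: lebesgue_tuple_unique => // a b.
rewrite /m' /= /pushforward.
rewrite (_ : _ @^-1` _ = box (vsub a y) (vsub b y)).
  by rewrite /box H; congr (_%:E); apply: eq_bigr => i _; rewrite !tnth_mktuple; congr Num.max; ring.
by apply/seteqP; split => x h i; have := h i; rewrite !tnth_mktuple ltrBlDl lerBrDl.
Qed.

Lemma ge0_integral_translation m y (f : d.-tuple R -> \bar R) : is_lebesgue_tuple m ->
  measurable_fun setT f -> (forall x, 0 <= f x)%E ->
  (\int[m]_x f (vadd y x) = \int[m]_x f x)%E.
Proof.
move=> H mf f0.
have mt := measurable_translation y.
pose m' : {measure set _ -> \bar R} := pushforward m (vadd y).
rewrite [RHS](@eq_measure_integral _ _ _ _ (m' mt) m); last first.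
  by move=> A mA _; rewrite /m' /= /pushforward lebesgue_translation.
by rewrite /m' [RHS](ge0_integral_pushforward mt)// => x _; exact: f0.
Qed.

End lebesgue_tuple.

(** * Lebesgue measure in dimension d + 1 as a product *)

Section lebesgue_cons.
Variables (R : realType) (d : nat).

Definition consv (p : R * d.-tuple R) : d.+1.-tuple R := [the d.+1.-tuple R of p.1 :: p.2].

Lemma measurable_consv : measurable_fun setT consv.
Proof. by apply: measurable_cons. Qed.

Lemma tnth_consvS p i : tnth (consv p) (lift ord0 i) = tnth p.2 i.
Proof. by rewrite tnthS. Qed.

Variable M : {sigma_finite_measure set (d.-tuple R) -> \bar R}.
Hypothesis HM : is_lebesgue_tuple M.

Lemma lebesgue_pushforward_consv :
  is_lebesgue_tuple (pushforward (@lebesgue_measure R \x M)%E consv).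
Proof.
move=> a b; rewrite /pushforward.
pose a' : d.-tuple R := [tuple tnth a (lift ord0 i) | i < d].
pose b' : d.-tuple R := [tuple tnth b (lift ord0 i) | i < d].
rewrite (_ : _ @^-1` _ = `]tnth a ord0, tnth b ord0]%classic `*` box a' b').
  rewrite product_measure1E//; last exact: measurable_box.
  rewrite /box HM /= lebesgue_measure_itv/= lte_fin big_ord_recl EFinM; congr (_ * _)%E.
    case: ltP => ab; first by rewrite -EFinB max_l// subr_ge0 ltW.
    by rewrite max_r// subr_le0.
  by congr (_%:E); apply: eq_bigr => i _; rewrite !tnth_mktuple.
apply/seteqP; split => [[u v] /= h|[u v] /= [h1 h2] i].
  split; first by rewrite in_itv/=; have := h ord0.
  by move=> i; have := h (lift ord0 i); rewrite tnth_consvS !tnth_mktuple.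
case: (unliftP ord0 i) => [j ->|->].
  by rewrite tnth_consvS; have := h2 j; rewrite !tnth_mktuple.
by rewrite in_itv/= in h1.
Qed.

Lemma lebesgue_consv (m : {measure set (d.+1.-tuple R) -> \bar R}) A :
  is_lebesgue_tuple m -> measurable A ->
  m A = pushforward (@lebesgue_measure R \x M)%E consv A.
Proof.
move=> Hm mA; have mc := measurable_consv.
pose m' : {measure set (d.+1.-tuple R) -> \bar R} :=
  pushforward (@lebesgue_measure R \x M)%E consv.
rewrite -[RHS]/(m' mc A); apply: lebesgue_tuple_unique => //.
exact: lebesgue_pushforward_consv.
Qed.

End lebesgue_cons.

(** * Fourier transforms of cube indicators *)

Section dominated_fubini.
Context dS dT (S : measurableType dS) (T : measurableType dT) (R : realType).
Variable m2 : {sigma_finite_measure set T -> \bar R}.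

Lemma dominated_integrable (f g : T -> R) : measurable_fun setT f ->
  (forall t, `|f t| <= g t) -> m2.-integrable setT (EFin \o g) ->
  m2.-integrable setT (EFin \o f).
Proof.
move=> mf fg ig; apply: (le_integrable measurableT _ _ ig).
  exact/measurable_EFinP.
by move=> t _ /=; rewrite lee_fin (le_trans (fg t))// ler_norm.
Qed.

Lemma measurable_section (f : S * T -> R) s : measurable_fun setT f ->
  measurable_fun setT (fun t => f (s, t)).
Proof. by move=> mf; apply: measurableT_comp => //; exact: pair1_measurable. Qed.

Lemma measurable_Rintegral (f : S * T -> R) (g : T -> R) : measurable_fun setT f ->
  (forall s t, `|f (s, t)| <= g t) -> m2.-integrable setT (EFin \o g) ->
  measurable_fun setT (fun s => \int[m2]_t f (s, t)).
Proof.
move=> mf fg ig.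
have mg : measurable_fun setT g by apply/measurable_EFinP; exact: measurable_int ig.
(* Adding [g] makes the integrand nonnegative, so Tonelli applies; the integral of [g] is subtracted
   afterwards. *)
pose h (p : S * T) := (g p.2 + f p)%:E.
have h0 p : (0 <= h p)%E.
  by rewrite lee_fin; case: p => s t; have := fg s t; rewrite ler_norml /= => /andP[]; lra.
have mh : measurable_fun setT h.
  apply/measurable_EFinP; apply: measurable_funD => //.
  by apply: measurableT_comp => //; exact: measurable_snd.
rewrite (_ : (fun s => _) = (fun s => fine (\int[m2]_t h (s, t)) - \int[m2]_t g t)).
  apply: measurable_funB => //; apply: measurableT_comp => //.
  exact: (@measurable_fun_fubini_tonelli_F _ _ _ _ _ m2 h mh h0).
apply/funext => s; rewrite -[X in _ = X - _]/(\int[m2]_t (g t + f (s, t))) RintegralD//.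
  by rewrite addrAC subrr add0r.
by apply: dominated_integrable ig => //; exact: measurable_section.
Qed.

Variable m1 : {sigma_finite_measure set S -> \bar R}.
Variables (f : S * T -> R) (g1 : S -> R) (g2 : T -> R).
Hypotheses (mf : measurable_fun setT f) (fg : forall s t, `|f (s, t)| <= g1 s * g2 t).
Hypotheses (g10 : forall s, 0 <= g1 s) (ig1 : m1.-integrable setT (EFin \o g1))
  (ig2 : m2.-integrable setT (EFin \o g2)).

Lemma integrable_section s : m2.-integrable setT (EFin \o (fun t => f (s, t))).
Proof.
apply: (@dominated_integrable _ (fun t => g1 s * g2 t)) => //; first exact: measurable_section.
rewrite -[X in _.-integrable _ X]/(fun t => (g1 s)%:E * (g2 t)%:E)%E.
exact: integrableZl.
Qed.

Lemma dominated_prod_integrable : (m1 \x m2)%E.-integrable setT (EFin \o f).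
Proof.
apply/integrable12ltyP; first exact/measurable_EFinP.
apply: (@le_lt_trans _ _ (\int[m1]_s ((g1 s)%:E * \int[m2]_t `|(g2 t)%:E|))%E).
  apply: ge0_le_integral => //.
  - by move=> s _; apply: integral_ge0.
  - apply: (@measurable_fun_fubini_tonelli_F _ _ _ _ _ m2 (fun p => `|(f p)%:E|%E)) => //.
    by apply: measurableT_comp => //; exact/measurable_EFinP.
  - apply: emeasurable_funM => //; exact: measurable_int ig1.
  - move=> s _; rewrite -ge0_integralZl//; last 2 first.
    + by apply: measurableT_comp => //; exact: measurable_int ig2.
    + by rewrite lee_fin.
    apply: ge0_le_integral => //.
    + apply: (@measurableT_comp _ _ _ _ _ _ abse _ (fun t => (f (s, t))%:E)) => //.
      by apply/measurable_EFinP; exact: measurable_section.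
    + apply: emeasurable_funM; first exact: measurable_cst.
      apply: (@measurableT_comp _ _ _ _ _ _ abse _ (fun t => (g2 t)%:E)) => //.
      exact: measurable_int ig2.
    + move=> t _; rewrite lee_fin (le_trans (fg s t))//.
      by rewrite ler_wpM2l// ler_norm.
have /integrableP[mg2 g2oo] := ig2.
have fin2 : (\int[m2]_t `|(g2 t)%:E| \is a fin_num)%E.
  by rewrite ge0_fin_numE// integral_ge0.
rewrite -(fineK fin2) ge0_integralZr//; last 3 first.
- exact: measurable_int ig1.
- by move=> s _; rewrite lee_fin.
- by rewrite lee_fin fine_ge0// integral_ge0.
rewrite lte_mul_pinfty//.
- by apply: integral_ge0 => s _; rewrite lee_fin.
- rewrite ge0_fin_numE; last by apply: integral_ge0 => s _; rewrite lee_fin.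
  have /integrableP[_] := ig1.
  rewrite (_ : (\int[m1]_x `|(EFin \o g1) x|)%E = (\int[m1]_x (g1 x)%:E)%E)//.
  by apply: eq_integral => s _; rewrite gee0_abs ?lee_fin//=.
- by rewrite ltry.
Qed.

Lemma EFin_Rintegral_section s : (\int[m2]_t f (s, t))%:E = (\int[m2]_t (f (s, t))%:E)%E.
Proof. by rewrite /Rintegral fineK//; exact: integrable_fin_num (integrable_section s). Qed.

Lemma integrable_Rintegral : m1.-integrable setT (EFin \o (fun s => \int[m2]_t f (s, t))).
Proof.
rewrite (_ : EFin \o _ = fubini_F m2 (EFin \o f)).
  exact: (integrable_fubini_F dominated_prod_integrable).
by apply/funext => s /=; exact: EFin_Rintegral_section.
Qed.

End dominated_fubini.

Section dominated_fubini_swap.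
Context dS dT (S : measurableType dS) (T : measurableType dT) (R : realType).
Variables (m1 : {sigma_finite_measure set S -> \bar R}) (m2 : {sigma_finite_measure set T -> \bar R}).
Variables (f : S * T -> R) (g1 : S -> R) (g2 : T -> R).
Hypotheses (mf : measurable_fun setT f) (fg : forall s t, `|f (s, t)| <= g1 s * g2 t).
Hypotheses (g10 : forall s, 0 <= g1 s) (g20 : forall t, 0 <= g2 t).
Hypotheses (ig1 : m1.-integrable setT (EFin \o g1)) (ig2 : m2.-integrable setT (EFin \o g2)).

Lemma Rintegral_swap :
  \int[m1]_s (\int[m2]_t f (s, t)) = \int[m2]_t (\int[m1]_s f (s, t)).
Proof.
rewrite {1 3}/Rintegral; congr fine.
under eq_integral do rewrite (EFin_Rintegral_section mf fg ig2).
pose f' (p : T * S) := f (p.2, p.1).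
have mf' : measurable_fun setT f'.
  apply: (measurableT_comp mf); apply/measurable_fun_pairP.
  by split; [exact: measurable_snd|exact: measurable_fst].
have fg' t s : `|f' (t, s)| <= g2 t * g1 s by rewrite mulrC; exact: fg.
under [RHS]eq_integral => t _.
  rewrite (_ : (\int[m1]_s f (s, t))%:E = (\int[m1]_s (f (s, t))%:E)%E); last first.
    exact: (EFin_Rintegral_section mf' fg' ig1).
  over.
exact: (Fubini (dominated_prod_integrable mf fg g10 ig1 ig2)).
Qed.

End dominated_fubini_swap.

(** * Autocorrelation and energy of a window function *)

Section autocorrelation.
Context (R : realType) (d : nat) dX (X : measurableType dX).
Variables (mu : probability X R) (m : {sigma_finite_measure set (d.-tuple R) -> \bar R}).
Variable w : d.-tuple R -> R.
Hypotheses (w0 : forall z, 0 <= w z) (w1 : forall z, w z <= 1).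
Hypotheses (mw : measurable_fun setT w) (iw : m.-integrable setT (EFin \o w)).
Variable g : X * d.-tuple R -> R.
Hypotheses (mg : measurable_fun setT g) (g1 : forall p, `|g p| <= 1).

(** Used twice: with the cosine of <x - a, u>, where the inner mean becomes the characteristic
    function, and with the shifted characteristic function itself, where it becomes its squared
    modulus. The window supplies the integrable majorant w(z) w(z'). *)
Lemma autocorrelation_swap :
  \int[mu]_x (\int[m]_z (\int[m]_z' (w z * w z' * g (x, vsub z' z)))) =
  \int[m]_z (\int[m]_z' (w z * w z' * \int[mu]_x g (x, vsub z' z))).
Proof.
have i1 : mu.-integrable setT (EFin \o (fun=> 1)).
  by apply: finite_measure_integrable_cst.
pose W := \int[m]_z w z.
have W0 : 0 <= W by apply: Rintegral_ge0.
pose F (p : (X * d.-tuple R) * d.-tuple R) := w p.1.2 * w p.2 * g (p.1.1, vsub p.2 p.1.2).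
have mF : measurable_fun setT F.
  apply: measurable_funM; first apply: measurable_funM.
  - by apply: measurableT_comp => //; apply: measurableT_comp.
  - by apply: measurableT_comp.
  - apply: measurableT_comp => //; apply/measurable_fun_pairP; split => /=.
      exact: (measurableT_comp measurable_fst measurable_fst).
    apply: measurable_vsub; first exact: measurable_snd.
    exact: (measurableT_comp measurable_snd measurable_fst).
have F_le x z z' : `|F ((x, z), z')| <= w z * w z'.
  by rewrite /F /= normrM ger0_norm ?mulr_ge0// ler_piMr ?mulr_ge0.
have h z z' x : `|w z * w z' * g (x, vsub z' z)| <= w z * w z' by exact: F_le.
pose G (p : X * d.-tuple R) := \int[m]_z' F (p, z').
have mG : measurable_fun setT G.
  apply: (@measurable_Rintegral _ _ _ _ _ m F w) => // -[x z] z'.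
  by apply: (le_trans (F_le _ _ _)); rewrite ler_piMl.
have G_le x z : `|G (x, z)| <= 1 * (w z * W).
  rewrite mul1r /W -RintegralZl//.
  apply: (le_trans (le_normr_Rintegral measurableT _)).
    apply: (@dominated_integrable _ _ _ m _ (fun z' => w z * w z')) => //.
      exact: (measurable_section (x, z) mF).
    rewrite -[X in _.-integrable _ X]/(fun t => (w z)%:E * (w t)%:E)%E.
    exact: integrableZl.
  apply: le_Rintegral; [exact: measurableT| | |by move=> z' _; exact: F_le].
    apply: (@dominated_integrable _ _ _ m _ (fun z' => w z * w z')) => //.
    - by apply: measurableT_comp => //; exact: (measurable_section (x, z) mF).
    - by move=> z'; rewrite normr_id; exact: F_le.
    - rewrite -[X in _.-integrable _ X]/(fun t => (w z)%:E * (w t)%:E)%E.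
      exact: integrableZl.
  rewrite -[X in _.-integrable _ X]/(fun t => (w z)%:E * (w t)%:E)%E.
  exact: integrableZl.
(* Two exchanges: first [x] with [z], where the inner integral over [z'] is majorised by w(z) times
   the mass of the window, then [x] with [z'] for fixed [z]. *)
rewrite (@Rintegral_swap _ _ _ _ _ mu m G (fun=> 1) (fun z => w z * W))//; last first.
  rewrite (_ : EFin \o _ = fun z => W%:E * (w z)%:E)%E; first exact: integrableZl.
  by apply/funext => z /=; rewrite mulrC.
apply: eq_Rintegral => z _; rewrite /G /F /=.
pose F2 (p : X * d.-tuple R) := w z * w p.2 * g (p.1, vsub p.2 z).
rewrite (@Rintegral_swap _ _ _ _ _ mu m F2 (fun=> 1) w)//; first last.
- by move=> x z'; rewrite mul1r (le_trans (h _ _ _))// ler_piMl.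
- apply: measurable_funM; first apply: measurable_funM => //.
  + by apply: measurableT_comp.
  + apply: measurableT_comp => //; apply/measurable_fun_pairP; split.
      exact: measurable_fst.
    by apply: measurable_vsub; [exact: measurable_snd|exact: measurable_cst].
apply: eq_Rintegral => z' _; rewrite /F2 /= RintegralZl//.
apply: (@dominated_integrable _ _ _ mu _ (fun=> 1)) => //.
by apply: measurableT_comp => //; apply/measurable_fun_pairP; split.
Qed.

End autocorrelation.

Section energy.
Context (R : realType) (d : nat) (m : {sigma_finite_measure set (d.-tuple R) -> \bar R}).
Variable w : d.-tuple R -> R.
Hypotheses (w0 : forall z, 0 <= w z) (w1 : forall z, w z <= 1).
Hypotheses (mw : measurable_fun setT w) (iw : m.-integrable setT (EFin \o w)).
Implicit Types (x y z : d.-tuple R).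

Definition cosT y := \int[m]_z (w z * cos (ip y z)).
Definition sinT y := \int[m]_z (w z * sin (ip y z)).
(** The squared modulus of the Fourier transform of [w], whose real and imaginary parts are [cosT]
    and [sinT]. *)
Definition energy y := cosT y ^+ 2 + sinT y ^+ 2.

Lemma measurable_cosip y : measurable_fun setT (fun z => cos (ip y z)).
Proof.
apply: measurableT_comp; first by apply: continuous_measurable_fun; exact: continuous_cos.
by apply: measurable_ip => //; exact: measurable_cst.
Qed.

Lemma measurable_sinip y : measurable_fun setT (fun z => sin (ip y z)).
Proof.
apply: measurableT_comp; first by apply: continuous_measurable_fun; exact: continuous_sin.
by apply: measurable_ip => //; exact: measurable_cst.
Qed.

Lemma w_abs_le (t : R) z : `|t| <= 1 -> `|w z * t| <= w z.
Proof. by move=> t1; rewrite normrM ger0_norm// ler_piMr. Qed.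

Lemma integrable_wcos y : m.-integrable setT (EFin \o (fun z => w z * cos (ip y z))).
Proof.
apply: (dominated_integrable _ _ iw) => [|z]; last by rewrite w_abs_le// cos_max.
by apply: measurable_funM => //; exact: measurable_cosip.
Qed.

Lemma integrable_wsin y : m.-integrable setT (EFin \o (fun z => w z * sin (ip y z))).
Proof.
apply: (dominated_integrable _ _ iw) => [|z]; last by rewrite w_abs_le// sin_max.
by apply: measurable_funM => //; exact: measurable_sinip.
Qed.

Lemma measurable_energy : measurable_fun setT energy.
Proof.
apply: measurable_funD; apply: measurable_funX.
- apply: (@measurable_Rintegral _ _ _ _ _ m (fun p => w p.2 * cos (ip p.1 p.2)) w) => //.
    apply: measurable_funM; first by apply: measurableT_comp.
    apply: measurableT_comp; first by apply: continuous_measurable_fun; exact: continuous_cos.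
    exact: measurable_ip.
  by move=> y z; rewrite w_abs_le// cos_max.
- apply: (@measurable_Rintegral _ _ _ _ _ m (fun p => w p.2 * sin (ip p.1 p.2)) w) => //.
    apply: measurable_funM; first by apply: measurableT_comp.
    apply: measurableT_comp; first by apply: continuous_measurable_fun; exact: continuous_sin.
    exact: measurable_ip.
  by move=> y z; rewrite w_abs_le// sin_max.
Qed.

(** The squared modulus is the transform of the autocorrelation of [w]; in real terms this is the
    expansion of the cosine of <y,z'> - <y,z>. *)
Lemma energyE y :
  energy y = \int[m]_z (\int[m]_z' (w z * w z' * cos (ip y (vsub z' z)))).
Proof.
have e z : \int[m]_z' (w z * w z' * cos (ip y (vsub z' z))) =
    cosT y * (w z * cos (ip y z)) + sinT y * (w z * sin (ip y z)).
  rewrite [cosT y * _]mulrC [sinT y * _]mulrC -!RintegralZl//;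
    [|exact: integrable_wsin|exact: integrable_wcos].
  rewrite -RintegralD//; first last.
  - rewrite -[X in _.-integrable _ X]/(fun t => (w z * sin (ip y z))%:E * (w t * sin (ip y t))%:E)%E.
    by apply: integrableZl => //; exact: integrable_wsin.
  - rewrite -[X in _.-integrable _ X]/(fun t => (w z * cos (ip y z))%:E * (w t * cos (ip y t))%:E)%E.
    by apply: integrableZl => //; exact: integrable_wcos.
  by apply: eq_Rintegral => z' _; rewrite ip_subr cosB; ring.
under eq_Rintegral do rewrite e.
rewrite RintegralD//; first last.
- rewrite -[X in _.-integrable _ X]/(fun t => (sinT y)%:E * (w t * sin (ip y t))%:E)%E.
  by apply: integrableZl => //; exact: integrable_wsin.
- rewrite -[X in _.-integrable _ X]/(fun t => (cosT y)%:E * (w t * cos (ip y t))%:E)%E.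
  by apply: integrableZl => //; exact: integrable_wcos.
by rewrite !RintegralZl// /energy ?expr2//; [exact: integrable_wsin|exact: integrable_wcos].
Qed.

End energy.

Lemma indic_ge0 (R : realType) (T : Type) (D : set T) (x : T) : 0 <= \1_D x :> R.
Proof. by rewrite indicE. Qed.

(** * The transform of an interval *)

Section fourier_of_interval.
Variable R : realType.
Implicit Types r t u : R.
Local Notation leb := (@lebesgue_measure R).
Local Notation I r := (`](- r), r]%classic : set R).

Definition cos1T r t : R := \int[leb]_u (\1_(I r) u * cos (t * u)).
Definition sin1T r t : R := \int[leb]_u (\1_(I r) u * sin (t * u)).

Lemma Rintegral_indic_itv r (f F : R -> R) : 0 < r -> continuous f ->
  (forall u, is_derive u 1 F (f u)) ->
  \int[leb]_u (\1_(I r) u * f u) = F r - F (- r).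
Proof.
move=> r0 cf dF.
have cF : continuous F.
  by move=> u; apply: differentiable_continuous; apply/derivable1_diffP; apply: ex_derive.
have mf : measurable_fun setT f by exact: continuous_measurable_fun.
rewrite /Rintegral.
rewrite (_ : (\int[leb]_u _)%E = (\int[leb]_(u in `](- r)%R, r%R]) (f u)%:E)%E); last first.
  rewrite [RHS]integral_mkcond; apply: eq_integral => u _.
  by rewrite patchE indicE; case: ifPn => _; rewrite ?mul1r ?mul0r.
rewrite integral_itv_obnd_cbnd; last exact/measurable_EFinP/measurable_funTS.
rewrite (@continuous_FTC2 _ f F) ?gtrN//.
- exact: continuous_subspaceT.
- split.
  + by move=> u _; apply: ex_derive.
  + by apply: cvg_at_right_filter; exact: cF.
  + by apply: cvg_at_left_filter; exact: cF.
- by move=> u _; rewrite derive1E; apply: derive_val.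
Qed.

Lemma continuous_mull t : continuous (fun u : R => t * u).
Proof. by move=> u; apply: cvgM; [exact: cvg_cst|exact: cvg_id]. Qed.

Lemma continuous_cos_mull t : continuous (fun u : R => cos (t * u)).
Proof.
move=> u; apply: (@continuous_comp _ _ _ (fun u => t * u) cos); last exact: continuous_cos.
exact: continuous_mull.
Qed.

Lemma continuous_sin_mull t : continuous (fun u : R => sin (t * u)).
Proof.
move=> u; apply: (@continuous_comp _ _ _ (fun u => t * u) sin); last exact: continuous_sin.
exact: continuous_mull.
Qed.

(** A majorant of the kernel 4 sin(r t)^2 / t^2, obtained from sin(v)^2 <= min(1, v^2). Unlike the
    kernel it has an elementary primitive, 8 r atan(r t), so its integral over the line is
    explicit. *)
Definition energy1_bound r t : R := 8 * r ^+ 2 * (oneDsqr (r * t))^-1.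

Lemma energy1_le r t : 0 < r -> cos1T r t ^+ 2 + sin1T r t ^+ 2 <= energy1_bound r t.
Proof.
move=> r0; rewrite /energy1_bound /oneDsqr.
have o0 : 0 < 1 + (r * t) ^+ 2 by rewrite ltr_pwDl// sqr_ge0.
rewrite ler_pdivlMr//.
have [->|t0] := eqVneq t 0.
  have -> : cos1T r 0 = r - - r.
    apply: (@Rintegral_indic_itv _ _ (fun u => u)) => //; first exact: continuous_cos_mull.
    by move=> u; rewrite mul0r cos0; exact: is_derive_id.
  have -> : sin1T r 0 = 0 - 0.
    apply: (@Rintegral_indic_itv _ _ (fun u => 0)) => //; first exact: continuous_sin_mull.
    by move=> u; rewrite mul0r sin0; exact: is_derive_cst.
  by rewrite mulr0 expr0n/= addr0 mulr1 subr0 expr0n/= addr0; have := sqr_ge0 r; nra.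
have -> : cos1T r t = sin (t * r) / t - sin (t * - r) / t.
  apply: (@Rintegral_indic_itv _ _ (fun u => sin (t * u) / t)) => //; first exact: continuous_cos_mull.
  by move=> u; apply: trigger_derive; rewrite /GRing.scale/=; field.
have -> : sin1T r t = - cos (t * r) / t - - cos (t * - r) / t.
  apply: (@Rintegral_indic_itv _ _ (fun u => - cos (t * u) / t)) => //; first exact: continuous_sin_mull.
  by move=> u; apply: trigger_derive; rewrite /GRing.scale/=; field.
rewrite mulrN cosN sinN subrr expr0n/= addr0.
set s := sin (t * r).
have s1 : s ^+ 2 <= 1 by rewrite -real_normK ?num_real// expr_le1// sin_max.
have s2 : s ^+ 2 <= (t * r) ^+ 2.
  by rewrite -[leLHS]real_normK ?num_real// -[leRHS]real_normK ?num_real// ler_pXn2r ?nnegrE// abs_sin_le.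
have -> : s / t - - s / t = 2 * s / t by field.
rewrite expr_div_n mulrAC ler_pdivrMr; last by rewrite exprn_even_gt0.
have : s ^+ 2 * (1 + (r * t) ^+ 2) <= 2 * (t * r) ^+ 2.
  rewrite mulrDr mulr1 [r * t]mulrC.
  have : s ^+ 2 * (t * r) ^+ 2 <= (t * r) ^+ 2 by rewrite ler_piMl// sqr_ge0.
  lra.
by rewrite !exprMn; nra.
Qed.

Lemma continuous_energy1_bound r : continuous (energy1_bound r).
Proof.
move=> t; apply: cvgM; first exact: cvg_cst.
apply: (@continuous_comp _ _ _ (fun t => r * t) (fun x => (oneDsqr x)^-1)).
  exact: continuous_mull.
exact: continuous_oneDsqrV.
Qed.

Lemma energy1_bound_ge0 r t : 0 <= energy1_bound r t.
Proof.
by apply: mulr_ge0; [rewrite mulr_ge0 ?sqr_ge0|rewrite invr_ge0 (le_trans ler01 (oneDsqr_ge1 _))].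
Qed.

Lemma integral_energy1_bound r : 0 < r ->
  (\int[leb]_t (energy1_bound r t)%:E = (8 * pi * r)%:E)%E.
Proof.
move=> r0; have r1 : r != 0 by rewrite gt_eqF.
rewrite ge0_symfun_integralT; first last.
- by move=> t; rewrite /energy1_bound /oneDsqr /= mulrN sqrrN.
- exact: continuous_energy1_bound.
- exact: energy1_bound_ge0.
have dF (t : R) : is_derive t 1 (fun t : R => 8 * r * atan (r * t)) (energy1_bound r t).
  apply: trigger_derive; rewrite /GRing.scale/= /energy1_bound /oneDsqr.
  have : 1 + (r * t) ^+ 2 != 0 by rewrite gt_eqF// ltr_pwDl// sqr_ge0.
  by move=> h; field.
have cF : continuous (fun t : R => 8 * r * atan (r * t)).
  by move=> u; apply: differentiable_continuous; apply/derivable1_diffP; apply: ex_derive.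
rewrite -set_itvcy (@ge0_continuous_FTC2y _ _ (fun t => 8 * r * atan (r * t)) _ (8 * r * (pi / 2))).
- by rewrite mulr0 atan0 mulr0 -EFinB -EFinM; congr (_%:E); field.
- by move=> t _; exact: energy1_bound_ge0.
- by apply: continuous_subspaceT; exact: continuous_energy1_bound.
- apply: cvgM; first exact: cvg_cst.
  apply: (@cvg_comp _ _ _ (fun t => r * t) atan _ _ _ _ (@cvgy_atan R)).
  apply/cvgryPge => a; exists (r^-1 * a); split; first exact: num_real.
  by move=> t /= /ltW; rewrite ler_pdivrMl.
- by move=> t _; apply: ex_derive.
- by apply: cvg_at_right_filter; exact: cF.
- by move=> t _; rewrite derive1E; apply: derive_val.
Qed.

End fourier_of_interval.

(** * The energy of a cube, by induction on the dimension *)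

Section cube_energy.
Variable R : realType.
Local Notation leb := (@lebesgue_measure R).
Local Notation I r := (`](- r), r]%classic : set R).

Lemma indic_cube_consv d r (u : R) (v : d.-tuple R) :
  \1_(cube r) (consv (u, v)) = \1_(I r) u * \1_(cube r) v :> R.
Proof.
rewrite !indicE -natrM mulnb; congr (_%:R).
apply: congr1; apply/idP/andP => [/set_mem h|[/set_mem h1 /set_mem h2]].
  split; apply/mem_set => /=.
    by rewrite in_itv/=; have := h ord0; rewrite !tnth_mktuple.
  by move=> i; have := h (lift ord0 i); rewrite tnth_consvS !tnth_mktuple.
apply/mem_set => i; case: (unliftP ord0 i) => [j ->|->].
  by rewrite tnth_consvS; have := h2 j; rewrite !tnth_mktuple.
by rewrite /= in_itv/= in h1; rewrite !tnth_mktuple.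
Qed.

Lemma ip_consv d t u (y v : d.-tuple R) :
  ip (consv (t, y)) (consv (u, v)) = t * u + ip y v.
Proof. by rewrite /ip big_ord_recl; congr (_ + _); apply: eq_bigr => i _; rewrite !tnth_consvS. Qed.

Lemma integrable_indic_cube d (m : {measure set (d.-tuple R) -> \bar R}) r :
  is_lebesgue_tuple m -> 0 <= r -> m.-integrable setT (EFin \o \1_(cube r)).
Proof.
move=> Hm r0; apply/integrableP; split.
  by apply/measurable_EFinP; exact: measurable_indic (measurable_cube r).
under eq_integral do rewrite gee0_abs ?lee_fin//.
by rewrite integral_indic ?setIT ?lebesgue_cube ?ltry//; exact: measurable_cube.
Qed.

Lemma Rintegral_indic_cube d (m : {measure set (d.-tuple R) -> \bar R}) r :
  is_lebesgue_tuple m -> 0 <= r -> \int[m]_z \1_(cube r) z = (2 * r) ^+ d.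
Proof.
move=> Hm r0; rewrite /Rintegral integral_indic ?setIT ?lebesgue_cube//.
exact: measurable_cube.
Qed.

(** The theorem supplies Lebesgue measure in one dimension only, while the induction for the energy
    of a cube also needs it in all lower ones. It starts from the point mass in dimension 0. *)
Lemma lebesgue_tuple_exists d :
  exists M : {sigma_finite_measure set (d.-tuple R) -> \bar R}, is_lebesgue_tuple M.
Proof.
elim: d => [|d [M HM]].
  pose M0 : {measure set (0.-tuple R) -> \bar R} := dirac (vzero R 0).
  have H0 : is_lebesgue_tuple M0.
    by move=> a b; rewrite /M0 /= diracE mem_set ?big_ord0// => -[].
  have [M ME] := sigma_finite_measureE (lebesgue_sigma_finite H0).
  by exists M; move: H0; rewrite -ME.
have mc : measurable_fun [set: (measurableTypeR R * d.-tuple R)%type] (@consv R d).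
  exact: measurable_consv.
pose m' : {measure set (d.+1.-tuple R) -> \bar R} := pushforward (leb \x M)%E (@consv R d).
have H' : is_lebesgue_tuple (m' mc) by exact: lebesgue_pushforward_consv.
have [M' ME] := sigma_finite_measureE (lebesgue_sigma_finite H').
by exists M'; move: H'; rewrite -ME.
Qed.

Section step.
Variables (d : nat) (M : {sigma_finite_measure set (d.-tuple R) -> \bar R}).
Variables (m : {sigma_finite_measure set (d.+1.-tuple R) -> \bar R}).
Hypotheses (HM : is_lebesgue_tuple M) (Hm : is_lebesgue_tuple m).
Lemma ge0_integral_consv (f : d.+1.-tuple R -> \bar R) : measurable_fun setT f ->
  (forall x, 0 <= f x)%E ->
  (\int[m]_x f x = \int[leb]_t \int[M]_y f (consv (t, y)))%E.
Proof.
move=> mf f0; have mc : measurable_fun [set: (measurableTypeR R * d.-tuple R)%type] (@consv R d).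
  exact: measurable_consv.
pose m' : {measure set (d.+1.-tuple R) -> \bar R} := pushforward (leb \x M)%E (@consv R d).
rewrite (@eq_measure_integral _ _ _ _ (m' mc) m); last first.
  by move=> A mA _; rewrite (lebesgue_consv HM Hm mA).
rewrite /m' (ge0_integral_pushforward mc)// preimage_setT.
exact: (@fubini_tonelli1 _ _ _ _ R leb M _ (measurableT_comp mf mc) (fun p => f0 _)).
Qed.

Variable r : R.
Hypothesis r0 : 0 < r.

Lemma Rintegral_consv (f : d.+1.-tuple R -> R) : measurable_fun setT f ->
  (forall u v, `|f (consv (u, v))| <= \1_(I r) u * \1_(cube r) v) ->
  \int[m]_x f x = \int[leb]_t (\int[M]_y f (consv (t, y))).
Proof.
move=> mf fb; have mc : measurable_fun [set: (measurableTypeR R * d.-tuple R)%type] (@consv R d).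
  exact: measurable_consv.
have mfc := measurableT_comp mf mc.
have iI : leb.-integrable setT (EFin \o \1_(I r)) by apply: integrable_indic_itv.
have iC := integrable_indic_cube HM (ltW r0).
have ifc := dominated_prod_integrable mfc fb (fun s => indic_ge0 R _ s) iI iC.
rewrite {1}/Rintegral.
pose m' : {measure set (d.+1.-tuple R) -> \bar R} := pushforward (leb \x M)%E (@consv R d).
rewrite (@eq_measure_integral _ _ _ _ (m' mc) m); last first.
  by move=> A mA _; rewrite (lebesgue_consv HM Hm mA).
have mEf : measurable_fun setT (EFin \o f) by exact/measurable_EFinP.
rewrite /m' (integral_pushforward mc mEf)// preimage_setT.
rewrite -(integral12_prod_meas1 ifc).
rewrite [RHS]/Rintegral; congr fine; apply: eq_integral => u _.
by rewrite (EFin_Rintegral_section mfc fb iC).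
Qed.

Lemma measurable_trig_weight n (q : n.-tuple R) (g : R -> R) : continuous g ->
  measurable_fun setT (fun z : n.-tuple R => \1_(cube r) z * g (ip q z)).
Proof.
move=> cg; apply: measurable_funM; first exact: measurable_indic (measurable_cube r).
apply: measurableT_comp; first by apply: continuous_measurable_fun.
by apply: measurable_ip => //; exact: measurable_cst.
Qed.

Lemma trig_weight_bound (g : R -> R) (q : d.+1.-tuple R) : (forall t, `|g t| <= 1) -> forall u v,
  `|\1_(cube r) (consv (u, v)) * g (ip q (consv (u, v)))| <= \1_(I r) u * \1_(cube r) v.
Proof.
move=> g1 u v; rewrite indic_cube_consv normrM ger0_norm ?mulr_ge0 ?indic_ge0//.
by rewrite ler_piMr ?mulr_ge0 ?indic_ge0.
Qed.

Lemma integrable_1trig (t : R) (g : R -> R) : continuous g -> (forall t, `|g t| <= 1) ->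
  leb.-integrable setT (EFin \o (fun u => \1_(I r) u * g (t * u))).
Proof.
move=> cg g1; apply: (@dominated_integrable _ _ _ leb _ \1_(I r)).
- apply: measurable_funM; first exact: measurable_indic.
  apply: (measurableT_comp (continuous_measurable_fun cg)).
  by apply: continuous_measurable_fun; exact: continuous_mull.
- by move=> u; rewrite normrM ger0_norm ?indic_ge0// ler_piMr ?indic_ge0.
- by apply: integrable_indic_itv.
Qed.

Local Notation w := (\1_(cube r)).

Lemma indic_cube_le1 n (z : n.-tuple R) : \1_(cube r) z <= 1 :> R.
Proof. by rewrite indicE lern1 leq_b1. Qed.

Let iwcos := integrable_wcos (fun z => indic_ge0 R _ z)
  (measurable_indic (measurable_cube r)) (integrable_indic_cube HM (ltW r0)).
Let iwsin := integrable_wsin (fun z => indic_ge0 R _ z)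
  (measurable_indic (measurable_cube r)) (integrable_indic_cube HM (ltW r0)).
Let icosM t := @integrable_1trig t _ (@continuous_cos R) (@cos_max R).
Let isinM t := @integrable_1trig t _ (@continuous_sin R) (@sin_max R).

Lemma integrableZl_R dT (T : measurableType dT) (mu : {measure set T -> \bar R}) (k : R) (f : T -> R) :
  mu.-integrable setT (EFin \o f) -> mu.-integrable setT (EFin \o (fun t => k * f t)).
Proof. by move=> h; apply: (integrableZl measurableT k h). Qed.

(** Together with [sinT_consv] this is the product rule for real and imaginary parts: the transform
    of a product cube is the product of the transforms, hence the energies multiply. *)
Lemma cosT_consv t y : cosT m w (consv (t, y)) =
  cos1T r t * cosT M w y - sin1T r t * sinT M w y.
Proof.
rewrite /cosT Rintegral_consv; first last.
- by apply: trig_weight_bound; exact: cos_max.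
- by apply: measurable_trig_weight; exact: continuous_cos.
transitivity (\int[leb]_u (cosT M w y * (\1_(I r) u * cos (t * u)) - sinT M w y * (\1_(I r) u * sin (t * u)))).
  apply: eq_Rintegral => u _.
  transitivity (\int[M]_v (\1_(I r) u * cos (t * u) * (w v * cos (ip y v)) -
      \1_(I r) u * sin (t * u) * (w v * sin (ip y v)))).
    by apply: eq_Rintegral => v _; rewrite indic_cube_consv ip_consv cosD; ring.
  rewrite RintegralB//; try (by apply: integrableZl_R; first [exact: iwcos|exact: iwsin]).
  rewrite !RintegralZl//; try (by first [exact: iwcos|exact: iwsin]).
  by rewrite /cosT /sinT; ring.
rewrite RintegralB//; try (by apply: integrableZl_R; first [exact: icosM|exact: isinM]).
rewrite !RintegralZl//; try (by first [exact: icosM|exact: isinM]).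
by rewrite /cos1T /sin1T /cosT /sinT; ring.
Qed.

Lemma sinT_consv t y : sinT m w (consv (t, y)) =
  sin1T r t * cosT M w y + cos1T r t * sinT M w y.
Proof.
rewrite /sinT Rintegral_consv; first last.
- by apply: trig_weight_bound; exact: sin_max.
- by apply: measurable_trig_weight; exact: continuous_sin.
transitivity (\int[leb]_u (cosT M w y * (\1_(I r) u * sin (t * u)) + sinT M w y * (\1_(I r) u * cos (t * u)))).
  apply: eq_Rintegral => u _.
  transitivity (\int[M]_v (\1_(I r) u * sin (t * u) * (w v * cos (ip y v)) +
      \1_(I r) u * cos (t * u) * (w v * sin (ip y v)))).
    by apply: eq_Rintegral => v _; rewrite indic_cube_consv ip_consv sinD; ring.
  rewrite RintegralD//; try (by apply: integrableZl_R; first [exact: iwcos|exact: iwsin]).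
  rewrite !RintegralZl//; try (by first [exact: iwcos|exact: iwsin]).
  by rewrite /cosT /sinT; ring.
rewrite RintegralD//; try (by apply: integrableZl_R; first [exact: icosM|exact: isinM]).
rewrite !RintegralZl//; try (by first [exact: icosM|exact: isinM]).
by rewrite /cos1T /sin1T /cosT /sinT; ring.
Qed.

Lemma energy_consv t y :
  energy m w (consv (t, y)) = (cos1T r t ^+ 2 + sin1T r t ^+ 2) * energy M w y.
Proof. by rewrite /energy cosT_consv sinT_consv; ring. Qed.

End step.

(** Stands in for Plancherel's identity, which would give (4 pi r)^d. The factor 2 per dimension is
    the price of the majorant [energy1_bound], and an upper bound is all that is required. *)
Lemma integral_energy_cube d (m : {sigma_finite_measure set (d.-tuple R) -> \bar R}) r :
  is_lebesgue_tuple m -> 0 < r ->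
  (\int[m]_y (energy m \1_(cube r) y)%:E <= ((8 * pi * r) ^+ d)%:E)%E.
Proof.
move=> Hm r0; elim: d m Hm => [|d ih] m Hm.
  have w1 : (\1_(cube r) : 0.-tuple R -> R) = cst 1.
    by apply/funext => z; rewrite indicE mem_set// => -[].
  have e1 y : energy m \1_(cube r) y = 1.
    rewrite /energy /cosT /sinT w1 /=.
    rewrite (_ : (\int[m]_z _) = \int[m]_z \1_(cube r) z); last first.
      by apply: eq_Rintegral => z _; rewrite w1 /ip big_ord0 cos0 mulr1.
    rewrite Rintegral_indic_cube ?(ltW r0)// expr0 expr1n.
    by rewrite {1}/Rintegral integral0_eq ?expr0n ?addr0// => z _; rewrite /ip big_ord0 sin0 mulr0.
  under eq_integral do rewrite e1.
  rewrite integral_cst// mul1e expr0.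
  have := @lebesgue_cube _ _ m 0 Hm (lexx _); rewrite expr0 => <-.
  rewrite (_ : setT = cube 0)//; apply/seteqP; split => // z _ [].
  by [].
have [M HM] := lebesgue_tuple_exists d.
have me := measurable_energy (fun z => indic_ge0 R _ z)
  (measurable_indic (measurable_cube r)) (integrable_indic_cube Hm (ltW r0)).
have meM := measurable_energy (fun z => indic_ge0 R _ z)
  (measurable_indic (measurable_cube r)) (integrable_indic_cube HM (ltW r0)).
have en0 k (q : {sigma_finite_measure set (k.-tuple R) -> \bar R}) y : 0 <= energy q \1_(cube r) y.
  by rewrite addr_ge0 ?sqr_ge0.
rewrite (ge0_integral_consv HM Hm); [|exact/measurable_EFinP|by move=> x; rewrite lee_fin].
apply: (@le_trans _ _ (\int[leb]_t ((energy1_bound r t)%:E * ((8 * pi * r) ^+ d)%:E))%E).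
  apply: ge0_le_integral => //.
  - by move=> t _; apply: integral_ge0 => y _; rewrite lee_fin.
  - apply: (@measurable_fun_fubini_tonelli_F _ _ _ _ _ M (fun p => (energy m \1_(cube r) (consv p))%:E)).
      by apply/measurable_EFinP; apply: measurableT_comp => //; exact: measurable_consv.
    by move=> p; rewrite lee_fin.
  - apply: emeasurable_funM => //; apply/measurable_EFinP.
    by apply: continuous_measurable_fun; exact: continuous_energy1_bound.
  - move=> t _.
    under eq_integral do rewrite (energy_consv HM Hm r0) EFinM.
    rewrite ge0_integralZl//; first last.
    + by rewrite lee_fin addr_ge0 ?sqr_ge0.
    + by move=> y _; rewrite lee_fin.
    + exact/measurable_EFinP.
    apply: lee_pmul; rewrite ?lee_fin ?addr_ge0 ?sqr_ge0//.
    + by apply: integral_ge0 => y _; rewrite lee_fin.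
    + exact: energy1_le.
    + exact: ih.
rewrite ge0_integralZr//; first last.
- by rewrite lee_fin exprn_ge0// !mulr_ge0 ?pi_ge0 ?(ltW r0).
- by move=> t _; rewrite lee_fin energy1_bound_ge0.
- by apply/measurable_EFinP; apply: continuous_measurable_fun; exact: continuous_energy1_bound.
by rewrite integral_energy1_bound// -EFinM -exprS.
Qed.

End cube_energy.

(** * Laws with integrable characteristic function or bounded density *)

Section dyadic.
Variables (R : realType) (d : nat).
Implicit Types (x : d.-tuple R) (k : d.-tuple int).

(** Ceilings rather than floors, so that the cells are open on the left and closed on the right,
    like [box]. *)
Definition dyadic_index n x : d.-tuple int := [tuple Num.ceil (2 ^+ n * tnth x i) | i < d].
Definition dyadic_cell n k : set (d.-tuple R) := dyadic_index n @^-1` [set k].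
(** Arbitrary, possibly infinite, unions of cells of one level. They form a ring because two levels
    always have a common refinement. *)
Definition dyadic_ring : set (set (d.-tuple R)) :=
  [set A | exists n (S : set (d.-tuple int)), A = dyadic_index n @^-1` S].

Lemma dyadic_cellE n k : dyadic_cell n k =
  box [tuple (tnth k i - 1)%:~R / 2 ^+ n | i < d] [tuple (tnth k i)%:~R / 2 ^+ n | i < d].
Proof.
have p2 : 0 < 2 ^+ n :> R by rewrite exprn_gt0.
have itv (c : R) (j : int) : ((j - 1)%:~R / 2 ^+ n < c <= j%:~R / 2 ^+ n) = (Num.ceil (2 ^+ n * c) == j).
  by rewrite ceil_eq ltr_pdivrMr// ler_pdivlMr// [c * _]mulrC.
apply/seteqP; split => [x /= <- i|x h].
  by rewrite !tnth_mktuple itv.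
by apply: eq_from_tnth => i; have := h i; rewrite !tnth_mktuple itv => /eqP.
Qed.

Lemma measurable_dyadic_cell n k : measurable (dyadic_cell n k).
Proof. by rewrite dyadic_cellE; exact: measurable_box. Qed.

(** The index at one level is a function of the index at the next finer level: the cells are
    nested. *)
Lemma ceil_half (c : R) : Num.ceil c = Num.ceil ((Num.ceil (2 * c))%:~R / 2 : R).
Proof.
apply/esym/eqP; rewrite ceil_eq; set m := Num.ceil c; set j := Num.ceil (2 * c).
have /andP[m1 m2] := ceil_itv c; rewrite -/m in m1 m2.
have jm : j <= 2 * m by rewrite ceil_le_int intrM; lra.
have mj : 2 * (m - 1) < j by rewrite ceil_gt_int intrM; lra.
have jm' : (j%:~R : R) <= (2 * m)%:~R by rewrite ler_int.
have mj' : ((2 * (m - 1))%:~R : R) < j%:~R by rewrite ltr_int.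
by rewrite intrM in jm'; rewrite intrM in mj'; apply/andP; split; lra.
Qed.

Lemma dyadic_refine n m (S : set (d.-tuple int)) : (n <= m)%N ->
  exists S', dyadic_index n @^-1` S = dyadic_index m @^-1` S'.
Proof.
move=> /subnK <-; elim: (m - n)%N => [|l [S' ->]]; first by exists S.
exists [set k | S' [tuple Num.ceil ((tnth k i)%:~R / 2 : R) | i < d]].
apply/seteqP; split => x /=; rewrite /dyadic_index.
  suff -> : [tuple Num.ceil (2 ^+ (l + n) * tnth x i) | i < d] =
    [tuple Num.ceil ((tnth [tuple Num.ceil (2 ^+ (l.+1 + n) * tnth x i) | i < d] i)%:~R / 2 : R) | i < d] by [].
  by apply: eq_from_tnth => i; rewrite !tnth_mktuple ceil_half addSn exprS mulrA.
suff -> : [tuple Num.ceil (2 ^+ (l + n) * tnth x i) | i < d] =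
    [tuple Num.ceil ((tnth [tuple Num.ceil (2 ^+ (l.+1 + n) * tnth x i) | i < d] i)%:~R / 2 : R) | i < d] by [].
by apply: eq_from_tnth => i; rewrite !tnth_mktuple ceil_half addSn exprS mulrA.
Qed.

Lemma dyadic_common A B : dyadic_ring A -> dyadic_ring B ->
  exists n S S', A = dyadic_index n @^-1` S /\ B = dyadic_index n @^-1` S'.
Proof.
move=> [n [S ->]] [m [S' ->]]; exists (maxn n m).
have [U ->] := dyadic_refine S (leq_maxl n m).
by have [U' ->] := dyadic_refine S' (leq_maxr n m); exists U, U'.
Qed.

Lemma setring_dyadic : setring dyadic_ring.
Proof.
split.
- by exists 0%N, set0; rewrite preimage_set0.
- move=> A B /dyadic_common hA /hA [n [S [S' [-> ->]]]].
  by exists n, (S `|` S'); rewrite preimage_setU.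
- move=> A B /dyadic_common hA /hA [n [S [S' [-> ->]]]].
  by exists n, (S `\` S').
Qed.

Lemma cube_dyadic N : dyadic_ring (cube N%:R).
Proof.
exists 0%N, [set k | forall i, - N%:Z < tnth k i <= N%:Z].
apply/seteqP; split => [x h i|x h i].
  have := h i; rewrite !tnth_mktuple expr0 mul1r ceil_gt_int ceil_le_int.
  by rewrite intrN.
have := h i; rewrite !tnth_mktuple expr0 mul1r ceil_gt_int ceil_le_int.
by rewrite intrN.
Qed.

Lemma halfspace_dyadic i c : <<sr dyadic_ring >> [set x | tnth x i <= c].
Proof.
have [h0 hD hU] := smallest_sigma_ring dyadic_ring.
have hI (F : (set (d.-tuple R))^nat) : (forall n, <<sr dyadic_ring >> (F n)) ->
    <<sr dyadic_ring >> (\bigcap_n F n).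
  move=> hF; rewrite (_ : \bigcap_n F n = F 0%N `\` \bigcup_n (F 0%N `\` F n)).
    by apply: (hD) => //; apply: hU => n; exact: (hD).
  apply/seteqP; split => [x h|x [x0 h] n _].
    by split; [exact: h|move=> [n _ [_ /(_ (h n I))]]].
  by apply: contrapT => xn; apply: h; exists n.
(* The half-space is the intersection of its outer approximations at all levels: a point with
   coordinate above [c] is excluded as soon as 2^n times the gap exceeds 1. *)
rewrite (_ : [set x | _] = \bigcap_n (dyadic_index n @^-1` [set k | tnth k i <= Num.ceil (2 ^+ n * c)])).
  by apply: hI => n; apply: sub_g_sigma_ring; exists n, [set k | tnth k i <= Num.ceil (2 ^+ n * c)].
apply/seteqP; split => [x /= xc n _ /=|x h /=].
  by rewrite tnth_mktuple le_ceil// ler_pM2l ?exprn_gt0.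
rewrite leNgt; apply/negP => cx.
have e0 : 0 < tnth x i - c by rewrite subr_gt0.
have [n [_ hn]] : exists n, True /\ (tnth x i - c)^-1 < 2 ^+ n.
  exists (Num.bound (tnth x i - c)^-1); split => //.
  apply: (@lt_trans _ _ (Num.bound (tnth x i - c)^-1)%:R).
    by apply: archi_boundP; rewrite invr_ge0 ltW.
  by rewrite -natrX ltr_nat ltn_expl.
have := h n I; rewrite /= tnth_mktuple.
have p2 : 0 < 2 ^+ n :> R by rewrite exprn_gt0.
have h1 : 1 < 2 ^+ n * (tnth x i - c) by rewrite -ltr_pdivrMr// mul1r.
rewrite leNgt => /negP; apply; rewrite ceil_gt_int.
by have /andP[+ _] := ceil_itv (2 ^+ n * c); rewrite intrB; lra.
Qed.

Lemma measurable_sub_dyadic (A : set (d.-tuple R)) : measurable A -> <<sr dyadic_ring >> A.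
Proof.
have [h0 hD hU] := smallest_sigma_ring dyadic_ring.
have hT : <<sr dyadic_ring >> setT.
  by apply: sub_g_sigma_ring; exists 0%N, setT; rewrite preimage_setT.
have hI A' B' : <<sr dyadic_ring >> A' -> <<sr dyadic_ring >> B' -> <<sr dyadic_ring >> (A' `&` B').
  by move=> hA hB; rewrite -[A' `&` B']setDD; exact: hD (hD _ _ hA hB).
rewrite measurable_tupleE; apply: smallest_sub.
  by split => // B hB; exact: hD.
move=> _ [[a b] _ <-] /=; rewrite boxE (_ : [set: 'I_d] = [set` enum 'I_d]); last first.
  by apply/seteqP; split => i //= _; rewrite mem_enum.
rewrite bigcap_seq; elim/big_ind: _ => // i _.
rewrite (_ : _ @^-1` _ = [set x | tnth x i <= tnth b i] `\` [set x | tnth x i <= tnth a i]).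
  by apply: hD; exact: halfspace_dyadic.
apply/seteqP; split => x /=; rewrite in_itv/=.
  by move=> /andP[h ->]; split => //; rewrite leNgt h.
by move=> [-> /negP]; rewrite -ltNge => ->.
Qed.

End dyadic.

(** * From a bound on dyadic cells to a bound on all Borel sets *)

Section domination.
Variables (R : realType) (d : nat).
Variables (mu : {finite_measure set (d.-tuple R) -> \bar R}).
Variables (lam : {measure set (d.-tuple R) -> \bar R}) (C : R).
Hypotheses (Hlam : is_lebesgue_tuple lam) (C0 : 0 <= C).
Hypothesis cell_le : forall n k, (mu (dyadic_cell n k) <= C%:E * lam (dyadic_cell n k))%E.

Lemma measurable_dyadic_ring (A : set (d.-tuple R)) : dyadic_ring A -> measurable A.
Proof.
move=> [n [S ->]].
(* Integer tuples are countable: [F j] is the cell whose index has code [j] if that index lies in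
   [S], and is empty otherwise. *)
pose F j := dyadic_index n @^-1` (S `&` [set k | pickle k = j]) : set (d.-tuple R).
rewrite (_ : _ @^-1` _ = \bigcup_j F j); last first.
  by apply/seteqP; split => [x h|x [j _ []]//]; exists (pickle (dyadic_index n x)).
apply: bigcup_measurable => j _.
have [[k [Sk kj]]|h] := pselect (exists k, S k /\ pickle k = j).
  rewrite /F (_ : S `&` _ = [set k]); first exact: measurable_dyadic_cell.
  apply/seteqP; split => [k' [_ /= k'j]|_ ->//].
  by apply: (pcan_inj (@pickleK _)); rewrite k'j kj.
rewrite /F (_ : S `&` _ = set0) ?preimage_set0//.
by apply/seteqP; split => // k [Sk kj]; apply: h; exists k.
Qed.

Lemma dyadic_ring_le A : dyadic_ring A -> (mu A <= C%:E * lam A)%E.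
Proof.
move=> [n [S AE]].
pose F j := dyadic_index n @^-1` (S `&` [set k | pickle k = j]) : set (d.-tuple R).
have mF j : measurable (F j) by apply: measurable_dyadic_ring; exists n, (S `&` [set k | pickle k = j]).
have AF : A = \bigcup_j F j.
  rewrite AE; apply/seteqP; split => [x h|x [j _ []]//].
  by exists (pickle (dyadic_index n x)).
have tF : trivIset setT F by move=> i j _ _ [x [[_ /= <-] [_ /= <-]]].
have mU : measurable (\bigcup_j F j) by apply: bigcup_measurable.
rewrite AF !measure_semi_bigcup// -nneseriesZl//.
apply: lee_nneseries => // j _.
have [[k [Sk kj]]|h] := pselect (exists k, S k /\ pickle k = j).
  rewrite /F (_ : S `&` _ = [set k]); first exact: cell_le.
  apply/seteqP; split => [k' [_ /= k'j]|_ ->//].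
  by apply: (pcan_inj (@pickleK _)); rewrite k'j kj.
rewrite /F (_ : S `&` _ = set0) ?preimage_set0 ?measure0 ?mule0//.
by apply/seteqP; split => // k [Sk kj]; apply: h; exists k.
Qed.

Lemma lee_cvg_scale (u v : (\bar R)^nat) a b : u @ \oo --> a -> v @ \oo --> b ->
  (forall n, (u n <= C%:E * v n)%E) -> (a <= C%:E * b)%E.
Proof.
move=> ua vb uv; apply: (lee_cvg_to ua (cvgeZl _ vb)) => //.
by apply: nearW.
Qed.

Lemma measure_cube_cvg (m : {measure set (d.-tuple R) -> \bar R}) A : measurable A ->
  m (A `&` cube n%:R) @[n --> \oo] --> m A.
Proof.
move=> mA; have -> : m A = m (\bigcup_n (A `&` cube n%:R)).
  by rewrite -setI_bigcupr cube_cover setIT.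
apply: nondecreasing_cvg_mu.
- by move=> n; apply: measurableI => //; exact: measurable_cube.
- by apply: bigcup_measurable => n _; apply: measurableI => //; exact: measurable_cube.
- by move=> n k nk; apply/subsetPset; apply: setIS; apply: cube_mono; rewrite ler_nat.
Qed.

(* Monotone classes need finite measures, whence the restriction to a cube. *)
Lemma dominated_on_cube N A : measurable A ->
  (mu (A `&` cube N%:R) <= C%:E * lam (A `&` cube N%:R))%E.
Proof.
move=> mA; have mK := @measurable_cube R d N%:R.
pose G := [set B : set (d.-tuple R) | measurable B /\ (mu (B `&` cube N%:R) <= C%:E * lam (B `&` cube N%:R))%E].
suff : G A by case.
have lamK B : measurable B -> (lam (B `&` cube N%:R) < +oo)%E.
  move=> mB; apply: (@le_lt_trans _ _ (lam (cube N%:R))).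
    by apply: le_measure; rewrite ?inE//; exact: measurableI.
  by rewrite lebesgue_cube// ltry.
apply: (monotone_setring_sub_g_sigma_ring _ (@setring_dyadic R d)); last exact: measurable_sub_dyadic.
- split => F mono hF; (split; first by [apply: bigcup_measurable => n _; case: (hF n)|apply: bigcap_measurable => // n _; case: (hF n)]).
  + have mI n : measurable (F n `&` cube N%:R) by apply: measurableI => //; case: (hF n).
    have ndI : nondecreasing_seq (fun n => F n `&` cube N%:R).
      by move=> n k nk; apply/subsetPset; apply: setSI; apply/subsetPset/mono.
    rewrite setI_bigcupl.
    apply: (lee_cvg_scale (nondecreasing_cvg_mu mI _ ndI) (nondecreasing_cvg_mu mI _ ndI)).
    * by apply: bigcup_measurable.
    * by apply: bigcup_measurable.
    * by move=> n; case: (hF n).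
  + have mI n : measurable (F n `&` cube N%:R) by apply: measurableI => //; case: (hF n).
    have niI : nonincreasing_seq (fun n => F n `&` cube N%:R).
      by move=> n k nk; apply/subsetPset; apply: setSI; apply/subsetPset/mono.
    rewrite -bigcapIl//.
    apply: (lee_cvg_scale (nonincreasing_cvg_mu _ mI _ niI) (nonincreasing_cvg_mu _ mI _ niI)).
    * by rewrite -ge0_fin_numE// fin_num_measure.
    * by apply: bigcap_measurable.
    * by apply: lamK; case: (hF 0%N).
    * by apply: bigcap_measurable.
    * by move=> n; case: (hF n).
- move=> B dB; split; first exact: measurable_dyadic_ring.
  apply: dyadic_ring_le; have [_ _ hD] := @setring_dyadic R d.
  by rewrite -setDD; apply: (hD) => //; apply: (hD) => //; exact: cube_dyadic.
Qed.

Lemma dominated_of_dyadic_cells A : measurable A -> (mu A <= C%:E * lam A)%E.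
Proof.
move=> mA.
apply: (lee_cvg_scale (@measure_cube_cvg mu _ mA) (@measure_cube_cvg lam _ mA)) => n.
exact: dominated_on_cube.
Qed.

End domination.

(** * Mass, density and characteristic function of a law *)

Section law.
Variables (R : realType) (d : nat).
Variables (lam : {sigma_finite_measure set (d.-tuple R) -> \bar R}).
Variable mu : probability (d.-tuple R) R.
Hypotheses (Hlam : is_lebesgue_tuple lam) (d0 : (0 < d)%N).
Implicit Types (a x y z u : d.-tuple R) (r : R).

Definition chf_cos u : R := \int[mu]_x cos (ip x u).
Definition chf_sin u : R := \int[mu]_x sin (ip x u).
(* [Re (e^{-i<a,u>} phi u)], where [phi] is the characteristic function of [mu]. *)
Definition chf_shift a u : R := chf_cos u * cos (ip a u) + chf_sin u * sin (ip a u).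
Definition chf_sqr u : R := chf_cos u ^+ 2 + chf_sin u ^+ 2.

Lemma integrable_1 : mu.-integrable setT (EFin \o (fun=> 1 : R)).
Proof. exact: finite_measure_integrable_cst. Qed.

Lemma measurable_trig_ip dT (T : measurableType dT) (g : R -> R) (f h : T -> d.-tuple R) :
  continuous g -> measurable_fun setT f -> measurable_fun setT h ->
  measurable_fun setT (fun t => g (ip (f t) (h t))).
Proof.
by move=> cg mf mh; apply: (measurableT_comp (continuous_measurable_fun cg)); exact: measurable_ip.
Qed.

Lemma measurable_cip u : measurable_fun setT (fun x : d.-tuple R => cos (ip x u)).
Proof. by apply: measurable_trig_ip; [exact: continuous_cos|exact: measurable_id|exact: measurable_cst]. Qed.

Lemma measurable_sip u : measurable_fun setT (fun x : d.-tuple R => sin (ip x u)).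
Proof. by apply: measurable_trig_ip; [exact: continuous_sin|exact: measurable_id|exact: measurable_cst]. Qed.

Lemma integrable_cip u : mu.-integrable setT (EFin \o (fun x => cos (ip x u))).
Proof. by apply: (dominated_integrable (measurable_cip u) _ integrable_1) => x; exact: cos_max. Qed.

Lemma integrable_sip u : mu.-integrable setT (EFin \o (fun x => sin (ip x u))).
Proof. by apply: (dominated_integrable (measurable_sip u) _ integrable_1) => x; exact: sin_max. Qed.

Lemma measurable_chf_cos : measurable_fun setT chf_cos.
Proof.
apply: (@measurable_Rintegral _ _ _ _ _ mu (fun p => cos (ip p.2 p.1)) (fun=> 1)).
- by apply: measurable_trig_ip; [exact: continuous_cos|exact: measurable_snd|exact: measurable_fst].
- by move=> u x; exact: cos_max.
- exact: integrable_1.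
Qed.

Lemma measurable_chf_sin : measurable_fun setT chf_sin.
Proof.
apply: (@measurable_Rintegral _ _ _ _ _ mu (fun p => sin (ip p.2 p.1)) (fun=> 1)).
- by apply: measurable_trig_ip; [exact: continuous_sin|exact: measurable_snd|exact: measurable_fst].
- by move=> u x; exact: sin_max.
- exact: integrable_1.
Qed.

Lemma measurable_chf_shift : measurable_fun setT (fun p => chf_shift p.1 p.2).
Proof.
apply: measurable_funD; apply: measurable_funM.
- by apply: (measurableT_comp measurable_chf_cos); exact: measurable_snd.
- by apply: measurable_trig_ip; [exact: continuous_cos|exact: measurable_fst|exact: measurable_snd].
- by apply: (measurableT_comp measurable_chf_sin); exact: measurable_snd.
- by apply: measurable_trig_ip; [exact: continuous_sin|exact: measurable_fst|exact: measurable_snd].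
Qed.

Lemma chf_shiftE a u : \int[mu]_x cos (ip (vsub x a) u) = chf_shift a u.
Proof.
have e x : cos (ip (vsub x a) u) = cos (ip a u) * cos (ip x u) + sin (ip a u) * sin (ip x u).
  by rewrite ip_subl cosB; ring.
under eq_Rintegral do rewrite e.
rewrite RintegralD//; try (by apply: integrableZl_R; first [exact: integrable_cip|exact: integrable_sip]).
rewrite !RintegralZl//; try (by first [exact: integrable_cip|exact: integrable_sip]).
by rewrite /chf_shift /chf_cos /chf_sin; ring.
Qed.

Lemma abs_chf_shift_le1 a u : `|chf_shift a u| <= 1.
Proof.
rewrite -chf_shiftE; have mc : measurable_fun setT (fun x => cos (ip (vsub x a) u)).
  apply: measurable_trig_ip; [exact: continuous_cos| |exact: measurable_cst].
  by apply: measurable_vsub => //; exact: measurable_cst.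
have ic : mu.-integrable setT (EFin \o (fun x => cos (ip (vsub x a) u))).
  by apply: (dominated_integrable mc _ integrable_1) => x; exact: cos_max.
apply: (le_trans (le_normr_Rintegral measurableT ic)).
apply: (@le_trans _ _ (\int[mu]_x 1)).
  apply: le_Rintegral => //; [|exact: integrable_1|by move=> x _; exact: cos_max].
  by apply: (dominated_integrable _ _ integrable_1) => [|x]; [exact: measurableT_comp|rewrite normr_id cos_max].
by rewrite Rintegral_cst// [X in fine X](@probability_setT _ _ _ mu) mulr1.
Qed.

(** The mean of e^{-i<a,u>} under the law is the conjugate of the characteristic function, so the
    product becomes a squared modulus. This amounts to symmetrising with an independent copy. *)
Lemma mean_chf_shift u : \int[mu]_a chf_shift a u = chf_sqr u.
Proof.
rewrite /chf_shift RintegralD//; try (by apply: integrableZl_R; first [exact: integrable_cip|exact: integrable_sip]).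
by rewrite !RintegralZl//; try (by first [exact: integrable_cip|exact: integrable_sip]).
Qed.

Lemma chf_sqr_ge0 u : 0 <= chf_sqr u.
Proof. by rewrite addr_ge0 ?sqr_ge0. Qed.

Lemma chf_shift_sqr_le a u : chf_shift a u ^+ 2 <= chf_sqr u.
Proof.
(* The square dropped is that of the imaginary part of e^{-i<a,u>} phi(u), up to sign. *)
have := sqr_ge0 (chf_cos u * sin (ip a u) - chf_sin u * cos (ip a u)).
have h : chf_shift a u ^+ 2 + (chf_cos u * sin (ip a u) - chf_sin u * cos (ip a u)) ^+ 2 =
   chf_sqr u * (cos (ip a u) ^+ 2 + sin (ip a u) ^+ 2).
  by rewrite /chf_shift /chf_sqr; ring.
by rewrite cos2Dsin2 mulr1 in h; rewrite -h; lra.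
Qed.

Section window.
Variable r : R.
Hypothesis r0 : 0 < r.
Local Notation w := (\1_(cube r) : d.-tuple R -> R).

Let w0 z : 0 <= w z. Proof. exact: indic_ge0. Qed.
Let w1 z : w z <= 1. Proof. exact: indic_cube_le1. Qed.
Let mw : measurable_fun setT w. Proof. exact: measurable_indic (measurable_cube r). Qed.
Let iw : lam.-integrable setT (EFin \o w). Proof. exact: integrable_indic_cube (ltW r0). Qed.
Let W := (2 * r) ^+ d.
Let WE : \int[lam]_z w z = W. Proof. by rewrite Rintegral_indic_cube// ltW. Qed.
Let W0 : 0 < W. Proof. by rewrite exprn_gt0// mulr_gt0. Qed.

Lemma mean_energy a : \int[mu]_x energy lam w (vsub x a) =
  \int[lam]_z (\int[lam]_z' (w z * w z' * chf_shift a (vsub z' z))).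
Proof.
transitivity (\int[mu]_x (\int[lam]_z (\int[lam]_z' (w z * w z' * cos (ip (vsub x a) (vsub z' z)))))).
  by apply: eq_Rintegral => x _; rewrite (energyE w0 mw iw).
pose g (p : d.-tuple R * d.-tuple R) := cos (ip (vsub p.1 a) p.2).
have mg : measurable_fun setT g.
  apply: measurable_trig_ip; [exact: continuous_cos| |exact: measurable_snd].
  by apply: measurable_vsub; [exact: measurable_fst|exact: measurable_cst].
rewrite (autocorrelation_swap mu w0 w1 mw iw mg (fun p => cos_max _)).
by apply: eq_Rintegral => z _; apply: eq_Rintegral => z' _; rewrite -chf_shiftE.
Qed.

Lemma measurable_window_shift a :
  measurable_fun setT (fun p => w p.1 * w p.2 * chf_shift a (vsub p.2 p.1)).
Proof.
apply: measurable_funM; first apply: measurable_funM.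
- exact: (measurableT_comp mw measurable_fst).
- exact: (measurableT_comp mw measurable_snd).
- apply: (@measurableT_comp _ _ _ _ _ _ (fun p => chf_shift p.1 p.2) _ (fun p => (a, vsub p.2 p.1))).
    exact: measurable_chf_shift.
  apply/measurable_fun_pairP; split; first exact: measurable_cst.
  by apply: measurable_vsub; [exact: measurable_snd|exact: measurable_fst].
Qed.

Lemma abs_cosT_le y : `|cosT lam w y| <= W.
Proof.
apply: (le_trans (le_normr_Rintegral measurableT (integrable_wcos w0 mw iw y))).
rewrite -WE; apply: le_Rintegral => //.
- apply: (dominated_integrable _ _ iw) => [|z].
    by apply: measurableT_comp => //; apply: measurable_funM => //; exact: measurable_cosip.
  by rewrite normr_id; apply: w_abs_le => //; exact: cos_max.
- by move=> z _; apply: w_abs_le => //; exact: cos_max.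
Qed.

Lemma abs_sinT_le y : `|sinT lam w y| <= W.
Proof.
apply: (le_trans (le_normr_Rintegral measurableT (integrable_wsin w0 mw iw y))).
rewrite -WE; apply: le_Rintegral => //.
- apply: (dominated_integrable _ _ iw) => [|z].
    by apply: measurableT_comp => //; apply: measurable_funM => //; exact: measurable_sinip.
  by rewrite normr_id; apply: w_abs_le => //; exact: sin_max.
- by move=> z _; apply: w_abs_le => //; exact: sin_max.
Qed.

Lemma energy_ge0 y : 0 <= energy lam w y.
Proof. by rewrite addr_ge0 ?sqr_ge0. Qed.

Lemma energy_le y : energy lam w y <= 2 * W ^+ 2.
Proof.
have h t : `|t| <= W -> t ^+ 2 <= W ^+ 2.
  by move=> tW; rewrite -real_normK ?num_real// ler_pXn2r ?nnegrE ?(ltW W0).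
rewrite mulr_natl mulr2n lerD// h//; [exact: abs_cosT_le|exact: abs_sinT_le].
Qed.

Lemma measurable_energy_shift a : measurable_fun setT (fun x => energy lam w (vsub x a)).
Proof.
apply: (measurableT_comp (measurable_energy w0 mw iw)).
by apply: measurable_vsub => //; exact: measurable_cst.
Qed.

Lemma integrable_energy_shift a : mu.-integrable setT (EFin \o (fun x => energy lam w (vsub x a))).
Proof.
apply: (@dominated_integrable _ _ _ mu _ (fun=> 2 * W ^+ 2)).
- exact: measurable_energy_shift.
- by move=> x; rewrite ger0_norm ?energy_ge0// energy_le.
- exact: finite_measure_integrable_cst.
Qed.

(** As long as the phase stays within 1 on the cube there is no cancellation: the cosine part alone
    is at least cos 1 times the volume. *)
Lemma energy_ge y : (forall z, cube r z -> `|ip y z| <= 1) -> (cos 1 * W) ^+ 2 <= energy lam w y.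
Proof.
move=> hy; have c0 := @cos1_gt0 R.
apply: (@le_trans _ _ (cosT lam w y ^+ 2)); last by rewrite lerDl sqr_ge0.
have h : cos 1 * W <= cosT lam w y.
  rewrite -WE -RintegralZl//; apply: le_Rintegral => //.
  - exact: integrableZl_R.
  - exact: integrable_wcos.
  - move=> z _; rewrite mulrC; have [zc|zc] := pselect (cube r z).
      by rewrite ler_wpM2l// cos_ge_cos1// hy.
    by rewrite indicE memNset// !mul0r.
by rewrite ler_pXn2r ?nnegrE ?mulr_ge0 ?(ltW W0) ?(ltW c0)// (le_trans _ h)// mulr_ge0 ?ltW.
Qed.

End window.

Lemma Rintegral_translate_le (F : d.-tuple R -> R) K z : measurable_fun setT F ->
  (forall u, 0 <= F u) -> (\int[lam]_u (F u)%:E <= K%:E)%E ->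
  (\int[lam]_z' (F (vsub z' z))%:E <= K%:E)%E.
Proof.
move=> mF F0 FK; apply: le_trans FK.
rewrite -(@ge0_integral_translation _ _ lam (vscale (-1) z) (fun u => (F u)%:E))//.
- rewrite le_eqVlt; apply/orP; left; apply/eqP; apply: eq_integral => z' _; congr (F _)%:E.
  by apply: eq_from_tnth => i; rewrite !tnth_mktuple; ring.
- exact/measurable_EFinP.
Qed.

(** [F] is an integrable majorant of the modulus of the characteristic function. The mean of the
    energy of [x - a] is at most K W, with W the volume of the window, since each inner integral is
    at most K w(z); on the small cube around [a] the energy is at least (cos 1 W)^2. The quotient is
    the bound. *)
Lemma concentration_bound (F : d.-tuple R -> R) K a r : 0 < r -> 0 <= K -> measurable_fun setT F ->
  (forall u, 0 <= F u) -> (forall u, chf_sqr u <= F u ^+ 2) ->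
  (\int[lam]_u (F u)%:E <= K%:E)%E ->
  (mu [set x | forall i, (`|tnth x i - tnth a i| <= (d%:R * r)^-1)%R] <=
    (K / (cos 1 ^+ 2 * (2 * r) ^+ d))%:E)%E.
Proof.
move=> r0 K0 mF F0 sF FK.
pose w : d.-tuple R -> R := \1_(cube r).
have w0 z : 0 <= w z by exact: indic_ge0.
have w1 z : w z <= 1 by exact: indic_cube_le1.
have mw : measurable_fun setT w by exact: measurable_indic (measurable_cube r).
have iw : lam.-integrable setT (EFin \o w) by exact: integrable_indic_cube (ltW r0).
pose W := (2 * r) ^+ d.
have WE : \int[lam]_z w z = W by rewrite Rintegral_indic_cube// ltW.
have W0 : 0 < W by rewrite exprn_gt0// mulr_gt0.
have shift_le u : `|chf_shift a u| <= F u.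
  rewrite -(@ler_pXn2r _ 2) ?nnegrE// real_normK ?num_real//.
  exact: le_trans (chf_shift_sqr_le a u) (sF u).
set S := [set x | _].
have mS : measurable S.
  rewrite (_ : S = \bigcap_(i in [set: 'I_d]) [set x | `|tnth x i - tnth a i| <= (d%:R * r)^-1]); last first.
    by apply/seteqP; split => [x h i _|x h i]; [exact: h|exact: h].
  apply: fin_bigcap_measurable => // i _.
  rewrite -[X in measurable X]setTI.
  apply: (@measurable_fun_ler _ _ _ setT (fun x : d.-tuple R => `|tnth x i - tnth a i|) (fun=> (d%:R * r)^-1)) => //.
  apply: measurableT_comp => //; apply: measurable_funB => //; exact: measurable_tnth.
have wF z : measurable_fun setT (fun z' => w z * w z' * F (vsub z' z)).
  apply: measurable_funM; first exact: measurable_funM.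
  by apply: (measurableT_comp mF); apply: measurable_vsub => //; exact: measurable_cst.
have iF z : lam.-integrable setT (EFin \o (fun z' => F (vsub z' z))).
  apply/integrableP; split.
    apply/measurable_EFinP; apply: (measurableT_comp mF).
    by apply: measurable_vsub => //; exact: measurable_cst.
  under eq_integral do rewrite gee0_abs ?lee_fin//.
  by apply: le_lt_trans (Rintegral_translate_le z mF F0 FK) _; rewrite ltry.
have shift_bound z z' : `|w z * w z' * chf_shift a (vsub z' z)| <= w z * F (vsub z' z).
  rewrite normrM ger0_norm ?mulr_ge0// -mulrA ler_wpM2l//.
  by rewrite (le_trans (ler_piMl _ (w1 z')))// shift_le.
have iwshift z : lam.-integrable setT (EFin \o (fun z' => w z * w z' * chf_shift a (vsub z' z))).
  apply: (dominated_integrable (measurable_section z (measurable_window_shift r a)) (shift_bound z)).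
  exact: integrableZl_R.
pose H z := \int[lam]_z' (w z * w z' * chf_shift a (vsub z' z)).
have H_le z : `|H z| <= K * w z.
  apply: (le_trans (le_normr_Rintegral measurableT (iwshift z))).
  apply: (@le_trans _ _ (\int[lam]_z' (w z * F (vsub z' z)))).
    apply: le_Rintegral => //; last exact: integrableZl_R.
    apply: (dominated_integrable _ _ (integrableZl_R (w z) (iF z))) => [|z'].
      apply: measurableT_comp => //.
      exact: (measurable_section z (measurable_window_shift r a)).
    by rewrite normr_id.
  rewrite RintegralZl// mulrC ler_wpM2r// -lee_fin.
  rewrite /Rintegral fineK; first exact: Rintegral_translate_le.
  exact: integrable_fin_num (iF z).
have mH : measurable_fun setT H.
  apply: (@measurable_Rintegral _ _ _ _ _ lam _ w (measurable_window_shift r a)) => // z z' /=.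
  rewrite normrM ger0_norm ?mulr_ge0//.
  rewrite (le_trans (ler_piMr _ (abs_chf_shift_le1 _ _))) ?mulr_ge0//.
  by rewrite ler_piMl.
have upper : \int[mu]_x energy lam w (vsub x a) <= K * W.
  rewrite (mean_energy r0) -WE -RintegralZl//; apply: le_Rintegral => //.
  - exact: (dominated_integrable mH H_le (integrableZl_R K iw)).
  - exact: integrableZl_R.
  - by move=> z _; apply: (le_trans (ler_norm _)); exact: H_le.
have dp : 0 < d%:R :> R by rewrite ltr0n.
(* The half-side 1/(d r) is dual to the window: each of the d terms of <x - a, z> is at most 1/d. *)
have near1 x : S x -> forall z, cube r z -> `|ip (vsub x a) z| <= 1.
  move=> Sx z zc; apply: (le_trans (ler_norm_sum _ _ _)).
  rewrite (_ : 1 = \sum_(i < d) d%:R^-1 :> R); last first.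
    by rewrite sumr_const card_ord -[RHS]mulr_natl divff// gt_eqF.
  apply: ler_sum => i _; rewrite tnth_mktuple normrM.
  have -> : d%:R^-1 = (d%:R * r)^-1 * r :> R by field; rewrite !gt_eqF.
  rewrite ler_pM//.
  by have := zc i; rewrite !tnth_mktuple ler_norml => /andP[/ltW -> ->].
have iS : mu.-integrable setT (EFin \o (fun x => (cos 1 * W) ^+ 2 * \1_S x)).
  by apply: integrableZl_R; exact: integrable_indic.
have lower : (cos 1 * W) ^+ 2 * fine (mu S) <= K * W.
  apply: le_trans upper.
  have -> : fine (mu S) = \int[mu]_x \1_S x by rewrite /Rintegral integral_indic// setIT.
  rewrite -RintegralZl//; last exact: integrable_indic.
  apply: le_Rintegral => //; first exact: integrable_energy_shift.
  move=> x _; have [xS|xS] := pselect (S x).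
    by rewrite indicE mem_set// mulr1 (energy_ge r0)//; exact: near1.
  by rewrite indicE memNset// mulr0 energy_ge0.
rewrite -[mu S]fineK ?fin_num_measure// lee_fin.
have c0 := @cos1_gt0 R.
have cW : 0 < cos 1 ^+ 2 * W by exact: mulr_gt0 (exprn_gt0 2 c0) W0.
rewrite -/W ler_pdivlMr//.
rewrite -(@ler_pM2r _ W)//; apply: le_trans lower.
by rewrite le_eqVlt; apply/orP; left; apply/eqP; ring.
Qed.

(** With r = 2^n / d the half-side 1/(d r) in [concentration_bound] is the side 2^-n of a dyadic
    cell, and 1/(2 r)^d is (d / 2)^d times the volume of that cell. *)
Definition Cdens : R := (d%:R / 2) ^+ d / cos 1 ^+ 2.

Lemma Cdens_gt0 : 0 < Cdens.
Proof. by rewrite divr_gt0 ?exprn_gt0 ?cos1_gt0// divr_gt0// ltr0n. Qed.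

Lemma lebesgue_dyadic_cell (m : {measure set (d.-tuple R) -> \bar R}) n k :
  is_lebesgue_tuple m -> m (dyadic_cell n k) = ((2 ^- n) ^+ d)%:E.
Proof.
move=> Hm; have p2 : 0 < 2 ^+ n :> R by rewrite exprn_gt0.
rewrite dyadic_cellE /box Hm; congr (_%:E).
rewrite -[in RHS](card_ord d) -prodr_const; apply: eq_bigr => i _.
rewrite !tnth_mktuple -mulrBl intrB opprB addrC subrK mul1r max_l//.
Qed.

Lemma dominated_of_integrable_chf (F : d.-tuple R -> R) K : 0 <= K -> measurable_fun setT F ->
  (forall u, 0 <= F u) -> (forall u, chf_sqr u <= F u ^+ 2) ->
  (\int[lam]_u (F u)%:E <= K%:E)%E ->
  forall B, measurable B -> (mu B <= (Cdens * K)%:E * lam B)%E.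
Proof.
move=> K0 mF F0 sF FK B mB.
have C0 := Cdens_gt0.
apply: (dominated_of_dyadic_cells Hlam) => // n k.
have p2 : 0 < 2 ^+ n :> R by rewrite exprn_gt0.
have dp : 0 < d%:R :> R by rewrite ltr0n.
pose r : R := 2 ^+ n / d%:R.
have r0 : 0 < r by rewrite divr_gt0.
(* [a] is the upper corner of the cell, so that every point of the cell is within one side of it in
   each coordinate. *)
pose a : d.-tuple R := [tuple (tnth k i)%:~R / 2 ^+ n | i < d].
have := concentration_bound a r0 K0 mF F0 sF FK.
set S := [set x | _] => hS.
have sub : dyadic_cell n k `<=` S.
  rewrite dyadic_cellE => x h i; have := h i; rewrite !tnth_mktuple.
  have -> : (d%:R * r)^-1 = 2 ^- n by rewrite /r mulrC divfK// gt_eqF.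
  by rewrite intrB mulrBl mul1r ler_norml; lra.
have mS : measurable S.
  rewrite (_ : S = \bigcap_(i in [set: 'I_d]) [set x | `|tnth x i - tnth a i| <= (d%:R * r)^-1]); last first.
    by apply/seteqP; split => [x h i _|x h i]; [exact: h|exact: h].
  apply: fin_bigcap_measurable => // i _.
  rewrite -[X in measurable X]setTI.
  apply: (@measurable_fun_ler _ _ _ setT (fun x : d.-tuple R => `|tnth x i - tnth a i|) (fun=> (d%:R * r)^-1)) => //.
  apply: measurableT_comp => //; apply: measurable_funB => //; exact: measurable_tnth.
apply: (@le_trans _ _ (mu S)).
  by apply: le_measure; rewrite ?inE//; exact: measurable_dyadic_cell.
apply: (le_trans hS); rewrite (lebesgue_dyadic_cell _ _ Hlam) -EFinM lee_fin.
rewrite le_eqVlt; apply/orP; left; apply/eqP; rewrite /Cdens /r.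
have -> : 2 * (2 ^+ n / d%:R) = (d%:R / 2 * 2 ^- n)^-1 :> R.
  by field; rewrite !gt_eqF.
by rewrite (exprVn (d%:R / 2 / 2 ^+ n)) invfM invrK exprMn; ring.
Qed.

(** A Radon-Nikodym density is at most [C] only almost everywhere, while (C1) asks for a bound at
    every point; hence the cut-off at [C]. It changes no integral: on the set where the density
    exceeds [C], domination by C times [lam] turns the inequality between the two integrals into an
    equality. *)
Lemma bounded_density C : 0 <= C -> (forall B, measurable B -> (mu B <= C%:E * lam B)%E) ->
  exists p : d.-tuple R -> R, [/\ measurable_fun setT p, forall x, 0 <= p x <= C &
    forall B, measurable B -> mu B = (\int[lam]_(x in B) (p x)%:E)%E].
Proof.
move=> C0 hC.
have [|f [f0 ffin intf fE]] := @radon_nikodym_sigma_finite _ _ _ lam mu.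
  apply/null_content_dominatesP => B mB lB; apply/eqP; rewrite eq_le measure_ge0 andbT.
  by apply: (le_trans (hC B mB)); rewrite lB mule0.
have fE' B : measurable B -> mu B = (\int[lam]_(x in B) f x)%E by move=> mB; exact: fE.
have mf : measurable_fun setT f by exact: measurable_int intf.
have mff : measurable_fun setT (fine \o f) by exact: measurableT_comp.
pose p x := Num.min C (fine (f x)).
have p0 x : 0 <= p x by rewrite le_min C0 fine_ge0.
have mp : measurable_fun setT p by exact: measurable_minr.
exists p; split => //; first by move=> x; rewrite p0 ge_min lexx.
pose E := [set x | C < fine (f x)].
have mE : measurable E.
  rewrite -[X in measurable X]setTI.
  exact: (@measurable_fun_ltr _ _ _ setT (fun=> C) (fine \o f)).
have fpE x : ~ E x -> (p x)%:E = f x.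
  by move=> /negP; rewrite -leNgt => h; rewrite /p min_r// fineK.
move=> B mB.
have BE : B = (B `&` E) `|` (B `\` E).
  by apply/seteqP; split => [x Bx|x [[]|[]]//]; have [?|?] := pselect (E x); [left|right].
have mI := measurableI _ _ mB mE; have mD := measurableD mB mE.
have dj : [disjoint B `&` E & B `\` E] by rewrite disj_set2E; apply/eqP; rewrite setIDA; apply/seteqP; split => // x [[[_ Ex] _]].
transitivity (mu ((B `&` E) `|` (B `\` E))); first by rewrite -BE.
transitivity (\int[lam]_(x in (B `&` E) `|` (B `\` E)) (p x)%:E)%E; last by rewrite -BE.
rewrite measureU//; last by apply/eqP; rewrite -disj_set2E.
rewrite ge0_integral_setU//; first last.
- by move=> x _; rewrite lee_fin.
- by apply/measurable_EFinP; exact: measurable_funTS.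
congr (_ + _)%E; last first.
  transitivity (\int[lam]_(x in B `\` E) f x)%E; first exact: fE'.
  by apply: eq_integral => x /set_mem [_ /fpE ->].
have pE : (\int[lam]_(x in B `&` E) (p x)%:E = C%:E * lam (B `&` E))%E.
  rewrite -integral_cst//; apply: eq_integral => x /set_mem [_ Ex].
  by rewrite /p min_l// ltW.
apply/eqP; rewrite eq_le pE hC//= -pE.
rewrite [leRHS](_ : _ = \int[lam]_(x in B `&` E) f x)%E; last exact: fE'.
apply: ge0_le_integral => //.
- by move=> x _; rewrite lee_fin.
- by apply/measurable_EFinP; exact: measurable_funTS.
- exact: measurable_funTS.
- by move=> x _; rewrite -[f x]fineK// lee_fin ge_min lexx orbT.
Qed.

Lemma Rintegral_translate (F : d.-tuple R -> R) z : measurable_fun setT F ->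
  (forall u, 0 <= F u) ->
  \int[lam]_z' F (vsub z' z) = \int[lam]_u F u.
Proof.
move=> mF F0; rewrite /Rintegral; congr fine.
rewrite -[RHS](@ge0_integral_translation _ _ lam (vscale (-1) z) (fun u => (F u)%:E))//.
- apply: eq_integral => z' _; congr (F _)%:E.
  by apply: eq_from_tnth => i; rewrite !tnth_mktuple; ring.
- exact/measurable_EFinP.
Qed.

Lemma measurable_chf_sqr : measurable_fun setT chf_sqr.
Proof.
by apply: measurable_funD; apply: measurable_funX; [exact: measurable_chf_cos|exact: measurable_chf_sin].
Qed.

Lemma chf_sqr_le1 u : chf_sqr u <= 1.
Proof.
rewrite -mean_chf_shift; apply: (@le_trans _ _ (\int[mu]_a 1)).
  apply: le_Rintegral => //; [|exact: integrable_1|by move=> a _; apply: (le_trans (ler_norm _)); exact: abs_chf_shift_le1].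
  apply: (dominated_integrable _ _ integrable_1) => [|a]; last exact: abs_chf_shift_le1.
  apply: (@measurableT_comp _ _ _ _ _ _ (fun p => chf_shift p.1 p.2) _ (fun a => (a, u))).
    exact: measurable_chf_shift.
  by apply/measurable_fun_pairP; split; [exact: measurable_id|exact: measurable_cst].
by rewrite Rintegral_cst// [X in fine X](@probability_setT _ _ _ mu) mulr1.
Qed.

Lemma chf_L2_bound M : 0 <= M -> (forall B, measurable B -> (mu B <= M%:E * lam B)%E) ->
  forall s, 0 < s -> (\int[lam]_(u in cube s) (chf_sqr u)%:E <= ((8 * pi) ^+ d * M)%:E)%E.
Proof.
move=> M0 hM s s0.
(* If [z] and [z' - z] lie in the cube of half-side [s], then [z] and [z'] lie in that of half-side
   2 s, where the window is 1. The double integral is thus at least (2 s)^d times the integral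
   wanted, and this volume cancels against (8 pi r)^d, so the bound does not depend on [s]. *)
pose r := 2 * s; have r0 : 0 < r by rewrite mulr_gt0.
pose w : d.-tuple R -> R := \1_(cube r).
have w0 z : 0 <= w z by exact: indic_ge0.
have w1 z : w z <= 1 by exact: indic_cube_le1.
have mw : measurable_fun setT w by exact: measurable_indic (measurable_cube r).
have iw : lam.-integrable setT (EFin \o w) by exact: integrable_indic_cube (ltW r0).
have me := measurable_energy w0 mw iw.
(* The density bound replaces the law by M times Lebesgue measure; translation invariance removes
   [a], and the energy of a cube has a known integral bound. *)
have mean_le a : \int[mu]_x energy lam w (vsub x a) <= M * (8 * pi * r) ^+ d.
  rewrite -lee_fin /Rintegral fineK; last exact: integrable_fin_num (integrable_energy_shift r0 a).
  have mshift : measurable_fun setT (fun x => (energy lam w (vsub x a))%:E).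
    by apply/measurable_EFinP; exact: measurable_energy_shift.
  apply: (@le_trans _ _ (\int[mscale (NngNum M0) lam]_x (energy lam w (vsub x a))%:E)%E).
    apply: ge0_le_measure_integral => //; last by move=> x; rewrite lee_fin energy_ge0.
  rewrite ge0_integral_mscale//; last by move=> x _; rewrite lee_fin energy_ge0.
  rewrite /= EFinM lee_wpmul2l ?lee_fin//.
  apply: Rintegral_translate_le => //; first exact: energy_ge0.
  exact: integral_energy_cube.
have mcs : measurable_fun setT (fun p => chf_sqr (vsub p.2 p.1)).
  apply: (measurableT_comp measurable_chf_sqr).
  by apply: measurable_vsub; [exact: measurable_snd|exact: measurable_fst].
pose T z := \int[lam]_z' (w z * w z' * chf_sqr (vsub z' z)).
have total : \int[lam]_z T z <= M * (8 * pi * r) ^+ d.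
  pose L := \int[mu]_a (\int[lam]_z (\int[lam]_z' (w z * w z' * chf_shift a (vsub z' z)))).
  have LE : L = \int[lam]_z (\int[lam]_z' (w z * w z' * \int[mu]_a chf_shift a (vsub z' z))).
    exact: (autocorrelation_swap mu w0 w1 mw iw measurable_chf_shift (fun p => abs_chf_shift_le1 p.1 p.2)).
  have -> : \int[lam]_z T z = L.
    rewrite LE; apply: eq_Rintegral => z _; apply: eq_Rintegral => z' _.
    by rewrite mean_chf_shift.
  apply: (@le_trans _ _ (\int[mu]_a (M * (8 * pi * r) ^+ d))); last first.
    by rewrite Rintegral_cst// [X in fine X](@probability_setT _ _ _ mu) mulr1.
  rewrite /L; apply: le_Rintegral => //.
  - have mE : measurable_fun setT (fun a => \int[mu]_x energy lam w (vsub x a)).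
      apply: (@measurable_Rintegral _ _ _ _ _ mu (fun p => energy lam w (vsub p.2 p.1)) (fun=> 2 * ((2 * r) ^+ d) ^+ 2)).
      + apply: (measurableT_comp me).
        by apply: measurable_vsub; [exact: measurable_snd|exact: measurable_fst].
      + by move=> a x /=; rewrite ger0_norm ?energy_ge0 ?energy_le.
      + exact: finite_measure_integrable_cst.
    rewrite (_ : EFin \o _ = EFin \o (fun a => \int[mu]_x energy lam w (vsub x a))); last first.
      by apply/funext => a /=; rewrite mean_energy.
    apply: (@dominated_integrable _ _ _ mu _ (fun=> M * (8 * pi * r) ^+ d)) => //.
      by move=> a; rewrite ger0_norm ?mean_le// Rintegral_ge0// => x _; exact: energy_ge0.
    exact: finite_measure_integrable_cst.
  - exact: finite_measure_integrable_cst.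
  - by move=> a _; rewrite -mean_energy.
pose psi u : R := \1_(cube s) u * chf_sqr u.
have psi0 u : 0 <= psi u by rewrite mulr_ge0 ?indic_ge0 ?chf_sqr_ge0.
have mpsi : measurable_fun setT psi.
  by apply: measurable_funM; [exact: measurable_indic (measurable_cube s)|exact: measurable_chf_sqr].
have ics : lam.-integrable setT (EFin \o \1_(cube s)) by exact: integrable_indic_cube (ltW s0).
have ipsi : lam.-integrable setT (EFin \o psi).
  apply: (dominated_integrable mpsi _ ics) => u.
  by rewrite ger0_norm// ler_piMr ?indic_ge0 ?chf_sqr_le1.
pose J := \int[lam]_u psi u.
have J0 : 0 <= J by rewrite Rintegral_ge0.
have mTf : measurable_fun setT (fun p => w p.1 * w p.2 * chf_sqr (vsub p.2 p.1)).
  apply: measurable_funM => //; apply: measurable_funM.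
    exact: (measurableT_comp mw measurable_fst).
  exact: (measurableT_comp mw measurable_snd).
have Tf_le z z' : `|w z * w z' * chf_sqr (vsub z' z)| <= w z * w z'.
  by rewrite ger0_norm ?mulr_ge0 ?chf_sqr_ge0// ler_piMr ?mulr_ge0 ?chf_sqr_le1.
have iT : lam.-integrable setT (EFin \o T).
  exact: (integrable_Rintegral mTf Tf_le w0 iw iw).
have low : (2 * s) ^+ d * J <= \int[lam]_z T z.
  rewrite -(@Rintegral_indic_cube _ _ lam _ Hlam (ltW s0)) mulrC -RintegralZl//.
  apply: le_Rintegral; [exact: measurableT|exact: integrableZl_R|exact: iT|].
  move=> z _; have [zs|zs] := pselect (cube s z); last first.
    have -> : \1_(cube s) z = 0 :> R by rewrite indicE memNset.
    rewrite mulr0; apply: Rintegral_ge0 => z' _.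
    by rewrite mulr_ge0 ?chf_sqr_ge0// mulr_ge0.
  have -> : \1_(cube s) z = 1 :> R by rewrite indicE mem_set.
  rewrite mulr1 /J -(Rintegral_translate z mpsi psi0).
  apply: le_Rintegral => //.
  - apply/integrableP; split.
      apply/measurable_EFinP; apply: (measurableT_comp mpsi).
      by apply: measurable_vsub => //; exact: measurable_cst.
    under eq_integral do rewrite gee0_abs ?lee_fin//.
    apply: (@le_lt_trans _ _ (J%:E)); last by rewrite ltry.
    apply: Rintegral_translate_le => //.
    by rewrite /J /Rintegral fineK//; exact: integrable_fin_num ipsi.
  - exact: (integrable_section mTf Tf_le iw).
  move=> z' _; rewrite /psi; have [zz|zz] := pselect (cube s (vsub z' z)); last first.
    by rewrite indicE memNset// mul0r !mulr_ge0// chf_sqr_ge0.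
  have -> : w z = 1.
    by rewrite /w indicE mem_set//; apply: cube_mono zs; rewrite /r; lra.
  have -> : w z' = 1.
    rewrite /w indicE mem_set// => i; have := zs i; have := zz i.
    by rewrite !tnth_mktuple /r; lra.
  by rewrite indicE mem_set// !mul1r.
rewrite integral_mkcond (_ : (\int[lam]_u _)%E = J%:E); last first.
  rewrite /J /Rintegral fineK; last exact: integrable_fin_num ipsi.
  apply: eq_integral => u _; rewrite patchE /psi indicE.
  by case: ifPn => _; rewrite ?mul1r ?mul0r.
have p0 : 0 < (2 * s) ^+ d by rewrite exprn_gt0// mulr_gt0.
rewrite lee_fin -(ler_pM2l p0); apply: (le_trans low); apply: (le_trans total).
rewrite le_eqVlt; apply/orP; left; apply/eqP.
by rewrite -/r exprMn; ring.
Qed.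

End law.

(** * Fourier bounds and scaling of the exponent *)

Section semigroup_integral.
Variables (R : realType) (d : nat) (A : 'M[R]_d).
Variable N : {sigma_finite_measure set (d.-tuple R) -> \bar R}.
Variable lam : {sigma_finite_measure set (d.-tuple R) -> \bar R}.
Hypotheses (HA : sym_nonneg_def A) (HN : levy_measure N).
Hypothesis Hh0 : hfun A N r @[r --> 0^'+] --> +oo%E.
Hypothesis Hlam : is_lebesgue_tuple lam.
Implicit Types (x y z : d.-tuple R) (r s t : R).
Local Notation RePsi := (RePsi A N).
Local Notation PsiStar := (PsiStar A N).
Local Notation h := (hR A N).
Local Notation hinv := (hinv A N).

Lemma measurable_RePsi : measurable_fun setT RePsi.
Proof.
apply: measurable_funD.
  apply: measurable_ip => //; apply/measurable_fun_tnthP => i.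
  rewrite (_ : _ \o _ = fun x => \sum_(j < d) A i j * tnth x j).
    by apply: measurable_sum => j; apply: measurable_funM => //; exact: measurable_tnth.
  by apply/funext => x /=; rewrite tnth_mktuple.
apply: measurableT_comp => //.
apply: (@measurable_fun_fubini_tonelli_F _ _ _ _ _ N (fun p => (1 - cos (ip p.1 p.2))%:E)).
  apply/measurable_EFinP; apply: measurable_funB => //.
  apply: (measurableT_comp (continuous_measurable_fun (@continuous_cos R))).
  by apply: measurable_ip; [exact: measurable_fst|exact: measurable_snd].
by move=> p; rewrite lee_fin one_sub_cos_ge0.
Qed.

Lemma measurable_exp_RePsi t : measurable_fun setT (fun z => expR (- t * RePsi z)).
Proof.
apply: measurableT_comp => //; apply: measurable_funM => //; exact: measurable_RePsi.
Qed.

(** Doubling gives h(r / 2^n) <= 4^n h(r), which carries positivity near 0 to every radius. *)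
Lemma h_gt0 r : 0 < r -> 0 < h r.
Proof.
move=> r0; have [e e0 H] := h_blows_up HN Hh0 0.
have it n : h (r / 2 ^+ n) <= 4 ^+ n * h r.
  elim: n => [|n ih]; first by rewrite !expr0 divr1 mul1r.
  have := hR_double A HN (r := r / 2 ^+ n.+1).
  rewrite divr_gt0 ?exprn_gt0// => /(_ isT) /le_trans; apply.
  rewrite (exprS 4) -mulrA ler_pM2l//.
  by rewrite (_ : 2 * (r / 2 ^+ n.+1) = r / 2 ^+ n)// exprS; field; rewrite expf_neq0.
have [n hn] : exists n, r / e < 2 ^+ n.
  exists (Num.bound (r / e)); apply: (@lt_trans _ _ (Num.bound (r / e))%:R).
    by apply: archi_boundP; rewrite divr_ge0 ?(ltW r0) ?(ltW e0).
  by rewrite -natrX ltr_nat ltn_expl.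
have p2 : 0 < 2 ^+ n :> R by rewrite exprn_gt0.
have := H (r / 2 ^+ n); rewrite divr_gt0// => /(_ isT).
rewrite ltr_pdivrMr// mulrC -ltr_pdivrMr// => /(_ hn) /lt_le_trans /(_ (it n)).
by rewrite pmulr_rgt0// exprn_gt0.
Qed.

Lemma norm_ge_notin_cube r z : ~ cube r z -> r <= enorm z.
Proof.
move=> zr; rewrite leNgt; apply/negP => zr'; apply: zr => i; rewrite !tnth_mktuple.
by have := le_lt_trans (abs_tnth_le_enorm z i) zr'; rewrite ltr_norml => /andP[-> /ltW].
Qed.

Lemma norm_le_cube r z : cube r z -> enorm z <= d%:R * r.
Proof.
move=> zr; apply: enorm_le_max => i; have := zr i; rewrite !tnth_mktuple.
by rewrite ler_norml => /andP[/ltW -> ->].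
Qed.

(** From v <= e^v at v = u / m. Decay of a high polynomial order is all that is needed to beat the
    volumes of the shells. *)
Lemma expRN_le_pow (u : R) m : 0 < u -> (0 < m)%N -> expR (- u) <= (m%:R / u) ^+ m.
Proof.
move=> u0 m0; have mp : 0 < m%:R :> R by rewrite ltr0n.
have -> : expR (- u) = (expR (- (u / m%:R))) ^+ m.
  by rewrite -expRM_natl; congr expR; field; rewrite gt_eqF.
have H : expR (- (u / m%:R)) <= m%:R / u.
  rewrite expRN -[leRHS]invrK lef_pV2 ?posrE ?expR_gt0 ?invr_gt0 ?divr_gt0// invf_div.
  by have := expR_ge1Dx (u / m%:R); lra.
by apply: lerXn2r => //; rewrite nnegrE ?expR_ge0// divr_ge0// ltW.
Qed.

(* Dyadic shells: past radius [2^n r0] the exponent is at least [q 2^(n a)]. *)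
Lemma shell_integral (g : d.-tuple R -> R) (r0 q a : R) m : (0 < m)%N -> d.+1%:R <= a * m%:R -> 0 < r0 -> 0 < q -> 0 < a ->
  measurable_fun setT g -> (forall z, 0 <= g z) ->
  (forall n z, ~ cube (2 ^+ n * r0) z -> q * (2 ^+ n) `^ a <= g z) ->
  (\int[lam]_z (expR (- g z))%:E <=
    (2 ^+ d.+1 * (2 ^+ d.+1 * (m%:R / q) ^+ m + 1) * r0 ^+ d)%:E)%E.
Proof.
move=> m0 am r00 q0 a0 mg g0 gn.
pose B := 2 ^+ d.+1 * (m%:R / q) ^+ m + 1.
have mq0 : 0 <= (m%:R / q) ^+ m by apply: exprn_ge0; apply: divr_ge0 => //; exact: ltW.
have B1 : 1 <= B by rewrite /B lerDr; apply: mulr_ge0 => //; exact: exprn_ge0.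
(* [b n] bounds the integrand on the shell between [Q (n-1)] and [Q n], hence the shift of the
   index; on the central cube the trivial bound 1 is used. *)
pose b n : R := if n is k.+1 then expR (- (q * (2 ^+ k) `^ a)) else 1.
have b0 n : 0 <= b n by case: n => // n; exact: expR_ge0.
pose Q n : set (d.-tuple R) := cube (2 ^+ n * r0).
have pw n : 0 <= 2 ^+ n * r0 by rewrite mulr_ge0 ?exprn_ge0 ?ltW.
(* The hypothesis d + 1 <= a m leaves one power of 2^n beyond the volume growth 2^(n d), so the
   series becomes geometric. The summand 1 in [B] takes care of n = 0. *)
have bB n : b n * 2 ^+ (n * d) <= B * 2 ^- n.
  case: n => [|n]; first by rewrite mul0n !expr0 invr1 !mulr1.
  have P0 : 0 < (2 ^+ n) `^ a :> R by rewrite powR_gt0// exprn_gt0.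
  have h1 : b n.+1 <= (m%:R / q) ^+ m * (((2 ^+ n) `^ a) ^+ m)^-1.
    apply: (le_trans (expRN_le_pow _ m0)); first by rewrite mulr_gt0.
    by rewrite -exprVn -exprMn le_eqVlt; apply/orP; left; apply/eqP; congr (_ ^+ _); field; rewrite !gt_eqF.
  have h2 : (2 ^+ n) ^+ d.+1 <= ((2 ^+ n) `^ a) ^+ m :> R.
    rewrite -[leRHS]powR_mulrn ?powR_ge0// -powRrM -[leLHS]powR_mulrn ?exprn_ge0//.
    by apply: ler_powR => //; rewrite exprn_ege1// ler1n.
  have h3 : (((2 ^+ n) `^ a) ^+ m)^-1 <= ((2 ^+ n) ^+ d.+1)^-1 :> R.
    by rewrite lef_pV2 ?posrE// ?exprn_gt0// exprn_gt0.
    apply: (@le_trans _ _ ((m%:R / q) ^+ m * ((2 ^+ n) ^+ d.+1)^-1 * 2 ^+ (n.+1 * d))).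
    by rewrite ler_wpM2r ?exprn_ge0// (le_trans h1)// ler_wpM2l.
  apply: (@le_trans _ _ (2 ^+ d.+1 * (m%:R / q) ^+ m * 2 ^- n.+1)); last first.
    by rewrite ler_wpM2r ?invr_ge0 ?exprn_ge0// lerDl.
  rewrite le_eqVlt; apply/orP; left; apply/eqP.
  rewrite mulSn exprD -exprM mulnS exprD !exprS; field.
  by rewrite !expf_neq0.
have mQ n : measurable (Q n) by exact: measurable_cube.
have mterm n : measurable_fun setT (fun z => (b n * \1_(Q n) z)%:E).
  by apply/measurable_EFinP; apply: measurable_funM => //; exact: measurable_indic.
have term0 n z : (0 <= (b n * \1_(Q n) z)%:E)%E by rewrite lee_fin mulr_ge0 ?indic_ge0.
apply: (@le_trans _ _ (\int[lam]_z \sum_(n <oo) (b n * \1_(Q n) z)%:E)%E).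
  apply: ge0_le_integral => //.
  - by apply/measurable_EFinP; apply: measurableT_comp => //; exact: measurable_funN.
  - by apply: ge0_emeasurable_sum.
  - move=> z _.
    have [n0 zn0] : exists n, `[< Q n z >].
      have [k _ hk] : (\bigcup_k cube k%:R) z by rewrite cube_cover.
      exists (Num.bound (k%:R / r0)); apply/asboolP; apply: cube_mono hk.
      rewrite -ler_pdivrMr//; apply: ltW; apply: (@lt_trans _ _ (Num.bound (k%:R / r0))%:R).
        by apply: archi_boundP; rewrite divr_ge0 ?ler0n ?(ltW r00).
      by rewrite -natrX ltr_nat ltn_expl.
    (* The least [n] with [z] in [Q n] identifies the shell of [z]; that single term of the series
       already dominates the integrand. *)
    have [n /asboolP zn nmin] := ex_minnP (ex_intro (fun n => `[< Q n z >]) n0 zn0).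
    have gb : expR (- g z) <= b n.
      case: n zn nmin => [|n] zn nmin; first by rewrite /b -[leRHS]expR0 ler_expR oppr_le0.
      rewrite /b ler_expR lerN2; apply: gn => zn'.
      by have := nmin n; rewrite asboolT// => /(_ isT); rewrite ltnn.
    apply: (@le_trans _ _ (b n * \1_(Q n) z)%:E).
      by rewrite indicE mem_set// mulr1 lee_fin.
    rewrite (@nneseriesD1 _ (fun n => (b n * \1_(Q n) z)%:E) n)//.
    by rewrite leeDl// nneseries_ge0.
rewrite integral_nneseries//.
apply: (@le_trans _ _ (\sum_(n <oo) ((2 * r0) ^+ d * B * 2 ^- n)%:E)%E).
  apply: lee_nneseries => [n _ _|n _]; first by apply: integral_ge0.
  under eq_integral do rewrite EFinM.
  rewrite ge0_integralZl//; first last.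
  - by rewrite lee_fin.
  - by apply/measurable_EFinP; exact: measurable_indic.
  rewrite integral_indic// setIT /Q lebesgue_cube// -EFinM lee_fin.
  rewrite (_ : 2 * (2 ^+ n * r0) = 2 ^+ n * (2 * r0)); last by ring.
  rewrite exprMn -exprM mulrA -[leRHS]mulrA [leRHS]mulrC; apply: ler_wpM2r => //.
  by rewrite exprn_ge0// mulr_ge0// ltW.
have -> : (2 ^+ d.+1 * B * r0 ^+ d)%:E = ((2 * r0) ^+ d * B * 2)%:E :> \bar R.
  by congr (_%:E); rewrite exprMn exprS; ring.
under eq_eseriesr do rewrite EFinM.
rewrite nneseriesZl//.
rewrite [leRHS]EFinM lee_pmul2l ?lte_fin//.
  apply: lime_le; first by apply: is_cvg_nneseries => n _ _; rewrite lee_fin invr_ge0 exprn_ge0.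
  apply: nearW => n; rewrite sumEFin lee_fin.
  rewrite (_ : \sum_(0 <= i < n) _ = 2 - 2 * 2 ^- n); first by rewrite gerBl mulr_ge0 ?invr_ge0 ?exprn_ge0.
  elim: n => [|n ih]; first by rewrite big_nil expr0 invr1; ring.
  by rewrite big_nat_recr//= ih exprS; field; rewrite expf_neq0.
by rewrite mulr_gt0 ?exprn_gt0 ?mulr_gt0// (lt_le_trans ltr01).
Qed.

End semigroup_integral.

(** * Equivalence of the scaling condition with Fourier bounds *)

Section fourier_bound_and_scaling.
Variables (R : realType) (d : nat) (A : 'M[R]_d).
Variable N : {sigma_finite_measure set (d.-tuple R) -> \bar R}.
Variable lam : {sigma_finite_measure set (d.-tuple R) -> \bar R}.
Hypotheses (HA : sym_nonneg_def A) (HN : levy_measure N).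
Hypothesis Hh0 : hfun A N r @[r --> 0^'+] --> +oo%E.
Hypothesis Hlam : is_lebesgue_tuple lam.
Implicit Types (x y z : d.-tuple R) (r s t : R).
Local Notation RePsi := (RePsi A N).
Local Notation PsiStar := (PsiStar A N).
Local Notation h := (hR A N).
Local Notation hinv := (hinv A N).

Lemma C3_C2 T : (0 < T)%E -> C3 A N T ->
  exists T2, [/\ (0 < T2)%E, T = +oo%E -> T2 = +oo%E & C2 lam A N T2].
Proof.
move=> T0 [c3 [a [/andP[c30 c31] [/andP[a0 a2] [H1 H2]]]]].
have rT := recip_ge0 T0.
have [m m0 am] : exists2 m, (0 < m)%N & d.+1%:R <= a * m%:R.
  exists (Num.bound (d.+1%:R / a)).+1 => //; rewrite mulrC -ler_pdivrMr//; apply: ltW.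
  apply: lt_trans (archi_boundP _) _; first by rewrite divr_ge0// ltW.
  by rewrite ltr_nat.
have Ch0 := Ch_gt0 R d.
(* Both halves of (C3) are applied, each contributing one c3; the divisor 4 Ch comes from [S1]
   below. *)
pose q := c3 ^+ 2 / (4 * Ch R d).
have q0 : 0 < q by rewrite divr_gt0 ?exprn_gt0 ?mulr_gt0.
pose B := 2 ^+ d.+1 * (2 ^+ d.+1 * (m%:R / q) ^+ m + 1).
have B0 : 0 < B.
  rewrite mulr_gt0 ?exprn_gt0// ltr_wpDl// mulr_ge0 ?exprn_ge0//.
  by rewrite divr_ge0// ltW.
have key t : 0 < t -> recip T < (hinv t^-1)^-1 ->
    (\int[lam]_z (expR (- t * RePsi z))%:E <= (B * hinv t^-1 ^- d)%:E)%E.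
  move=> t0; set e := hinv t^-1 => rTe.
  have e0 : 0 < e by apply: (hinv_gt0 HA HN Hh0); rewrite invr_gt0.
  have ei0 : 0 < e^-1 by rewrite invr_gt0.
  rewrite -exprVn; under eq_integral do rewrite mulNr.
  apply: (shell_integral (q := q) (a := a) Hlam m0 am) => //.
  - by apply: measurable_funM => //; exact: measurable_RePsi.
  - by move=> z; rewrite mulr_ge0 ?(ltW t0)// RePsi_ge0.
  move=> n z /norm_ge_notin_cube zn.
  have p1 : 1 <= 2 ^+ n :> R by rewrite exprn_ege1// ler1n.
  (* Only radii strictly below e = hinv(1/t) are known to satisfy h > 1/t. The comparison is made at
     e / 2, and the doubling bound for [PsiStar] returns to 1/e at the cost of a factor 4. *)
  have S1 : 1 <= 4 * Ch R d * (t * PsiStar e^-1).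
    have e20 : 0 < e / 2 by rewrite divr_gt0.
    have ee : (e / 2)^-1 = 2 * e^-1 by rewrite invf_div.
    have H : t^-1 <= Ch R d * PsiStar (2 * e^-1).
      rewrite -ee; apply: ltW; apply: lt_le_trans (h_le_PsiStar HA HN e20).
      by apply: (lt_h_of_lt_hinv HN) => //; rewrite ltr_pdivrMr// ltr_pMr// ltr1n.
    rewrite -[leLHS](mulfV (lt0r_neq0 t0)) [leRHS]mulrCA ler_pM2l// (le_trans H)//.
    by rewrite [4 * _]mulrC -mulrA ler_pM2l// (PsiStar_double HA HN)// ltW.
  have n0 : recip T < 2 ^+ n * e^-1 by rewrite (lt_le_trans rTe)// ler_peMl// ltW.
  have R1 := H1 z (lt_le_trans n0 zn).
  have R2 := H2 _ _ p1 rTe.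
  have R3 : PsiStar (2 ^+ n * e^-1) <= PsiStar (enorm z).
    by apply: (PsiStar_mono HA HN) => //; rewrite mulr_ge0 ?exprn_ge0// ltW.
  have P0 : 0 <= (2 ^+ n) `^ a by exact: powR_ge0.
  apply: (@le_trans _ _ (t * (c3 * (c3 * (2 ^+ n) `^ a * PsiStar e^-1)))); last first.
    rewrite ler_pM2l// (le_trans _ R1)// ler_pM2l// (le_trans R2)//.
  rewrite (_ : t * _ = q * (2 ^+ n) `^ a * (4 * Ch R d * (t * PsiStar e^-1))).
    by rewrite ler_peMr// mulr_ge0// ltW.
  by rewrite /q; field; rewrite gt_eqF.
case: T T0 H1 H2 rT key => [T' | |]//= T0 _ _ rT key; last first.
  exists +oo%E; split => //; exists B; split => // t t0 _; apply: key => //.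
  by rewrite invr_gt0 (hinv_gt0 HA HN Hh0)// invr_gt0.
(* The new threshold forces hinv(1/t) <= T' / 2, so that 1/hinv(1/t) lies strictly above 1/T', where
   (C3) applies. *)
have T20 : 0 < T' / 2 by rewrite divr_gt0.
have hT := h_gt0 HN Hh0 T20.
have h10 : 0 < h (T' / 2) + 1 by rewrite addr_gt0.
exists ((h (T' / 2) + 1)^-1)%:E; split => //; first by rewrite lte_fin invr_gt0.
exists B; split => // t t0; rewrite lte_fin => tT; apply: key => //.
have : hinv t^-1 <= T' / 2.
  apply: (hinv_le HN) => //; rewrite -[leLHS]invrK lef_pV2 ?posrE ?invr_gt0//.
  by rewrite (le_trans (ltW tT))// lef_pV2 ?posrE// lerDl.
have e0 : 0 < hinv t^-1 by apply: (hinv_gt0 HA HN Hh0); rewrite invr_gt0.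
by move=> e1; rewrite ltf_pV2 ?posrE// (le_lt_trans e1)// ltr_pdivrMr// ltr_pMr// ltr1n.
Qed.

(** The exponent is 2 t since the integrand is the squared modulus of the characteristic function of
    [Y t]. The constant may depend neither on [t] nor on the cube. *)
Definition local_fourier_bound (T : \bar R) := exists c, 0 < c /\
  forall t, 0 < t -> (t%:E < T)%E -> forall s, 0 < s ->
  (\int[lam]_(z in cube s) (expR (- (2 * t) * RePsi z))%:E <= (c * hinv t^-1 ^- d)%:E)%E.

Lemma RePsi_scale2n n x : RePsi (vscale (2 ^+ n) x) <= 4 ^+ n * RePsi x.
Proof.
elim: n => [|n ih]; first by rewrite !expr0 mul1r vscale1.
rewrite !exprS -vscaleA -mulrA (le_trans (RePsi_double HA HN _))//.
by rewrite ler_pM2l.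
Qed.

Lemma integral_exp_ge t s M (F : set (d.-tuple R)) : 0 <= M -> measurable F -> F `<=` cube s ->
  (forall z, F z -> t * RePsi z <= M) ->
  ((expR (- M))%:E * lam F <= \int[lam]_(z in cube s) (expR (- t * RePsi z))%:E)%E.
Proof.
move=> M0 mF Fs FM.
have me := measurable_exp_RePsi A N t.
rewrite -integral_cst//.
apply: (@le_trans _ _ (\int[lam]_(z in F) (expR (- t * RePsi z))%:E)%E).
  apply: ge0_le_integral => //.
  - by move=> z _; rewrite lee_fin expR_ge0.
  - by apply/measurable_EFinP; exact: measurable_funTS.
  - by move=> z /FM h1; rewrite lee_fin ler_expR mulNr lerN2.
apply: ge0_subset_integral => //.
- exact: measurable_cube.
- by apply/measurable_EFinP; exact: measurable_funTS.
Qed.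

(** * Consequences of the local Fourier bound at one radius *)

Section at_radius.
Variables (c r : R).
Hypotheses (c0 : 0 < c) (r0 : 0 < r).
Hypothesis Hc : forall s, 0 < s ->
  (\int[lam]_(z in cube s) (expR (- (4 / h r^-1) * RePsi z))%:E <= (c * r ^+ d)%:E)%E.
Let tau := 4 / h r^-1.

Let tau0 : 0 < tau.
Proof. by rewrite divr_gt0// (h_gt0 HN Hh0)// invr_gt0. Qed.

(** From PsiStar(r) <= 2 h(1/r). The exponents 16 and 18 in the next two lemmas are built from this
    8. *)
Let tau_PsiStar : tau * PsiStar r <= 8.
Proof.
have i0 : 0 < r^-1 by rewrite invr_gt0.
have := PsiStar_le_h HA HN i0; rewrite invrK => H.
rewrite /tau mulrAC ler_pdivrMr ?(h_gt0 HN Hh0)//; lra.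
Qed.

(* If [RePsi x] were tiny, [RePsi] would stay bounded on disjoint cubes around
   [x, 2x, 4x, ...]. *)
Lemma PsiStar_le_RePsi x n : enorm x = r ->
  c * (2 * d%:R) ^+ d * expR 18 < n%:R -> PsiStar r <= 8 * 4 ^+ n * RePsi x.
Proof.
move=> xr nc; have dp := dim_gt0 HA HN Hh0; have dr : 0 < d%:R :> R by rewrite ltr0n.
have h0 : 0 < h r^-1 by rewrite (h_gt0 HN Hh0)// invr_gt0.
rewrite leNgt; apply/negP => small.
(* Each doubling of [x] multiplies [RePsi] by at most 4, so the assumption keeps tau RePsi at most 1
   at all the points 2^k x with k <= n. *)
have tx : 4 ^+ n * (tau * RePsi x) <= 1.
  have : tau * (8 * 4 ^+ n * RePsi x) < tau * PsiStar r by rewrite ltr_pM2l.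
  move: tau_PsiStar; set X := 4 ^+ n => h1 h2.
  have : 8 * (X * (tau * RePsi x)) < 8 by lra.
  lra.
(* A cube of half-side r/(4 d) lies in the ball of radius r/4; successive centres have norms r, 2 r,
   4 r and so on, hence the cubes are disjoint. *)
pose rho := r / (4 * d%:R).
have rho0 : 0 < rho by rewrite divr_gt0// mulr_gt0.
pose F k := vadd (vscale (- 2 ^+ k) x) @^-1` (cube rho).
have mF k : measurable (F k).
  rewrite -[F k]setTI; apply: measurable_translation => //; exact: measurable_cube.
have Fk k z : F k z -> exists2 w, enorm w <= r / 4 & z = vadd (vscale (2 ^+ k) x) w.
  move=> Fz; exists (vadd (vscale (- 2 ^+ k) x) z).
    apply: (le_trans (norm_le_cube Fz)); rewrite /rho le_eqVlt; apply/orP; left.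
    by apply/eqP; field; rewrite gt_eqF.
  by apply: eq_from_tnth => i; rewrite !tnth_mktuple; ring.
have nx k : enorm (vscale (2 ^+ k) x) = 2 ^+ k * r.
  by rewrite enorm_scale xr ger0_norm// exprn_ge0.
have upF k z : F k z -> enorm z <= 2 ^+ k * r + r / 4.
  by move=> /Fk[w wr ->]; rewrite (le_trans (enorm_add _ _))// nx lerD2l.
have loF k z : F k z -> 2 ^+ k * r - r / 4 <= enorm z.
  move=> /Fk[w wr ->]; rewrite lerBlDr -nx.
  rewrite {1}(_ : vscale _ x = vadd (vadd (vscale (2 ^+ k) x) w) (vscale (-1) w)).
    by rewrite (le_trans (enorm_add _ _))// lerD2l enorm_scale normrN1 mul1r.
  by apply: eq_from_tnth => i; rewrite !tnth_mktuple; ring.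
have disj i j z : (i < j)%N -> F i z -> F j z -> False.
  move=> ij /upF zi /loF zj; have := le_trans zj zi.
  have : 2 ^+ i.+1 * r <= 2 ^+ j * r by rewrite ler_pM2r// ler_weXn2l// ler1n.
  have : r <= 2 ^+ i * r by rewrite ler_peMl ?(ltW r0)// exprn_ege1// ler1n.
  rewrite (exprS 2 i); set X := 2 ^+ i; set Y := 2 ^+ j; clearbody X Y => *; move: r0; lra.
pose U := \big[setU/set0]_(k < n) F k.
have mU : measurable U by exact: bigsetU_measurable.
have lamU : lam U = ((r / (2 * d%:R)) ^+ d *+ n)%:E.
  rewrite /U measure_semi_additive_ord_I//; last first.
    apply/trivIsetP => i j _ _; rewrite neq_ltn => /orP[ij|ij];
      by rewrite -subset0 => z [zi zj]; apply: (disj _ _ z ij).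
  rewrite (eq_bigr (fun=> ((r / (2 * d%:R)) ^+ d)%:E)).
    by rewrite sumEFin sumr_const card_ord.
  move=> k _; apply: (eq_trans (lebesgue_translation _ Hlam (measurable_cube _))).
  apply: (eq_trans (lebesgue_cube Hlam (ltW rho0))); congr ((_ ^+ _)%:E).
  by rewrite /rho; field; rewrite gt_eqF.
have Un z : U z -> exists2 k, (k < n)%N & F k z.
  by rewrite /U -bigcup_mkord => -[k /= kn Fz]; exists k.
have bound : ((expR (- 18))%:E * lam U <= (c * r ^+ d)%:E)%E.
  apply: le_trans (Hc (s := 2 ^+ n * r + r) _); last first.
    by rewrite addr_gt0// mulr_gt0// exprn_gt0.
  apply: integral_exp_ge => //.
    move=> z /Un[k kn /upF zk].
    have s1 : enorm z < 2 ^+ n * r + r.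
      rewrite (le_lt_trans zk)// ler_ltD//; last by rewrite ltr_pdivrMr// ltr_pMr// ltr1n.
      by rewrite ler_pM2r// ler_weXn2l ?ler1n// ltnW.
    move=> i; rewrite !tnth_mktuple; have := le_lt_trans (abs_tnth_le_enorm z i) s1.
    by rewrite ltr_norml => /andP[-> /ltW].
  (* On each cube tau RePsi is at most 2 * 1 + 2 * 8 = 18 by subadditivity: 1 from the centre, 8
     from the displacement. *)
  move=> z /Un[k kn /Fk[w wr ->]].
  have a1 : tau * RePsi (vscale (2 ^+ k) x) <= 1.
    apply: le_trans tx; rewrite mulrCA ler_pM2l// (le_trans (RePsi_scale2n k x))//.
    rewrite ler_wpM2r ?RePsi_ge0// ler_weXn2l ?ler1n// ltnW//.
  have a2 : tau * RePsi w <= 8.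
    apply: le_trans tau_PsiStar; rewrite ler_pM2l//; apply: (RePsi_le_PsiStar HA HN).
    by rewrite (le_trans wr)// ler_pdivrMr// ler_peMr ?(ltW r0)// ler1n.
  have := RePsi_add HA HN (vscale (2 ^+ k) x) w.
  rewrite -(ler_pM2l tau0) => /le_trans; apply; lra.
move: bound; rewrite lamU -EFinM lee_fin -[_ *+ n]mulr_natr expRN => bound.
have rd : 0 < r ^+ d by rewrite exprn_gt0.
suff : n%:R <= c * (2 * d%:R) ^+ d * expR 18 by rewrite leNgt nc.
have E18 := expR_gt0 (18 : R).
have D0 : 0 < (2 * d%:R) ^+ d :> R by rewrite exprn_gt0// mulr_gt0.
move: bound; rewrite expr_div_n.
rewrite (_ : (expR 18)^-1 * _ = n%:R * (r ^+ d / ((2 * d%:R) ^+ d * expR 18))).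
  rewrite mulrA ler_pdivrMr ?mulr_gt0// => H.
  by rewrite -(ler_pM2r rd) (le_trans H)// le_eqVlt; apply/orP; left; apply/eqP; ring.
by field; rewrite !gt_eqF.
Qed.

(** Failure would keep tau RePsi at most 16 on the cube of half-side L r / d, which lies in the ball
    of radius L r. Here 2 L / d is at least 1 + c e^16, hence so is its d-th power, and the volume
    of the cube exceeds what the Fourier bound allows. The summand 2 gives L >= 2, as needed for
    iterating. *)
Lemma PsiStar_growth : 
  2 * PsiStar r <= PsiStar ((d%:R * (1 + c * expR 16) + 2) * r).
Proof.
set L := d%:R * _ + 2; have dp := dim_gt0 HA HN Hh0; have dr : 0 < d%:R :> R by rewrite ltr0n.
have cE : 0 < c * expR 16 by rewrite mulr_gt0 ?expR_gt0.
have L0 : 0 < L by rewrite addr_gt0// mulr_gt0// addr_gt0.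
rewrite leNgt; apply/negP => small.
pose s := L * r / d%:R.
have s0 : 0 < s by rewrite divr_gt0// mulr_gt0.
have bound : ((expR (- 16))%:E * lam (cube s) <= (c * r ^+ d)%:E)%E.
  apply: le_trans (Hc s0); apply: integral_exp_ge => //; first exact: measurable_cube.
  move=> z /norm_le_cube; rewrite /s mulrCA divff ?gt_eqF// mulr1.
  move=> /(RePsi_le_PsiStar HA HN) zL.
  apply: (@le_trans _ _ (tau * (2 * PsiStar r))).
    by rewrite ler_pM2l// (le_trans zL)// ltW.
  by move: tau_PsiStar; lra.
move: bound; rewrite lebesgue_cube ?(ltW s0)// -EFinM lee_fin.
rewrite (_ : 2 * s = (2 * L / d%:R) * r); last by rewrite /s; field; rewrite gt_eqF.
rewrite exprMn mulrA ler_pM2r ?exprn_gt0// expRN mulrC ler_pdivrMr ?expR_gt0//.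
apply/negP; rewrite -ltNge.
have l1 : 1 + c * expR 16 <= 2 * L / d%:R.
  rewrite ler_pdivlMr// mulrC /L; have := mulr_gt0 dr (addr_gt0 ltr01 cE); lra.
apply: (@lt_le_trans _ _ (1 + c * expR 16)); first by lra.
apply: (le_trans l1); rewrite -[leLHS]expr1; apply: ler_weXn2l => //.
by rewrite (le_trans _ l1)//; lra.
Qed.

End at_radius.

Lemma local_fourier_bound_C3 T : (0 < T)%E -> local_fourier_bound T ->
  exists T3, [/\ (0 < T3)%E, T = +oo%E -> T3 = +oo%E & C3 A N T3].
Proof.
move=> T0 [c [c0 Hc]].
have dp := dim_gt0 HA HN Hh0; have dr : 0 < d%:R :> R by rewrite ltr0n.
(* The blow-up of [h] at 0 makes the time 2 / h(1/r) smaller than [T] for all large [r]. *)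
have [T3 [T30 TT3 HT3]] : exists T3 : \bar R, [/\ (0 < T3)%E, T = +oo%E -> T3 = +oo%E &
    forall r, recip T3 < r -> ((2 / h r^-1)%:E < T)%E].
  case: T T0 {Hc} => [T'| |]// T0; last by exists +oo%E; split => // r _; rewrite ltry.
  have [e e0 He] := h_blows_up HN Hh0 (2 / T').
  exists e%:E; split => // r /= er.
  have r0 : 0 < r by rewrite (lt_trans _ er)// invr_gt0.
  have ri : 0 < r^-1 by rewrite invr_gt0.
  have := He _ ri; rewrite -[X in _ < X]invrK ltf_pV2 ?posrE ?invr_gt0// => /(_ er).
  by rewrite lte_fin !ltr_pdivrMr ?(h_gt0 HN Hh0)// mulrC.
have rT3 := recip_ge0 T30.
have H r : recip T3 < r -> forall s, 0 < s ->
  (\int[lam]_(z in cube s) (expR (- (4 / h r^-1) * RePsi z))%:E <= (c * r ^+ d)%:E)%E.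
  move=> rr s s0.
  have r0 : 0 < r by rewrite (le_lt_trans rT3).
  have ri : 0 < r^-1 by rewrite invr_gt0.
  have h0 := h_gt0 HN Hh0 ri.
  have := Hc (2 / h r^-1); rewrite divr_gt0// => /(_ isT (HT3 _ rr) _ s0).
  rewrite (_ : 2 * (2 / _) = 4 / h r^-1); last by field; rewrite gt_eqF.
  move=> /le_trans; apply; rewrite lee_fin ler_pM2l// invf_div -exprVn.
  (* The factor 2 in the time enters here: h(1/r) / 2 is strictly below h(1/r), so the one-sided
     relation for [hinv] applies. *)
  have g : r^-1 <= hinv (h r^-1 / 2).
    apply: (hinv_ge HA HN) => //; first by rewrite divr_gt0.
    by rewrite ltr_pdivrMr// ltr_pMr// ltr1n.
  have g0 := lt_le_trans ri g.
  apply: lerXn2r; rewrite ?nnegrE ?invr_ge0 ?(ltW g0) ?(ltW r0)//.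
  by rewrite -[leRHS]invrK lef_pV2 ?posrE.
pose L := d%:R * (1 + c * expR 16) + 2.
have cE : 0 < c * expR 16 by rewrite mulr_gt0 ?expR_gt0.
have L2 : 2 <= L by rewrite lerDr mulr_ge0 ?(ltW dr)// addr_ge0 ?ltW.
have rpos r : recip T3 < r -> 0 < r by move=> rr; rewrite (le_lt_trans rT3).
have [a a02 growth] : exists2 a, 0 < a <= 2 & forall l r, 1 <= l -> recip T3 < r ->
    2^-1 * l `^ a * PsiStar r <= PsiStar (l * r).
  apply: (@geometric_growth _ _ (recip T3) L) => //.
  - by rewrite (lt_le_trans _ L2)// ltr1n.
  - by rewrite ltr1n.
  - by rewrite expr2 (le_trans L2)// ler_peMr//; lra.
  - by move=> r /rpos /ltW /(PsiStar_ge0 HA HN).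
  - by move=> r s /rpos /ltW r0 rs; exact: (PsiStar_mono HA HN).
  - by move=> r rr; apply: PsiStar_growth => //; [exact: rpos|exact: H].
pose n := Num.bound (c * (2 * d%:R) ^+ d * expR 18).
have hn : c * (2 * d%:R) ^+ d * expR 18 < n%:R.
  apply: archi_boundP; rewrite !mulr_ge0 ?expR_ge0 ?(ltW c0)// exprn_ge0// mulr_ge0// ltW.
have X1 : 1 <= 4 ^+ n :> R by rewrite exprn_ege1// ler1n.
have X0 : 0 < 8 * 4 ^+ n :> R by rewrite mulr_gt0 ?exprn_gt0.
exists T3; split => //; exists (8 * 4 ^+ n)^-1, a; split; last split => //.
  by rewrite invr_gt0 X0 invf_le1//; lra.
split => [x xr|l r l1 rr].
  rewrite mulrC ler_pdivrMr// mulrC.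
  by apply: (@PsiStar_le_RePsi c) => //; [exact: rpos|exact: H].
apply: le_trans (growth _ _ l1 rr).
rewrite ler_wpM2r ?(PsiStar_ge0 HA HN) ?(ltW (rpos _ rr))//.
rewrite ler_wpM2r ?powR_ge0// lef_pV2 ?posrE//; lra.
Qed.

End fourier_bound_and_scaling.

(** * The law of the process *)

(** Markov's inequality for min(1, |z|^2) bounds the mass of the sets |z| >= 1/(n+1); the origin,
    which they miss, has measure 0. *)
Lemma levy_sigma_finite (R : realType) (d : nat) (N : {measure set (d.-tuple R) -> \bar R}) :
  levy_measure N -> sigma_finite setT N.
Proof.
move=> [N0 Nint].
have mn : measurable_fun setT (@enorm R d) by exact: measurable_enorm.
pose E n := [set z : d.-tuple R | n.+1%:R^-1 <= enorm z].
pose Z := [set z : d.-tuple R | enorm z <= 0].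
have mE n : measurable (E n).
  rewrite (_ : E n = setT `&` (@enorm R d) @^-1` `[n.+1%:R^-1, +oo[).
    by apply: mn => //; exact: measurable_itv.
  by rewrite setTI; apply/seteqP; split => z; rewrite /E /= in_itv/= andbT.
have mZ : measurable Z.
  rewrite (_ : Z = setT `&` (@enorm R d) @^-1` `]-oo, 0]).
    by apply: mn => //; exact: measurable_itv.
  by rewrite setTI; apply/seteqP; split => z; rewrite /Z /= in_itv.
have Z0 : Z = [set vzero R d].
  apply/seteqP; split => [z /= z0|z ->]; last by rewrite /Z /= enorm0.
  by apply: enorm0_eq; apply/eqP; rewrite eq_le z0 enorm_ge0.
have mm : measurable_fun setT (fun z : d.-tuple R => (Num.min 1 (enorm z ^+ 2))%:E).
  apply/measurable_EFinP; apply: measurable_minr => //.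
  by apply: (measurable_funX 2).
have m0 z : (0 <= (Num.min 1 (enorm z ^+ 2))%:E)%E.
  by rewrite lee_fin le_min ler01 sqr_ge0.
exists (fun n => E n `|` Z).
  apply/esym/seteqP; split => // z _.
  have [z0|z0] := leP (enorm z) 0; first by exists 0%N => //; right.
  exists (Num.bound (enorm z)^-1) => //; left; rewrite /E /= -[leRHS]invrK lef_pV2 ?posrE ?invr_gt0//.
  apply: ltW; apply: lt_trans (archi_boundP _) _; first by rewrite invr_ge0 ltW.
  by rewrite ltr_nat.
move=> n; split; first exact: measurableU.
apply: (@le_lt_trans _ _ (N (E n) + N Z)%E); first exact: measureU2.
have e0 : 0 < n.+1%:R ^- 2 :> R by rewrite invr_gt0 exprn_gt0.
rewrite Z0 N0 adde0 -(@lte_pmul2l _ (n.+1%:R ^- 2)%:E)// mulry gtr0_sg// mul1e.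
apply: le_lt_trans Nint; rewrite -integral_cst//.
apply: (@le_trans _ _ (\int[N]_(z in E n) (Num.min 1 (enorm z ^+ 2))%:E)%E).
  apply: ge0_le_integral => //.
  - by move=> z _; rewrite /= lee_fin ltW.
  - by apply: measurable_funTS.
  - move=> z Ez; rewrite /= lee_fin le_min invf_le1 ?exprn_gt0// exprn_ege1 ?ler1n//=.
    by rewrite -exprVn lerXn2r// nnegrE ?enorm_ge0.
by apply: ge0_subset_integral.
Qed.

Section equivalences.
Variables (R : realType) (d : nat) (A : 'M[R]_d).
Variable N : {sigma_finite_measure set (d.-tuple R) -> \bar R}.
Variable lam : {sigma_finite_measure set (d.-tuple R) -> \bar R}.
Variable b : d.-tuple R.
Hypotheses (HA : sym_nonneg_def A) (HN : levy_measure N).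
Hypothesis Hh0 : hfun A N r @[r --> 0^'+] --> +oo%E.
Hypothesis Hlam : is_lebesgue_tuple lam.
Variables (dO : measure_display) (Omega : measurableType dO) (P : probability Omega R).
Variable Y : R -> Omega -> d.-tuple R.
Hypotheses (mY : forall t, measurable_fun setT (Y t)) (HYt : has_triplet P Y A N b).

(** Taking the squared modulus removes the phase t Im Psi, so that only [RePsi] remains. *)
Lemma law_of_process t : 0 <= t -> exists mu : probability (d.-tuple R) R,
  (forall B, mu B = P [set w | B (Y t w)]) /\
  forall u, chf_sqr mu u = expR (- (2 * t) * RePsi A N u).
Proof.
move=> t0.
pose mix := isMeasurableFun.Build _ _ _ _ (Y t) (mY t).
pose X : {mfun Omega >-> d.-tuple R} := HB.pack (Y t) mix.
exists (distribution P X); split => // u.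
have mc : measurable_fun setT (EFin \o fun x => cos (ip x u)).
  by apply/measurable_EFinP; exact: measurable_cip.
have ms : measurable_fun setT (EFin \o fun x => sin (ip x u)).
  by apply/measurable_EFinP; exact: measurable_sip.
have [Hc Hs] := HYt t0 u.
have bint (f : Omega -> R) : measurable_fun setT f -> (forall w, `|f w| <= 1) ->
    P.-integrable setT (EFin \o f).
  move=> mf f1; apply: (@le_integrable _ _ _ _ _ _ _ (EFin \o cst 1)) => //.
  - exact/measurable_EFinP.
  - by move=> w _; rewrite /= lee_fin normr1.
  - exact: finite_measure_integrable_cst.
rewrite /chf_sqr; have -> : chf_cos (distribution P X) u = expR (- t * RePsi A N u) * cos (t * ImPsi N b u).
  rewrite /chf_cos /Rintegral (integral_distribution mc).
    transitivity (fine (\int[P]_w (cos (ip u (Y t w)))%:E)); last by rewrite Hc.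
    by congr fine; apply: eq_integral => w _; rewrite /= ipC.
  apply: bint => [|w]; last by rewrite ler_norml cos_geN1 cos_le1.
  by apply/measurable_EFinP; exact: (measurableT_comp mc (mY t)).
have -> : chf_sin (distribution P X) u = - (expR (- t * RePsi A N u) * sin (t * ImPsi N b u)).
  rewrite /chf_sin /Rintegral (integral_distribution ms).
    transitivity (fine (\int[P]_w (sin (ip u (Y t w)))%:E)); last by rewrite Hs.
    by congr fine; apply: eq_integral => w _; rewrite /= ipC.
  apply: bint => [|w]; last by rewrite ler_norml sin_geN1 sin_le1.
  by apply/measurable_EFinP; exact: (measurableT_comp ms (mY t)).
rewrite sqrrN !exprMn -mulrDr cos2Dsin2 mulr1 -expRM_natl; congr expR; ring.
Qed.

Lemma C1_local_fourier_bound T : C1 P Y lam A N T -> local_fourier_bound A N lam T.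
Proof.
move=> [_ [c1 [c10 H]]].
have p0 : 0 < (8 * pi) ^+ d :> R by rewrite exprn_gt0// mulr_gt0// pi_gt0.
exists ((8 * pi) ^+ d * c1); split; first by rewrite mulr_gt0.
move=> t t0 tT s s0.
have [p [[mp [pp0 dp]] pM]] := H t t0 tT.
have [mu [muE chfE]] := law_of_process (ltW t0).
have e0 : 0 < hinv A N t^-1 by rewrite (hinv_gt0 HA HN Hh0)// invr_gt0.
have M0 : 0 <= c1 * hinv A N t^-1 ^- d by rewrite mulr_ge0 ?(ltW c10)// invr_ge0 exprn_ge0// ltW.
under eq_integral do rewrite -chfE.
rewrite -mulrA; apply: chf_L2_bound => // B mB.
rewrite muE dp// -integral_cst//; apply: ge0_le_integral => //.
- by move=> x _; rewrite lee_fin.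
- by apply/measurable_EFinP; exact: measurable_funTS.
- by move=> x _; rewrite /= lee_fin.
Qed.

Lemma C2_local_fourier_bound T : C2 lam A N T -> local_fourier_bound A N lam T.
Proof.
move=> [c2 [c20 H]]; exists c2; split => // t t0 tT s s0.
apply: le_trans (H t t0 tT).
have m2 u : measurable_fun setT (fun z => (expR (- u * RePsi A N z))%:E).
  by apply/measurable_EFinP; exact: measurable_exp_RePsi.
apply: (@le_trans _ _ (\int[lam]_z (expR (- (2 * t) * RePsi A N z))%:E)%E).
  apply: ge0_subset_integral => //; first exact: measurable_cube.
apply: ge0_le_integral => //.
move=> z _; rewrite lee_fin ler_expR !mulNr lerN2 ler_wpM2r ?RePsi_ge0//.
by rewrite ler_peMl ?(ltW t0)// ler1n.
Qed.

Lemma C2_C1 T : (0 < T)%E -> C2 lam A N T -> C1 P Y lam A N T.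
Proof.
move=> T0 [c2 [c20 H]]; have d0 := dim_gt0 HA HN Hh0.
have C0 := Cdens_gt0 R d0.
have Kpos t : 0 < t -> 0 <= c2 * hinv A N t^-1 ^- d.
  by move=> t0; rewrite mulr_ge0 ?(ltW c20)// invr_ge0 exprn_ge0// ltW// (hinv_gt0 HA HN Hh0)// invr_gt0.
have density t K : 0 < t -> 0 <= K -> (\int[lam]_z (expR (- t * RePsi A N z))%:E <= K%:E)%E ->
    exists p, is_density P Y lam t p /\ forall x, p x <= Cdens R d * K.
  move=> t0 K0 HK; have [mu [muE chfE]] := law_of_process (ltW t0).
  have CK : 0 <= Cdens R d * K by rewrite mulr_ge0// ltW.
  have dom : forall B, measurable B -> (mu B <= (Cdens R d * K)%:E * lam B)%E.
    apply: (dominated_of_integrable_chf Hlam d0 (F := fun z => expR (- t * RePsi A N z))) => //.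
      exact: measurable_exp_RePsi.
    by move=> u; rewrite chfE -expRM_natl le_eqVlt; apply/orP; left; apply/eqP; congr expR; ring.
  have [p [mp pb pE]] := bounded_density CK dom.
  exists p; split => [|x]; last by have /andP[] := pb x.
  split => //; split => [x|B mB]; first by have /andP[] := pb x.
  by rewrite -muE pE.
split => [t t0|].
  (* (C1) asks for a density at every t > 0, whereas (C2) says nothing beyond [T]. As [RePsi] is
     nonnegative, the integral at [t] is at most the one at any earlier time, and [t'] is such a
     time below [T]. *)
  pose t' := if T is T'%:E then Num.min t (T' / 2) else t.
  have [t'0 t't t'T] : [/\ 0 < t', t' <= t & (t'%:E < T)%E].
    rewrite /t'; case: T T0 {H t'} => [T'| |]//= T'0; last by rewrite ltry.
    have T0' : 0 < T' by [].
    rewrite lt_min t0 divr_gt0// ge_min lexx lte_fin gt_min; split => //.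
    by rewrite ltr_pdivrMr// ltr_pMr// ltr1n orbT.
  have [|p [dp _]] := density t _ t0 (Kpos _ t'0); last by exists p.
  apply: le_trans (H t' t'0 t'T).
  have m2 u : measurable_fun setT (fun z => (expR (- u * RePsi A N z))%:E).
    by apply/measurable_EFinP; exact: measurable_exp_RePsi.
  apply: ge0_le_integral => //.
  by move=> z _; rewrite lee_fin ler_expR !mulNr lerN2 ler_wpM2r ?RePsi_ge0.
exists (Cdens R d * c2); split; first by rewrite mulr_gt0.
move=> t t0 tT; have [p [dp pK]] := density t _ t0 (Kpos _ t0) (H t t0 tT).
by exists p; split => // x; rewrite -mulrA.
Qed.

Lemma levy_equivalences :
  ((exists T1 : \bar R, (0 < T1)%E /\ C1 P Y lam A N T1) <->
     (exists T2 : \bar R, (0 < T2)%E /\ C2 lam A N T2)) /\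
  ((exists T2 : \bar R, (0 < T2)%E /\ C2 lam A N T2) <->
     (exists T3 : \bar R, (0 < T3)%E /\ C3 A N T3)) /\
  ((exists T3 : \bar R, (0 < T3)%E /\ C3 A N T3) <->
     (exists T4 : \bar R, (0 < T4)%E /\ C4 A N T4)) /\
  ((C1 P Y lam A N +oo \/ C2 lam A N +oo \/ C3 A N +oo \/ C4 A N +oo)%E ->
     (C1 P Y lam A N +oo /\ C2 lam A N +oo /\ C3 A N +oo /\ C4 A N +oo)%E).
Proof.
have p0 : (0 < +oo :> \bar R)%E by exact: ltry.
have F3 T T0 := local_fourier_bound_C3 HA HN Hh0 Hlam (T := T) T0.
have F32 T T0 := C3_C2 HA HN Hh0 Hlam (T := T) T0.
have F34 T T0 := C3_C4 HA HN (T := T) T0.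
have F43 T T0 := C4_C3 HA HN Hh0 (T := T) T0.
split; first split.
- move=> [T [T0 /C1_local_fourier_bound]] /(F3 _ T0)[T3 [T30 _]] /(F32 _ T30)[T2 [T20 _ H2]].
  by exists T2.
- by move=> [T [T0 /(C2_C1 T0)]]; exists T.
split; first split.
- by move=> [T [T0 /C2_local_fourier_bound]] /(F3 _ T0)[T3 [T30 _ H3]]; exists T3.
- by move=> [T [T0 /(F32 _ T0)[T2 [T20 _ H2]]]]; exists T2.
split; first split.
- by move=> [T [T0 /(F34 _ T0)]]; exists T.
- by move=> [T [T0 /(F43 _ T0)]]; exists T.
(* With threshold [+oo] no implication shrinks the range, so each condition passes through (C3) and
   from there to all four. *)
have F23 : C3 A N +oo -> C2 lam A N +oo by move=> /(F32 _ p0)[T [_ /(_ erefl) ->]].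
have all4 : C3 A N +oo -> [/\ C1 P Y lam A N +oo, C2 lam A N +oo, C3 A N +oo & C4 A N +oo].
  by move=> H3; split => //; [apply: C2_C1 => //; exact: F23|exact: F23|exact: F34].
suff H : C1 P Y lam A N +oo \/ C2 lam A N +oo \/ C3 A N +oo \/ C4 A N +oo -> C3 A N +oo.
  by move=> /H /all4[].
have L3 : local_fourier_bound A N lam +oo -> C3 A N +oo.
  by move=> /(F3 _ p0)[T [_ /(_ erefl) ->]].
move=> [/C1_local_fourier_bound/L3|[/C2_local_fourier_bound/L3|[|]]]//.
exact: F43.
Qed.

End equivalences.

Theorem theorem3p1 (R : realType) (d : nat)
  (lam : {measure set (d.-tuple R) -> \bar R}) (Hlam : is_lebesgue_tuple lam)
  (A : 'M[R]_d) (N : {measure set (d.-tuple R) -> \bar R}) (b : d.-tuple R)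
  (HA : sym_nonneg_def A) (HN : levy_measure N)
  (Hh0 : hfun A N r @[r --> 0^'+] --> +oo%E)
  (dO : measure_display) (Omega : measurableType dO) (P : probability Omega R)
  (Y : R -> Omega -> d.-tuple R)
  (HY : levy_process P Y) (HYt : has_triplet P Y A N b) :
  let C1' := C1 P Y lam A N in
  let C2' := C2 lam A N in
  let C3' := C3 A N in
  let C4' := C4 A N in
  ((exists T1 : \bar R, (0 < T1)%E /\ C1' T1) <-> (exists T2 : \bar R, (0 < T2)%E /\ C2' T2)) /\
  ((exists T2 : \bar R, (0 < T2)%E /\ C2' T2) <-> (exists T3 : \bar R, (0 < T3)%E /\ C3' T3)) /\
  ((exists T3 : \bar R, (0 < T3)%E /\ C3' T3) <-> (exists T4 : \bar R, (0 < T4)%E /\ C4' T4)) /\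
  ((C1' +oo%E \/ C2' +oo%E \/ C3' +oo%E \/ C4' +oo%E) ->
     C1' +oo%E /\ C2' +oo%E /\ C3' +oo%E /\ C4' +oo%E).
Proof.
(* Fubini and Radon-Nikodym are applied to sigma-finite measures; both given measures are
   sigma-finite and are replaced by equal ones that carry this structure. *)
have [M ME] := sigma_finite_measureE (levy_sigma_finite HN).
have [L LE] := sigma_finite_measureE (lebesgue_sigma_finite Hlam).
subst N lam; case: HY => mY _.
exact: (levy_equivalences HA HN Hh0 Hlam mY HYt).
Qed.
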